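(* For each $n\in\{0,1,2,\dots\}$ let $\bm P^{(n)}$ be a proper Beta Markov stick-breaking process with parameters $(N^{(n)},\bm\alpha^{(n)},\bm\beta^{(n)},P_0^{(n)})$ and weights $\bm w^{(n)}$, where: (H0) $N^{(0)}=0$ and $N^{(n)}\to\infty$; (H1) $\alpha^{(n)}_j\to\alpha_j>0$ and $\beta^{(n)}_j\to\beta_j>0$ as $n\to\infty$, for every $j\ge1$; (H2) with $F_j(v)=\mathcal I_v(\alpha_j,\beta_j)$ and $\Upsilon^{[j]}=F_j^{-1}\circ F_1$, one has $\sum_{j\ge1}\Upsilon^{[j]}(v)=\infty$ almost surely when $v\sim\mathrm{Beta}(\alpha_1,\beta_1)$; (H3) $P_0^{(n)}\to P_0$ weakly for some diffuse probability measure $P_0$. Then: (i) the length variables of $\bm P^{(0)}$ are independent with $v_j\sim\mathrm{Beta}(\alpha^{(0)}_j,\beta^{(0)}_j)$; in particular, if $\alpha^{(0)}_j=1-\sigma$ and $\beta^{(0)}_j=\theta+j\sigma$ with $0\le\sigma<1$, $\theta>-\sigma$, then $\bm P^{(0)}$ is a Pitman–Yor process. (ii) As $n\to\infty$, $\bm P^{(n)}\to\bm P$ weakly in distribution and $\bm w^{(n)}\to\bm w$ in distribution, where $\bm P$ is the completely dependent stick-breaking process with parameters $(\bm\pi,P_0)$, $\pi_j=\mathrm{Beta}(\alpha_j,\beta_j)$, and $\bm w$ its weights; in particular if $\alpha_j=1-\sigma$, $\beta_j=\theta+j\sigma$ with $0\le\sigma<1$, $\theta>-\sigma$, then $\bm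 w$ is a.s. non-increasing.
   Context: $\mathcal I_v(a,b)$ is the $\mathrm{Beta}(a,b)$ distribution function. Stick-breaking weights: $w_1=v_1$, $w_j=v_j\prod_{i<j}(1-v_i)$. A Beta Markov stick-breaking process with parameters $(N,\bm\alpha,\bm\beta,P_0)$ is $\bm P=\sum_jw_j\delta_{\theta_j}+(1-\sum_jw_j)P_0$ where $\bm v$ is a Markov chain with $v_1\sim\mathrm{Beta}(\alpha_1,\beta_1)$ and $\mathbb P[v_{j+1}\in du\mid v_j=v]=\sum_{z=0}^N\mathrm{Beta}(du\mid\alpha_{j+1}+z,\beta_{j+1}+N-z)\binom Nz\Upsilon_j(v)^z(1-\Upsilon_j(v))^{N-z}$, $\Upsilon_j=G_{j+1}^{-1}\circ G_j$ with $G_j(v)=\mathcal I_v(\alpha_j,\beta_j)$, $P_0$ diffuse on a complete separable metric space $\mathbb X$, and $\theta_j$ iid $P_0$ independent of $\bm w$. Proper: $\sum_jw_j=1$ a.s. The completely dependent stick-breaking process with parameters $(\bm\pi,P_0)$ (each $\pi_j$ with continuous strictly increasing distribution function $F_j$) uses $v_1\sim\pi_1$, $v_{j+1}=F_{j+1}^{-1}(F_j(v_j))$. The Pitman–Yor process corresponds to independent $v_j\sim\mathrm{Beta}(1-\sigma,\theta+j\sigma)$. $\bm P^{(n)}\to\bm P$ weakly in distribution means $\int f\,d\bm P^{(n)}\to\int f\,d\bm P$ in distribution for each bounded continuous $f$. *)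

(* Defs.v *)
From HB Require Import structures.
From mathcomp Require Import all_boot all_order all_algebra.
From mathcomp Require Import all_classical all_reals all_analysis.

Set Implicit Arguments.
Unset Strict Implicit.
Unset Printing Implicit Defensive.

Import Order.TTheory GRing.Theory Num.Theory.
Import numFieldNormedType.Exports.

Local Open Scope classical_set_scope.
Local Open Scope ring_scope.

(* Beta(a,b) distribution with real parameters a, b > 0 (the library only    *)
(* provides natural-number parameters).                                      *)
Section BetaDistribution.
Context {R : realType}.
Local Notation leb := (@lebesgue_measure R).

Definition beta_dens (a b : R) (x : R) : R :=
  if (0 < x) && (x < 1) then x `^ (a - 1) * (1 - x) `^ (b - 1) else 0.

Definition beta_const (a b : R) : R := fine (\int[leb]_x (beta_dens a b x)%:E).

Definition betaI (a b : R) (A : set R) (g : R -> \bar R) : \bar R :=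
  (\int[leb]_(x in A) (g x * (beta_dens a b x / beta_const a b)%:E))%E.

Definition betaM (a b : R) (A : set R) : \bar R := betaI a b A (fun=> 1%E).

Definition betaCDF (a b : R) (v : R) : R := fine (betaM a b `]-oo, v]).

Definition betaQ (a b : R) (p : R) : R :=
  inf [set u : R | (0 <= u <= 1) /\ p <= betaCDF a b u].
End BetaDistribution.

Definition Borel {R : realType} (X : completePseudoMetricType R) :=
  g_sigma_algebraType (@open X).

Definition separable {R : realType} (X : completePseudoMetricType R) : Prop :=
  exists D : set X, countable D /\ closure D = [set: X].

Definition diffuse {R : realType} {X : completePseudoMetricType R}
  (P0 : probability (Borel X) R) : Prop :=
  forall x : X, P0 [set x] = 0%E.

Definition bdd_fun {T : Type} {R : realType} (f : T -> R) : Prop :=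
  exists M : R, forall x, `|f x| <= M.

Definition weak_cvg {R : realType} {X : completePseudoMetricType R}
  (P : nat -> probability (Borel X) R) (Q : probability (Borel X) R) : Prop :=
  forall f : X -> R, continuous f -> bdd_fun f ->
    (fun n => (\int[P n]_x (f x)%:E)%E) @ \oo --> (\int[Q]_x (f x)%:E)%E.

(* Stick-breaking.  INDEXING: 0-based, i.e. v 0 = v_1, alpha 0 = alpha_1.    *)
Section StickBreaking.
Context {R : realType}.

Definition sbw {T : Type} (v : nat -> T -> R) (j : nat) (w : T) : R :=
  v j w * \prod_(i < j) (1 - v i w).

(* \int f dP  for  P = sum_j w_j delta_{theta_j} + (1 - sum_j w_j) P0 *)
Definition sb_integral {T : Type} {X : completePseudoMetricType R}
  (P0 : probability (Borel X) R) (v : nat -> T -> R) (th : nat -> T -> X)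
  (f : X -> R) (w : T) : R :=
  limn (series (fun j => sbw v j w * f (th j w)))
  + (1 - limn (series (fun j => sbw v j w))) * fine (\int[P0]_x (f x)%:E).

Definition Ups (al be : nat -> R) (j : nat) (v : R) : R :=
  betaQ (al j.+1) (be j.+1) (betaCDF (al j) (be j) v).

(* \int_A g(u) K_j(v, du) for the transition kernel from v_j to v_{j+1}:
   K_j(v,du) = sum_{z=0}^N Beta(du | al_{j+1}+z, be_{j+1}+N-z)
               C(N,z) Ups_j(v)^z (1-Ups_j(v))^(N-z) *)
Definition kerI (N : nat) (al be : nat -> R) (j : nat) (v : R)
  (A : set R) (g : R -> \bar R) : \bar R :=
  (\sum_(z < N.+1)
     ('C(N, z)%:R * Ups al be j v ^+ z * (1 - Ups al be j v) ^+ (N - z))%:E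
     * betaI (al j.+1 + z%:R) (be j.+1 + (N - z)%:R) A g)%E.

(* chainF N al be A k j u
   = P[v_{j+1} in A (j+1), ..., v_{j+k} in A (j+k) | v_j = u] *)
Fixpoint chainF (N : nat) (al be : nat -> R) (A : nat -> set R)
  (k j : nat) (u : R) : \bar R :=
  match k with
  | 0 => 1%E
  | k'.+1 => kerI N al be j u (A j.+1) (chainF N al be A k' j.+1)
  end.

(* (v, theta) on (Omega, Pr) is (the length/atom representation of) a Beta
   Markov stick-breaking process with parameters (N, al, be, P0):
   v Markov with the given initial law and kernels, theta iid P0,
   independent of v. *)
Definition is_BMSB {d : measure_display} {Omega : measurableType d}
  {X : completePseudoMetricType R} (Pr : probability Omega R)
  (N : nat) (al be : nat -> R) (P0 : probability (Borel X) R)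
  (v : nat -> Omega -> R) (th : nat -> Omega -> Borel X) : Prop :=
  [/\ (forall j, 0 < al j /\ 0 < be j), diffuse P0,
      (forall j, measurable_fun setT (v j)),
      (forall j, measurable_fun setT (th j)) &
      forall (k : nat) (A : nat -> set R) (B : nat -> set (Borel X)),
        (forall i, measurable (A i)) -> (forall i, measurable (B i)) ->
        Pr [set w | forall i, (i <= k)%N -> A i (v i w) /\ B i (th i w)]
        = (betaI (al 0%N) (be 0%N) (A 0%N) (chainF N al be A k 0%N)
           * \prod_(i < k.+1) P0 (B i))%E].

Definition proper_sb {d : measure_display} {Omega : measurableType d}
  (Pr : probability Omega R) (v : nat -> Omega -> R) : Prop :=
  {ae Pr, forall w, series (fun j => sbw v j w) @ \oo --> (1 : R)}.

Definition is_PY {d : measure_display} {Omega : measurableType d}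
  {X : completePseudoMetricType R} (Pr : probability Omega R)
  (sig tht : R) (P0 : probability (Borel X) R)
  (v : nat -> Omega -> R) (th : nat -> Omega -> Borel X) : Prop :=
  [/\ diffuse P0,
      (forall j, measurable_fun setT (v j)),
      (forall j, measurable_fun setT (th j)) &
      forall (k : nat) (A : nat -> set R) (B : nat -> set (Borel X)),
        (forall i, measurable (A i)) -> (forall i, measurable (B i)) ->
        Pr [set w | forall i, (i <= k)%N -> A i (v i w) /\ B i (th i w)]
        = (\prod_(i < k.+1) betaM (1 - sig) (tht + i.+1%:R * sig) (A i)
           * \prod_(i < k.+1) P0 (B i))%E].

Definition is_CDSB {d : measure_display} {Omega : measurableType d}
  {X : completePseudoMetricType R} (Pr : probability Omega R)
  (al be : nat -> R) (P0 : probability (Borel X) R)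
  (v : nat -> Omega -> R) (th : nat -> Omega -> Borel X) : Prop :=
  [/\ diffuse P0,
      measurable_fun setT (v 0),
      (forall j, measurable_fun setT (th j)),
      (forall j w, v j.+1 w = betaQ (al j.+1) (be j.+1) (betaCDF (al j) (be j) (v j w))) &
      forall (k : nat) (A : set R) (B : nat -> set (Borel X)),
        measurable A -> (forall i, measurable (B i)) ->
        Pr [set w | A (v 0 w) /\ forall i, (i <= k)%N -> B i (th i w)]
        = (betaM (al 0%N) (be 0%N) A * \prod_(i < k.+1) P0 (B i))%E].

Definition cvg_dist {dn : nat -> measure_display}
  {Omn : forall n, measurableType (dn n)} (Prn : forall n, probability (Omn n) R)
  (Y : forall n, Omn n -> R)
  {d : measure_display} {Omega : measurableType d} (Pr : probability Omega R)
  (Z : Omega -> R) : Prop :=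
  forall g : R -> R, continuous g -> bdd_fun g ->
    (fun n => (\int[Prn n]_w (g (Y n w))%:E)%E) @ \oo
      --> (\int[Pr]_w (g (Z w))%:E)%E.

Definition cvg_dist_seq {dn : nat -> measure_display}
  {Omn : forall n, measurableType (dn n)} (Prn : forall n, probability (Omn n) R)
  (Y : forall n, Omn n -> {ptws nat -> R})
  {d : measure_display} {Omega : measurableType d} (Pr : probability Omega R)
  (Z : Omega -> {ptws nat -> R}) : Prop :=
  forall g : {ptws nat -> R} -> R, continuous g -> bdd_fun g ->
    (fun n => (\int[Prn n]_w (g (Y n w))%:E)%E) @ \oo
      --> (\int[Pr]_w (g (Z w))%:E)%E.

End StickBreaking.

(* Main.v *)
Require Import Defs.
From HB Require Import structures.
From mathcomp Require Import all_boot all_order all_algebra.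
From mathcomp Require Import all_classical all_reals all_analysis.
From mathcomp Require Import measurable_realfun.
From mathcomp Require Import ring lra.
Import Order.TTheory GRing.Theory Num.Theory.
Import numFieldNormedType.Exports.
Set Implicit Arguments.
Unset Strict Implicit.
Unset Printing Implicit Defensive.
Local Open Scope classical_set_scope.
Local Open Scope ring_scope.

(** The transition kernel is a Binomial(N, Ups u) mixture of Beta laws whose mean
    is close to Ups u and whose variance is O(1/N); hence for large N the step
    v_(j+1) is close in probability to Ups_j(v_j), and by continuity of the
    quantile maps the whole sequence v is close to the deterministic image of v_1
    under the limit maps.  So E[G(v)] converges for every sequentially continuous
    bounded G, which gives the convergence of the weights.  For the process, the
    p-th moment of a truncated sum of w_j f(theta_j) expands into finitely many
    terms G(v) prod_j f(theta_j)^(m_j), whose expectations factor by independence;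
    the truncation error is at most prod_(i<k)(1 - v_i), whose limiting expectation
    tends to 0 with k because the limiting lengths have a divergent sum.  Convergence
    of all moments of variables in [0, 1] gives convergence in law.
    The limiting Pitman-Yor weights decrease because Beta(a, b) is stochastically
    decreasing in b.
    The lengths lie in (0, 1) only almost surely, so the argument is run for the
    lengths clipped to [0, 1] and transferred along null sets. *)

(** The law of the lengths is given only on rectangles, through nested kernel integrals, whereas
    closeness of [v_(j+1)] to a function of the random [v_j] is not a rectangle event; a finite grid
    on [0, 1] reconciles the two. Uniformity in the state comes each time from compactness of
    [0, 1], by refuting convergent sequences of counterexamples, since the joint continuity of Beta
    distribution and quantile functions in parameters and argument is proved along sequences.
    Replacing G(v) by a function of v_1 alone reduces independence to the first length and the
    atoms, whose joint law factors in the same way for the approximating processes and for the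
    limit. The truncation level k is chosen from the limit process and then transferred: at fixed k
    the expected remaining mass is itself a convergent quantity, which spares a tail bound uniform
    in n. Beta means and variances come from an integration by parts instead of the Gamma
    function. *)

(** * Integrability of the Beta densities with real parameters *)

Section BetaIntegrals.
Context {R : realType}.
Implicit Types (a b x : R).
Local Notation leb := (@lebesgue_measure R).

(** The intervals [exh i, 1 - exh i] exhaust ]0, 1[ and stay away from its ends, where the density
    may be singular, so the fundamental theorem of calculus applies on each. The shift by 3 gives
    [exh i < 1/2], so that they are nondegenerate from i = 0 on. *)
Definition exh (i : nat) : R := (i.+3%:R)^-1.

Lemma exh_itv i : 0 < exh i < 2^-1.
Proof.
rewrite /exh invr_gt0 ltr0n /= ltf_pV2 ?posrE ?ltr0n//.
by rewrite ltr_nat.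
Qed.

Lemma exh_lt i : exh i < 1 - exh i.
Proof. have /andP[] := exh_itv i; lra. Qed.

Lemma exh_cvg0 : exh @ \oo --> (0 : R).
Proof.
by have := @cvg_harmonic R; rewrite -(cvg_shiftn 2); apply: cvg_trans; apply: near_eq_cvg;
  apply: nearW => n; rewrite /exh /harmonic/= addn2.
Qed.

Lemma exh_nd : nondecreasing_seq (fun i => `[exh i, 1 - exh i]%classic).
Proof.
move=> i j ij; rewrite subsetEset => x /=; rewrite !in_itv/= => /andP[ix xi].
have h : exh j <= exh i by rewrite /exh lef_pV2 ?posrE ?ltr0n// ler_nat !ltnS.
by apply/andP; split; lra.
Qed.

Lemma exh_bigcup : \bigcup_i `[exh i, 1 - exh i]%classic = `]0, 1[%classic :> set R.
Proof.
apply/seteqP; split => [x [i _]/=|x /=]; rewrite !in_itv/=.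
  by have /andP[h1 h2] := exh_itv i; move=> /andP[? ?]; apply/andP; split; lra.
move=> /andP[x0 x1].
have h : 0 < Num.min x (1 - x) by rewrite lt_min x0 subr_gt0.
have := @cvgr0_norm_lt _ _ _ _ _ _ exh_cvg0 _ h.
move=> [n _ /(_ n (leqnn n))/=]; have /andP[h1 h2] := exh_itv n.
rewrite gtr0_norm// lt_min => /andP[? ?].
by exists n => //=; rewrite in_itv/=; apply/andP; split; lra.
Qed.

Lemma FTC_exh (f F : R -> R) i :
  (forall x, 0 < x < 1 -> {for x, continuous f}) ->
  (forall x, 0 < x < 1 -> is_derive x 1 F (f x)) ->
  (\int[leb]_(x in `[exh i, (1 - exh i)%R]) (f x)%:E = (F (1 - exh i) - F (exh i))%R%:E)%E.
Proof.
move=> cf dF; have /andP[e0 e1] := exh_itv i.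
have cF x : 0 < x < 1 -> {for x, continuous F}.
  move=> /dF h; apply: differentiable_continuous; apply/derivable1_diffP.
  by case: h.
rewrite (@continuous_FTC2 _ f F) ?EFinB//; first exact: exh_lt.
- apply: continuous_in_subspaceT => x; rewrite inE/= in_itv/= => /andP[? ?].
  by apply: cf; apply/andP; split; lra.
- split.
  + move=> x; rewrite in_itv/= => /andP[? ?].
    by apply: (@ex_derive _ _ _ x 1 F (f x)); apply: dF; apply/andP; split; lra.
  + by apply: cvg_at_right_filter; apply: cF; apply/andP; split; lra.
  + by apply: cvg_at_left_filter; apply: cF; apply/andP; split; lra.
- move=> x; rewrite in_itv/= => /andP[? ?].
  by rewrite derive1E; apply: (@derive_val _ _ _ x 1 F (f x)); apply: dF; apply/andP; split; lra.
Qed.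


Lemma ge0_integral_exh_cvg (f : R -> R) :
  measurable_fun (`]0, 1[%classic : set R) f ->
  (forall x, 0 < x < 1 -> 0 <= f x) ->
  (fun i => \int[leb]_(x in `[exh i, (1 - exh i)%R]) (f x)%:E)%E @ \oo -->
    (\int[leb]_(x in `]0%R, 1%R[) (f x)%:E)%E.
Proof.
move=> mf f0.
have sub i : `[exh i, 1 - exh i]%classic `<=` `]0, 1[%classic.
  by rewrite -exh_bigcup => x xi; exists i.
rewrite -exh_bigcup; apply: ge0_nondecreasing_set_cvg_integral.
- exact: exh_nd.
- by [].
- by move=> i; apply/measurable_EFinP; exact: measurable_funS mf.
- by move=> i x /sub/=; rewrite in_itv/= lee_fin; exact: f0.
Qed.

(** A primitive bounded by [C] keeps the integral over every exhausting interval below [C + C], and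
    monotone convergence passes this to ]0, 1[. *)
Lemma ge0_integral01_lty (f F : R -> R) (C : R) :
  measurable_fun (`]0, 1[%classic : set R) f ->
  (forall x, 0 < x < 1 -> 0 <= f x) ->
  (forall x, 0 < x < 1 -> {for x, continuous f}) ->
  (forall x, 0 < x < 1 -> is_derive x 1 F (f x)) ->
  (forall x, 0 < x < 1 -> `|F x| <= C) ->
  (\int[leb]_(x in `]0%R, 1%R[) (f x)%:E < +oo)%E.
Proof.
move=> mf f0 cf dF FC.
apply: (@le_lt_trans _ _ (C + C)%:E); last exact: ltry.
have cv := ge0_integral_exh_cvg mf f0.
rewrite -(cvg_lim (@ereal_hausdorff R) cv).
apply: lime_le; first by apply: (cvgP _ cv).
apply: nearW => i; rewrite (FTC_exh i cf dF) lee_fin.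
have /andP[e0 e1] := exh_itv i.
rewrite (le_trans (ler_norm _))// (le_trans (ler_normB _ _))// lerD// FC//; apply/andP; split; lra.
Qed.

Lemma beta_densE a b x : 0 < x < 1 -> beta_dens a b x = x `^ (a - 1) * (1 - x) `^ (b - 1).
Proof. by rewrite /beta_dens => ->. Qed.

Lemma beta_dens0 a b x : ~~ (0 < x < 1) -> beta_dens a b x = 0.
Proof. by rewrite /beta_dens => /negbTE ->. Qed.

Lemma beta_dens_ge0 a b x : 0 <= beta_dens a b x.
Proof. by rewrite /beta_dens; case: ifP => // _; rewrite mulr_ge0 ?powR_ge0. Qed.

Lemma measurable_powR1B p D : measurable_fun D (fun x : R => (1 - x) `^ p).
Proof.
apply: measurable_funTS; apply: (measurableT_comp (measurable_powR p)).
exact: measurable_funB.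
Qed.

Lemma beta_dens_patch a b :
  beta_dens a b = (fun x => x `^ (a - 1) * (1 - x) `^ (b - 1)) \_ (`]0, 1[%classic).
Proof.
apply/funext => x; rewrite /beta_dens patchE; case: ifPn => h.
  by rewrite mem_set//= in_itv.
by rewrite memNset//= in_itv/=; exact/negP.
Qed.

Lemma measurable_beta_dens a b : measurable_fun setT (beta_dens a b).
Proof.
rewrite beta_dens_patch; apply/(measurable_restrictT _ _).1 => //.
apply: measurable_funTS; apply: measurable_funM; last exact: measurable_powR1B.
exact: measurable_powR.
Qed.

Lemma is_derive_powR1B x p : x < 1 ->
  is_derive x 1 (fun x : R => (1 - x) `^ p) (- (p * (1 - x) `^ (p - 1))).
Proof.
move=> x1; have h : 0 < 1 - x by rewrite subr_gt0.
have h1 : is_derive x 1 (fun y : R => 1 - y) (- 1) by have := is_deriveB (is_derive_cst (1 : R) x 1) (is_derive_id x 1); rewrite sub0r.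
by have := @is_derive1_comp _ (fun y => y `^ p) (fun y => 1 - y) x _ _ (is_derive1_powR p h) h1; rewrite mulrN1.
Qed.

Lemma continuous_powR1 x p : 0 < x -> {for x, continuous (fun y : R => y `^ p)}.
Proof.
move=> x0; apply: differentiable_continuous; apply/derivable1_diffP.
by case: (is_derive1_powR p x0).
Qed.

Lemma continuous_powR1B x p : x < 1 -> {for x, continuous (fun y : R => (1 - y) `^ p)}.
Proof.
move=> x0; apply: differentiable_continuous; apply/derivable1_diffP.
by case: (is_derive_powR1B p x0).
Qed.

Lemma powR_le1 x p : 0 < x < 1 -> 0 <= p -> x `^ p <= 1.
Proof.
move=> /andP[x0 x1] p0.
by have := @ger_powR R x; rewrite x0 (ltW x1) => /(_ isT) /(_ _ _ p0); rewrite powRr0.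
Qed.

(** The absolute value covers both signs of the exponent: for y at most 1 the power only grows when
    p is replaced by -|p|, and then y = 1/2 is the worst case. *)
Lemma powR_half_bound (y p : R) : 2^-1 <= y <= 1 -> y `^ p <= ((2^-1) `^ `|p|)^-1.
Proof.
move=> /andP[y0 y1]; have yp : 0 < y by lra.
have h : y `^ p <= y `^ (- `|p|).
  by apply: ger_powR; [rewrite yp|rewrite lerNl -normrN ler_norm].
rewrite (le_trans h)// powRN lef_pV2 ?posrE ?powR_gt0//.
by apply: ge0_ler_powR => //; rewrite nnegrE; lra.
Qed.

Lemma integral_beta_dens_lty a b : 0 < a -> 0 < b ->
  (\int[leb]_x (beta_dens a b x)%:E < +oo)%E.
Proof.
move=> a0 b0.
(* The dominating function is the derivative of [x^a - (1 - x)^b], which is bounded by 2 on ]0,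
   1[. *)
pose f x : R := a * x `^ (a - 1) + b * (1 - x) `^ (b - 1).
have mf D : measurable_fun D f.
  apply: measurable_funTS; apply: measurable_funD.
    by apply: measurable_funM => //; exact: measurable_powR.
  by apply: measurable_funM => //; exact: measurable_powR1B.
have f0 x : 0 <= f x by rewrite addr_ge0// mulr_ge0 ?powR_ge0// ltW.
have lty : (\int[leb]_(x in `]0%R, 1%R[) (f x)%:E < +oo)%E.
  apply: (@ge0_integral01_lty _ (fun x => x `^ a - (1 - x) `^ b) 2) => //.
  - move=> x /andP[x0 x1]; apply: continuousD.
      by apply: continuousM; [exact: cst_continuous|exact: continuous_powR1].
    by apply: continuousM; [exact: cst_continuous|exact: continuous_powR1B].
  - move=> x /andP[x0 x1]; rewrite /f.
    have h1 := is_derive1_powR a x0; have h2 := is_derive_powR1B b x1.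
    by apply: is_derive_eq; rewrite opprK.
  - move=> x x01; rewrite (le_trans (ler_normB _ _))// !ger0_norm ?powR_ge0//.
    rewrite (_ : 2 = 1 + 1)// lerD// powR_le1 ?ltW//.
    by move: x01 => /andP[? ?]; apply/andP; split; lra.
(* On the left half only the factor in x can blow up, and the other one is at most its bound on
   [1/2, 1]; the right half is symmetric. Dividing by a and by b cancels the coefficients of [f]. *)
pose C := (((2^-1) `^ `|b - 1|)^-1 / a + ((2^-1) `^ `|a - 1|)^-1 / b : R).
have C0 : 0 <= C by rewrite addr_ge0// divr_ge0 ?invr_ge0 ?powR_ge0// ltW.
have le1 : (\int[leb]_x (beta_dens a b x)%:E <= \int[leb]_(x in `]0%R, 1%R[) (C%:E * (f x)%:E))%E.
  rewrite [leRHS]integral_mkcond; apply: ge0_le_integral => //.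
  - by move=> x _; rewrite lee_fin beta_dens_ge0.
  - by apply/measurable_EFinP; exact: measurable_beta_dens.
  - apply/(measurable_restrictT _ _).1 => //; apply/measurable_EFinP.
    by apply: measurable_funM => //; exact: mf.
  move=> x _; rewrite patchE; case: ifPn; rewrite ?inE/= ?notin_setE/= in_itv/= => x01; last first.
    by rewrite beta_dens0//; apply/negP.
  rewrite beta_densE// -EFinM lee_fin /C /f mulrDr !mulrDl.
  move: x01 => /andP[x0 x1].
  have A0 : 0 <= x `^ (a - 1) by exact: powR_ge0.
  have B0 : 0 <= (1 - x) `^ (b - 1) by exact: powR_ge0.
  set U := _^-1; set V := ((2^-1) `^ `|a - 1|)^-1.
  have U0 : 0 <= U by rewrite invr_ge0 powR_ge0.
  have V0 : 0 <= V by rewrite invr_ge0 powR_ge0.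
  have -> : U / a * (a * x `^ (a - 1)) = U * x `^ (a - 1) by field; rewrite gt_eqF.
  have -> : V / b * (b * (1 - x) `^ (b - 1)) = V * (1 - x) `^ (b - 1) by field; rewrite gt_eqF.
  have t1 : 0 <= V / b * (a * x `^ (a - 1)) by rewrite !mulr_ge0 ?invr_ge0// ltW.
  have t2 : 0 <= U / a * (b * (1 - x) `^ (b - 1)) by rewrite !mulr_ge0 ?invr_ge0// ltW.
  have [xh|xh] := leP x 2^-1.
    have : (1 - x) `^ (b - 1) <= U by apply: powR_half_bound; apply/andP; split; lra.
    move/(ler_wpM2l A0); have : 0 <= V * (1 - x) `^ (b - 1) by rewrite mulr_ge0.
    rewrite [U * _]mulrC; lra.
  have : x `^ (a - 1) <= V by apply: powR_half_bound; apply/andP; split; lra.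
  move/(ler_wpM2r B0); have : 0 <= U * x `^ (a - 1) by rewrite mulr_ge0.
  lra.
apply: (le_lt_trans le1); rewrite ge0_integralZl_EFin//.
- by rewrite lte_mul_pinfty.
- by move=> x _; rewrite lee_fin.
- by apply/measurable_EFinP; exact: mf.
Qed.

Lemma integrable_beta_dens a b : 0 < a -> 0 < b ->
  leb.-integrable setT (EFin \o beta_dens a b).
Proof.
move=> a0 b0; apply/integrableP; split.
  by apply/measurable_EFinP; exact: measurable_beta_dens.
under eq_integral do rewrite /= ger0_norm ?beta_dens_ge0//.
exact: integral_beta_dens_lty.
Qed.

Lemma integrable_M_beta_dens a b (h : R -> R) (M : R) : 0 < a -> 0 < b ->
  measurable_fun setT h -> (forall x, `|h x| <= M) ->
  leb.-integrable setT (EFin \o (fun x => h x * beta_dens a b x)).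
Proof.
move=> a0 b0 mh hM.
have i2 : leb.-integrable setT (fun x => M%:E * (beta_dens a b x)%:E)%E.
  by apply: integrableZl => //; exact: integrable_beta_dens.
apply: le_integrable i2 => //.
  by apply/measurable_EFinP; apply: measurable_funM => //; exact: measurable_beta_dens.
move=> x _ /=; rewrite lee_fin !normrM ler_wpM2r//.
by rewrite (le_trans (hM x))// ler_norm.
Qed.

End BetaIntegrals.

(** * Real-valued Beta expectations of bounded functions *)

HB.lock Definition BI {R : realType} (a b : R) (h : R -> R) : R :=
  \int[lebesgue_measure]_x (h x * beta_dens a b x).

HB.lock Definition EB {R : realType} (a b : R) (h : R -> R) : R :=
  BI a b h / beta_const a b.

Section BetaExpectation.
Context {R : realType}.
Implicit Types (a b x : R) (h : R -> R).
Local Notation leb := (@lebesgue_measure R).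

Lemma beta_constE a b : beta_const a b = BI a b (fun=> 1).
Proof. by rewrite BI.unlock /beta_const /Rintegral; under [in RHS]eq_integral do rewrite mul1r. Qed.

Lemma BI_fin a b h (M : R) : 0 < a -> 0 < b ->
  measurable_fun setT h -> (forall x, `|h x| <= M) ->
  (\int[leb]_x (h x * beta_dens a b x)%:E = (BI a b h)%:E)%E.
Proof.
move=> a0 b0 mh hM; rewrite BI.unlock /Rintegral fineK//.
by apply: integrable_fin_num => //; exact: (integrable_M_beta_dens a0 b0 mh hM).
Qed.

Lemma near_ge_half (u : R ^nat) (l : R) : u @ \oo --> l -> 0 < l ->
  \forall n \near \oo, l / 2 <= u n.
Proof. by move=> ul l0; apply: (cvgr_ge _ ul); lra. Qed.

(** Dominated convergence: once [an >= a / 2] and [bn >= b / 2], the moving densities lie below the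
    one with parameters (a/2, b/2), because powers of a number in ]0, 1[ decrease in the exponent.
    Convergence of the integrands is asked almost everywhere so that indicators of moving half-lines
    are covered. *)
Lemma BI_cvg (an bn : nat -> R) a b (hn : nat -> R -> R) h (M : R) :
  an @ \oo --> a -> bn @ \oo --> b -> 0 < a -> 0 < b ->
  (forall n, measurable_fun setT (hn n)) -> measurable_fun setT h ->
  (forall n x, `|hn n x| <= M) -> (forall x, `|h x| <= M) ->
  {ae leb, forall x, 0 < x < 1 -> hn ^~ x @ \oo --> h x} ->
  (fun n => BI (an n) (bn n) (hn n)) @ \oo --> BI a b h.
Proof.
move=> ana bnb a0 b0 mhn mh hnM hM hnh.
have M0 : 0 <= M by rewrite (le_trans _ (hM 0)).
have [n0 _ Hn0] : \forall n \near \oo, a / 2 <= an n /\ b / 2 <= bn n.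
  by near=> n; split; near: n; exact: near_ge_half.
rewrite -(cvg_shiftn n0).
have aq k : a / 2 <= an (k + n0)%N by have [] := Hn0 _ (leq_addl k n0).
have bq k : b / 2 <= bn (k + n0)%N by have [] := Hn0 _ (leq_addl k n0).
have apos : 0 < a / 2 by lra.
have bpos : 0 < b / 2 by lra.
pose f_ k x : \bar R := (hn (k + n0)%N x * beta_dens (an (k + n0)%N) (bn (k + n0)%N) x)%:E.
have mf_ k : measurable_fun setT (f_ k).
  by apply/measurable_EFinP; apply: measurable_funM => //; exact: measurable_beta_dens.
have mf : measurable_fun setT (fun x => (h x * beta_dens a b x)%:E).
  by apply/measurable_EFinP; apply: measurable_funM => //; exact: measurable_beta_dens.
have ig : leb.-integrable setT (fun x => M%:E * (beta_dens (a / 2) (b / 2) x)%:E)%E.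
  by apply: integrableZl => //; exact: integrable_beta_dens.
have [] := @dominated_convergence _ _ _ leb setT measurableT f_ _ _ mf_ mf _ ig.
- move: hnh => [N [mN N0 sN]]; exists N; split => // x nx; apply: sN => hx; apply: nx => _.
  rewrite /f_.
  have [x01|x01] := boolP (0 < x < 1); last first.
    apply: cvg_near_cst; apply: nearW => k; rewrite !beta_dens0// !mulr0//.
  apply: cvg_EFin; first by apply: nearW.
  have h1 : (fun n : nat => hn (n + n0)%N x) @ \oo --> h x.
    by have := hx x01; rewrite -(cvg_shiftn n0).
  rewrite [X in X @ _](_ : _ = fun k => hn (k + n0)%N x *
     (x `^ (an (k + n0)%N - 1) * (1 - x) `^ (bn (k + n0)%N - 1))); last first.
    by apply/funext => k /=; rewrite beta_densE.
  rewrite beta_densE//; apply: cvgM => //.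
  have pcv (un : nat -> R) (u y : R) : 0 < y -> un @ \oo --> u ->
      (fun k => y `^ (un (k + n0)%N - 1)) @ \oo --> y `^ (u - 1).
    move=> y0; rewrite -(cvg_shiftn n0) => unu; rewrite /powR gt_eqF//.
    apply: (@continuous_cvg _ _ _ _ _ _ expR); first exact: continuous_expR.
    by apply: cvgMl; apply: cvgB => //; exact: cvg_cst.
  move: x01 => /andP[x0 x1].
  by apply: cvgM; apply: pcv => //; rewrite subr_gt0.
- apply: aeW => x k _; rewrite /f_ -EFinM lee_fin normrM ler_pM//.
  rewrite ger0_norm ?beta_dens_ge0//.
  have [x01|x01] := boolP (0 < x < 1); last by rewrite !beta_dens0.
  rewrite !beta_densE//; move: x01 => /andP[x0 x1].
  apply: ler_pM; rewrite ?powR_ge0//.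
    by apply: ger_powR; [rewrite x0 ltW|rewrite lerD2r].
  by apply: ger_powR; [apply/andP; split; lra|rewrite lerD2r].
move=> _ _; rewrite (BI_fin a0 b0 mh hM).
have -> : [sequence (\int[leb]_x f_ n x)%E]_n = (fun n => (BI (an (n + n0)%N) (bn (n + n0)%N) (hn (n + n0)%N))%:E).
  apply/funext => n; rewrite /f_ /= (@BI_fin _ _ _ M)//.
  - exact: lt_le_trans apos (aq n).
  - exact: lt_le_trans bpos (bq n).
by move/fine_cvg.
Unshelve. all: by end_near. Qed.

Lemma ge0_BI a b h : (forall x, 0 < x < 1 -> 0 <= h x) -> 0 <= BI a b h.
Proof.
move=> h0; rewrite BI.unlock; apply: Rintegral_ge0 => x _.
have [x01|x01] := boolP (0 < x < 1); last by rewrite beta_dens0// mulr0.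
by rewrite mulr_ge0 ?beta_dens_ge0// h0.
Qed.

Lemma le_BI a b h1 h2 (M : R) : 0 < a -> 0 < b ->
  measurable_fun setT h1 -> (forall x, `|h1 x| <= M) ->
  measurable_fun setT h2 -> (forall x, `|h2 x| <= M) ->
  (forall x, 0 < x < 1 -> h1 x <= h2 x) -> BI a b h1 <= BI a b h2.
Proof.
move=> a0 b0 m1 b1 m2 b2 h12; rewrite BI.unlock; apply: le_Rintegral => //.
- exact: (integrable_M_beta_dens a0 b0 m1 b1).
- exact: (integrable_M_beta_dens a0 b0 m2 b2).
move=> x _; have [x01|x01] := boolP (0 < x < 1); last by rewrite beta_dens0// !mulr0.
by rewrite ler_wpM2r ?beta_dens_ge0// h12.
Qed.

Lemma BIZ a b h (M k : R) : 0 < a -> 0 < b ->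
  measurable_fun setT h -> (forall x, `|h x| <= M) ->
  BI a b (fun x => k * h x) = k * BI a b h.
Proof.
move=> a0 b0 m1 b1; rewrite BI.unlock -RintegralZl//.
  by apply: eq_Rintegral => x _; rewrite mulrA.
exact: (integrable_M_beta_dens a0 b0 m1 b1).
Qed.

Lemma BID a b h1 h2 (M : R) : 0 < a -> 0 < b ->
  measurable_fun setT h1 -> (forall x, `|h1 x| <= M) ->
  measurable_fun setT h2 -> (forall x, `|h2 x| <= M) ->
  BI a b (fun x => h1 x + h2 x) = BI a b h1 + BI a b h2.
Proof.
move=> a0 b0 m1 b1 m2 b2; rewrite BI.unlock -RintegralD//.
- by apply: eq_Rintegral => x _; rewrite mulrDl.
- exact: (integrable_M_beta_dens a0 b0 m1 b1).
- exact: (integrable_M_beta_dens a0 b0 m2 b2).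
Qed.

(** A zero integral would force the density to vanish almost everywhere on ]u, v[, where it is
    positive, although this interval has length v - u > 0. *)
Lemma BI_itv_gt0 a b (u v : R) : 0 < a -> 0 < b -> 0 <= u -> u < v -> v <= 1 ->
  0 < BI a b (\1_(`]u, v[%classic : set R)).
Proof.
move=> a0 b0 u0 uv v1; rewrite lt_neqAle ge0_BI ?andbT; last first.
  by move=> x _; rewrite indicE.
apply/eqP => /esym BI0.
have m1 : measurable_fun setT (\1_(`]u, v[%classic : set R) : R -> R) by exact: measurable_indic.
have b1 x : `|(\1_(`]u, v[%classic : set R) x : R)| <= 1.
  by rewrite indicE; case: (_ \in _); rewrite ?normr1 ?normr0.
have mi : measurable (`]u, v[%classic : set (measurableTypeR R)) by [].
have mb : measurable_fun (`]u, v[%classic : set (measurableTypeR R)) (EFin \o beta_dens a b).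
  by apply/measurable_EFinP; apply: measurable_funTS; exact: measurable_beta_dens.
have := (ae_eq_integral_abs leb mi mb).1.
have -> : (\int[leb]_(x in `]u, v[) `|(EFin \o beta_dens a b) x| =
   \int[leb]_x (\1_(`]u, v[%classic : set R) x * beta_dens a b x)%:E)%E.
  rewrite [LHS]integral_mkcond; apply: eq_integral => x _.
  rewrite patchE indicE; case: ifPn => _; rewrite ?mul0r// mul1r.
  by rewrite /= ger0_norm ?beta_dens_ge0.
rewrite (BI_fin a0 b0 m1 b1) BI0 => /(_ erefl) [N [mN N0 subN]].
have sub : `]u, v[%classic `<=` N.
  move=> x xuv; apply: subN => /= /(_ xuv) [] /eqP.
  move: xuv; rewrite /= in_itv/= => /andP[xu xv].
  have x0 : 0 < x by lra.
  have x1 : 0 < 1 - x by lra.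
  rewrite beta_densE; last by apply/andP; split; lra.
  by rewrite gt_eqF// mulr_gt0// powR_gt0.
have : (leb (`]u, v[%classic : set R) <= 0)%E.
  by rewrite -N0 le_measure// inE.
by rewrite lebesgue_measure_itv/= lte_fin uv -EFinB lee_fin subr_le0 leNgt uv.
Qed.

Lemma beta_const_gt0 a b : 0 < a -> 0 < b -> 0 < beta_const a b.
Proof.
move=> a0 b0; rewrite beta_constE; have := @BI_itv_gt0 a b 0 1 a0 b0 (lexx 0) ltr01 (lexx 1).
move/lt_le_trans; apply; apply: (@le_BI _ _ _ _ 1) => //.
- by move=> x; rewrite indicE; case: (_ \in _); rewrite ?normr1 ?normr0.
- by move=> x; rewrite normr1.
Qed.

End BetaExpectation.

(** * Beta distribution functions and quantiles, with continuity in the parameters *)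

Section BetaCDF.
Context {R : realType}.
Implicit Types (a b x u v p : R) (h : R -> R).
Local Notation leb := (@lebesgue_measure R).

Lemma indic_norm_le1 (T : Type) (A : set T) (x : T) : `|\1_A x : R| <= 1.
Proof. by rewrite indicE; case: (_ \in _); rewrite ?normr1 ?normr0. Qed.

(** Bridge from the extended-real [betaI], in which the processes are defined, to real expectations:
    restriction to [A] becomes an indicator factor. *)
Lemma betaI_EB a b (A : set R) h (M : R) : 0 < a -> 0 < b -> measurable A ->
  measurable_fun setT h -> (forall x, `|h x| <= M) ->
  betaI a b A (EFin \o h) = (EB a b (fun x => h x * \1_A x))%:E.
Proof.
move=> a0 b0 mA mh hM; have M0 : 0 <= M by rewrite (le_trans _ (hM 0)).
have mhA : measurable_fun setT (fun x => h x * \1_A x).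
  by apply: measurable_funM => //; exact: measurable_indic.
have hAM x : `|h x * \1_A x| <= M.
  by rewrite normrM -[leRHS]mulr1 ler_pM// indic_norm_le1.
rewrite /betaI EB.unlock mulrC EFinM -(BI_fin a0 b0 mhA hAM) -integralZl//; last first.
  exact: (integrable_M_beta_dens a0 b0 mhA hAM).
rewrite [LHS]integral_mkcond; apply: eq_integral => x _.
rewrite patchE indicE; case: ifPn => _; rewrite ?mulr0 ?mul0r ?mule0//.
by rewrite mulr1 -!EFinM; congr EFin; rewrite /=; ring.
Qed.

Lemma EB1 a b : 0 < a -> 0 < b -> EB a b (fun=> 1) = 1.
Proof. by move=> a0 b0; rewrite EB.unlock -beta_constE divff// gt_eqF// beta_const_gt0. Qed.

Lemma le_EB a b h1 h2 (M : R) : 0 < a -> 0 < b ->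
  measurable_fun setT h1 -> (forall x, `|h1 x| <= M) ->
  measurable_fun setT h2 -> (forall x, `|h2 x| <= M) ->
  (forall x, 0 < x < 1 -> h1 x <= h2 x) -> EB a b h1 <= EB a b h2.
Proof.
move=> a0 b0 m1 b1 m2 b2 h12; rewrite EB.unlock; apply: ler_wpM2r; last exact: (le_BI a0 b0 m1 b1 m2 b2).
by rewrite invr_ge0 ltW// beta_const_gt0.
Qed.

Lemma EB_eq a b h1 h2 : (forall x, 0 < x < 1 -> h1 x = h2 x) -> EB a b h1 = EB a b h2.
Proof.
move=> h12; rewrite EB.unlock BI.unlock; congr (_ / _); apply: eq_Rintegral => x _.
have [x01|x01] := boolP (0 < x < 1); last by rewrite beta_dens0// !mulr0.
by rewrite h12.
Qed.

Lemma EB_cvg (an bn : nat -> R) a b (hn : nat -> R -> R) h (M : R) :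
  an @ \oo --> a -> bn @ \oo --> b -> 0 < a -> 0 < b ->
  (forall n, measurable_fun setT (hn n)) -> measurable_fun setT h ->
  (forall n x, `|hn n x| <= M) -> (forall x, `|h x| <= M) ->
  {ae leb, forall x, 0 < x < 1 -> hn ^~ x @ \oo --> h x} ->
  (fun n => EB (an n) (bn n) (hn n)) @ \oo --> EB a b h.
Proof.
move=> ana bnb a0 b0 mhn mh hnM hM hnh.
rewrite EB.unlock; apply: cvgM; first exact: (BI_cvg ana bnb a0 b0 mhn mh hnM hM hnh).
apply: cvgV; first by rewrite gt_eqF// beta_const_gt0.
rewrite beta_constE (_ : (fun n => _) = (fun n => BI (an n) (bn n) (fun=> 1))); last first.
  by apply/funext => n; rewrite beta_constE.
apply: (@BI_cvg _ _ _ _ _ (fun _ _ => 1) _ 1) => //.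
- by move=> _ x; rewrite normr1.
- by move=> x; rewrite normr1.
- by apply: aeW => x _; exact: cvg_cst.
Qed.

Lemma betaCDFE a b v : 0 < a -> 0 < b ->
  betaCDF a b v = EB a b (\1_(`]-oo, v]%classic : set R)).
Proof.
move=> a0 b0; rewrite /betaCDF /betaM.
rewrite (@betaI_EB a b _ (fun=> 1) 1)//=; last by move=> x; rewrite normr1.
by congr EB; apply/funext => x; rewrite mul1r.
Qed.

Lemma measurable_indic_ray v :
  measurable_fun setT (\1_(`]-oo, v]%classic : set R) : R -> R).
Proof. exact: measurable_indic. Qed.

Lemma betaCDF_ge0 a b v : 0 < a -> 0 < b -> 0 <= betaCDF a b v.
Proof.
move=> a0 b0; rewrite betaCDFE// EB.unlock divr_ge0//; last exact/ltW/beta_const_gt0.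
by apply: ge0_BI => x _; rewrite indicE.
Qed.

Lemma betaCDF_homo a b u v : 0 < a -> 0 < b -> u <= v -> betaCDF a b u <= betaCDF a b v.
Proof.
move=> a0 b0 uv; rewrite !betaCDFE//; apply: (@le_EB _ _ _ _ 1) => //.
- exact: indic_norm_le1.
- exact: indic_norm_le1.
move=> x _; rewrite !indicE ler_nat; case: (boolP (x \in _)) => //.
by rewrite inE/= in_itv/= => xu; rewrite mem_set//= in_itv/= (le_trans xu).
Qed.

Lemma betaCDF_le0 a b v : 0 < a -> 0 < b -> v <= 0 -> betaCDF a b v = 0.
Proof.
move=> a0 b0 v0; rewrite betaCDFE// (@EB_eq _ _ _ (fun=> 0)).
  by rewrite EB.unlock BI.unlock; under eq_Rintegral do rewrite mul0r; rewrite Rintegral_cst// !mul0r.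
move=> x /andP[x0 x1]; rewrite indicE memNset//= in_itv/=; apply/negP.
by rewrite -ltNge; lra.
Qed.

Lemma betaCDF_ge1 a b v : 0 < a -> 0 < b -> 1 <= v -> betaCDF a b v = 1.
Proof.
move=> a0 b0 v1; rewrite betaCDFE// (@EB_eq _ _ _ (fun=> 1)) ?EB1//.
move=> x /andP[x0 x1]; rewrite indicE mem_set//= in_itv/=; lra.
Qed.

Lemma betaCDF_le1 a b v : 0 < a -> 0 < b -> betaCDF a b v <= 1.
Proof.
move=> a0 b0; have [v1|/ltW v1] := leP 1 v; first by rewrite betaCDF_ge1.
by rewrite -(@betaCDF_ge1 a b 1)// betaCDF_homo.
Qed.

Lemma betaCDF_lt a b u v : 0 < a -> 0 < b -> 0 <= u -> u < v -> v <= 1 ->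
  betaCDF a b u < betaCDF a b v.
Proof.
move=> a0 b0 u0 uv v1; rewrite !betaCDFE// EB.unlock ltr_pM2r ?invr_gt0 ?beta_const_gt0//.
apply: (@lt_le_trans _ _ (BI a b (\1_(`]u, v[%classic : set R)) + BI a b (\1_(`]-oo, u]%classic : set R)))).
  by rewrite ltrDr BI_itv_gt0.
have i1 A x : `|\1_A x : R| <= 1 by exact: indic_norm_le1.
rewrite -(@BID _ _ _ _ _ 1)//; apply: (@le_BI _ _ _ _ _ 2) => //.
- by apply: measurable_funD; exact: measurable_indic.
- by move=> x; rewrite (le_trans (ler_normD _ _))// (_ : 2 = 1 + 1)// lerD.
- by move=> x; rewrite (le_trans (i1 _ x))// ler1n.
- move=> x _; rewrite !indicE -natrD ler_nat !mem_setE !in_itv/=.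
  case: (leP x u) => xu; case: (leP x v) => xv //=.
  + by have := le_lt_trans xu (lt_trans uv xv); rewrite ltxx.
  + by case: (x < v).
  + by rewrite ltNge (ltW xv).
Qed.

(** The indicators of the moving half-lines converge at every point but the limiting endpoint [u], a
    Lebesgue-null set. *)
Lemma betaCDF_cvg (an bn un : nat -> R) a b u :
  an @ \oo --> a -> bn @ \oo --> b -> un @ \oo --> u -> 0 < a -> 0 < b ->
  (forall n, 0 < an n) -> (forall n, 0 < bn n) ->
  (fun n => betaCDF (an n) (bn n) (un n)) @ \oo --> betaCDF a b u.
Proof.
move=> ana bnb unu a0 b0 an0 bn0; rewrite betaCDFE//.
under eq_fun do rewrite betaCDFE//.
apply: (@EB_cvg _ _ _ _ (fun n => \1_(`]-oo, un n]%classic : set R)) _ 1) => //.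
- by move=> n x; exact: indic_norm_le1.
- by move=> x; exact: indic_norm_le1.
exists [set u]; split; [exact: measurable_set1|exact: lebesgue_measure_set1|].
move=> x nx; apply: contrapT => /eqP xu; apply: nx => _.
apply: cvg_near_cst; case: (ltgtP x u) xu => // xu _.
- near=> n; rewrite !indicE !mem_setE; congr (_%:R); rewrite !in_itv/= (ltW xu).
  by apply/eqP; rewrite eqb1; near: n; exact: (cvgr_ge _ unu).
- near=> n; rewrite !indicE !mem_setE; congr (_%:R); rewrite !in_itv/=.
  rewrite [in RHS]leNgt xu/=; apply/eqP; rewrite eqb0 -ltNge.
  by near: n; exact: (cvgr_lt _ unu).
Unshelve. all: by end_near. Qed.

Lemma betaCDF_seq_cvg a b (un : nat -> R) u : 0 < a -> 0 < b ->
  un @ \oo --> u -> (fun n => betaCDF a b (un n)) @ \oo --> betaCDF a b u.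
Proof.
move=> a0 b0 unu; apply: (@betaCDF_cvg (fun=> a) (fun=> b)) => //; exact: cvg_cst.
Qed.

Lemma betaQ_itv a b p : 0 < a -> 0 < b -> p <= 1 -> 0 <= betaQ a b p <= 1.
Proof.
move=> a0 b0 p1; apply/andP; split.
  apply: lb_le_inf; last by move=> u [/andP[]].
  by exists 1; split; rewrite ?lexx ?ler01// betaCDF_ge1.
apply: ge_inf; first by exists 0 => u [/andP[]].
by split; rewrite ?lexx ?ler01// betaCDF_ge1.
Qed.

Lemma betaQ_le a b p x : 0 <= x <= 1 -> p <= betaCDF a b x -> betaQ a b p <= x.
Proof. by move=> x01 px; apply: ge_inf; first by exists 0 => u [/andP[]]. Qed.

Lemma betaQ_ge a b p x : 0 < a -> 0 < b -> p <= 1 -> betaCDF a b x < p ->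
  x <= betaQ a b p.
Proof.
move=> a0 b0 p1 xp; apply: lb_le_inf.
  by exists 1; split; rewrite ?lexx ?ler01// betaCDF_ge1.
move=> u [_ pu]; rewrite leNgt; apply/negP => ux.
by have := betaCDF_homo a0 b0 (ltW ux); lra.
Qed.

(** Continuity excludes both strict inequalities. If the distribution function at the infimum q
    exceeded p, it would still do so slightly to the left, against q being a lower bound (there q >
    0, since it vanishes at 0). If it were below p, it would remain so slightly to the right, which
    pushes the infimum beyond q. *)
Lemma betaQK a b p : 0 < a -> 0 < b -> 0 <= p <= 1 -> betaCDF a b (betaQ a b p) = p.
Proof.
move=> a0 b0 /andP[p0 p1]; set q := betaQ a b p.
have /andP[q0 q1] : 0 <= q <= 1 by exact: betaQ_itv.
have hc : (fun n => betaCDF a b (q + harmonic n)) @ \oo --> betaCDF a b q.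
  by apply: betaCDF_seq_cvg => //; rewrite -[X in _ --> X]addr0; apply: cvgD;
    [exact: cvg_cst|exact: cvg_harmonic].
have hc' : (fun n => betaCDF a b (q - harmonic n)) @ \oo --> betaCDF a b q.
  by apply: betaCDF_seq_cvg => //; rewrite -[X in _ --> X]subr0; apply: cvgB;
    [exact: cvg_cst|exact: cvg_harmonic].
apply/eqP; rewrite eq_le; apply/andP; split; rewrite leNgt; apply/negP => hq.
- have qpos : 0 < q.
    by rewrite lt_neqAle q0 andbT; apply/eqP => q00; move: hq; rewrite -q00 betaCDF_le0//; lra.
  have [n _ /(_ n (leqnn n))] : \forall n \near \oo, p < betaCDF a b (q - harmonic n) /\ harmonic n < q.
    near=> n; split; near: n; first exact: (cvgr_gt _ hc').
    exact: (cvgr_lt _ (@cvg_harmonic R)).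
  case; have h3 : 0 < harmonic n :> R by exact: harmonic_gt0.
  move: (harmonic n : R) h3 => r r0 h1 r1.
  have : 0 <= q - r <= 1 by lra.
  by move=> /betaQ_le /(_ (ltW h1)); rewrite -/q; clearbody q; lra.
- have [n _ /(_ n (leqnn n)) h1] : \forall n \near \oo, betaCDF a b (q + harmonic n) < p.
    exact: (cvgr_lt _ hc).
  have h3 : 0 < harmonic n :> R by exact: harmonic_gt0.
    have := betaQ_ge a0 b0 p1 h1; rewrite -/q.
  by move: (harmonic n : R) h3 => r r0; clearbody q; lra.
Unshelve. all: by end_near. Qed.

Lemma near_cvg_lt (u v : R ^nat) (l m : R) : u @ \oo --> l -> v @ \oo --> m -> l < m ->
  \forall n \near \oo, u n < v n.
Proof.
move=> ul vm lm; have h : (fun n => v n - u n) @ \oo --> m - l by exact: cvgB.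
near=> n; rewrite -subr_gt0; near: n; apply: (cvgr_gt _ h); lra.
Unshelve. all: by end_near. Qed.

(** Strict monotonicity of the limiting distribution function puts p strictly between its values at
    q - e/2 and q + e/2; these strict inequalities persist for large n and trap the n-th
    quantile. *)
Lemma betaQ_cvg (an bn pn : nat -> R) a b p :
  an @ \oo --> a -> bn @ \oo --> b -> pn @ \oo --> p -> 0 < a -> 0 < b ->
  (forall n, 0 < an n) -> (forall n, 0 < bn n) ->
  (forall n, 0 <= pn n <= 1) -> 0 <= p <= 1 ->
  (fun n => betaQ (an n) (bn n) (pn n)) @ \oo --> betaQ a b p.
Proof.
move=> ana bnb pnp a0 b0 an0 bn0 pn01 p01.
set q := betaQ a b p; have qp := betaQK a0 b0 p01; rewrite -/q in qp.
have /andP[p0 p1] := p01.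
have /andP[q0 q1] : 0 <= q <= 1 by exact: betaQ_itv.
have Qn n : 0 <= betaQ (an n) (bn n) (pn n) <= 1.
  by apply: betaQ_itv => //; have /andP[] := pn01 n.
have Fc x : (fun n => betaCDF (an n) (bn n) x) @ \oo --> betaCDF a b x.
  by apply: betaCDF_cvg => //; exact: cvg_cst.
apply/cvgrPdist_lt => e e0.
have aux (Q : R) : 0 <= Q <= 1 -> q < e / 2 \/ q - e / 2 <= Q ->
    1 < q + e / 2 \/ Q <= q + e / 2 -> `|q - Q| < e.
  move: e0 q0 q1; clear; clearbody q => e0 q0 q1 /andP[Q0 Q1] h1 h2.
  by rewrite ltr_distl; apply/andP; split; [case: h2|case: h1]; lra.
have n1 : \forall n \near \oo, q < e / 2 \/ q - e / 2 <= betaQ (an n) (bn n) (pn n).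
  have [qe|qe] := ltP q (e / 2); first by apply: nearW => n; left.
  have hlt : betaCDF a b (q - e / 2) < p.
    rewrite -qp; have [h1 h2] : 0 <= q - e / 2 /\ q - e / 2 < q.
      by move: e0 qe; clear; clearbody q; split; lra.
    exact: betaCDF_lt.
  apply: filterS (near_cvg_lt (Fc (q - e / 2)) pnp hlt) => n h; right; apply: betaQ_ge => //.
  by have /andP[] := pn01 n.
have n2 : \forall n \near \oo, 1 < q + e / 2 \/ betaQ (an n) (bn n) (pn n) <= q + e / 2.
  have [qe|qe] := ltP 1 (q + e / 2); first by apply: nearW => n; left.
  have qe2 : 0 <= q + e / 2 <= 1 /\ q < q + e / 2.
    by move: e0 q0 qe; clear; clearbody q; split; lra.
  have hlt : p < betaCDF a b (q + e / 2) by rewrite -qp; case: qe2 => *; exact: betaCDF_lt.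
  apply: filterS (near_cvg_lt pnp (Fc (q + e / 2)) hlt) => n h; right.
  by apply: betaQ_le; [case: qe2|exact: ltW].
near=> n; apply: (aux _ (Qn n)).
- by near: n.
- by near: n.
Unshelve. all: by end_near. Qed.

End BetaCDF.

(** * Mean and mean square distance of Beta laws *)

Section BetaMoments.
Context {R : realType}.
Implicit Types (a b x u v p : R) (h : R -> R).
Local Notation leb := (@lebesgue_measure R).

Lemma beta_densSl a b x : 0 < a -> beta_dens (a + 1) b x = x * beta_dens a b x.
Proof.
move=> a0; have [x01|x01] := boolP (0 < x < 1); last by rewrite !beta_dens0// mulr0.
by rewrite !beta_densE// addrK mulrA mulr_powRB1//; case/andP: x01 => /ltW.
Qed.

Lemma beta_densSr a b x : 0 < b -> beta_dens a (b + 1) x = (1 - x) * beta_dens a b x.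
Proof.
move=> a0; have [x01|x01] := boolP (0 < x < 1); last by rewrite !beta_dens0// mulr0.
rewrite !beta_densE// addrK mulrCA mulr_powRB1//.
by case/andP: x01 => _ /ltW; rewrite subr_ge0.
Qed.

Lemma beta_dens_exh_cvg a b : 0 < a -> 0 < b ->
  (fun i => \int[leb]_(x in `[exh i, (1 - exh i)%R]) beta_dens a b x) @ \oo --> BI a b (fun=> 1).
Proof.
move=> a0 b0.
have mf : measurable_fun (`]0, 1[%classic : set R) (beta_dens a b).
  by apply: measurable_funTS; exact: measurable_beta_dens.
have := ge0_integral_exh_cvg mf (fun x _ => beta_dens_ge0 a b x).
have -> : (\int[leb]_(x in `]0%R, 1%R[) (beta_dens a b x)%:E)%E = (BI a b (fun=> 1))%:E.
  rewrite -(@BI_fin _ _ _ _ 1)//; last by move=> x; rewrite normr1.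
  rewrite [LHS]integral_mkcond; apply: eq_integral => x _; rewrite mul1r patchE.
  case: ifPn => //; rewrite notin_setE/= in_itv/= => x01.
  by rewrite beta_dens0//; exact/negP.
by move/fine_cvg.
Qed.

Lemma exh_powR_cvg0 p : 0 < p -> (fun i => (@exh R i) `^ p) @ \oo --> (0 : R).
Proof.
move=> p0; have h := powR_cvg0 p0.
apply: (cvg_comp _ _ _ h); move=> A [e /= e0 eA].
have /cvgrPdist_lt /(_ e e0) hN := @exh_cvg0 R.
apply: filterS hN => n hn; have /andP[h0 _] := @exh_itv R n.
by apply: eA.
Qed.

(** Both sides are the two parts of the integral of the derivative of [x^a (1 - x)^b], a function
    that vanishes at 0 and at 1. *)
Lemma beta_by_parts a b : 0 < a -> 0 < b ->
  a * BI a (b + 1) (fun=> 1) = b * BI (a + 1) b (fun=> 1).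
Proof.
move=> a0 b0; have a1 : 0 < a + 1 by lra. have b1 : 0 < b + 1 by lra.
pose F x : R := x `^ a * (1 - x) `^ b.
pose f x : R := a * (x `^ (a - 1) * (1 - x) `^ b) - b * (x `^ a * (1 - x) `^ (b - 1)).
have dF x : 0 < x < 1 -> is_derive x 1 F (f x).
  move=> /andP[x0 x1]; have h1 := is_derive1_powR a x0; have h2 := is_derive_powR1B b x1.
  have := is_deriveM h1 h2; rewrite /f => h3; apply: is_derive_eq.
  by rewrite /GRing.scale/=; ring.
have cf x : 0 < x < 1 -> {for x, continuous f}.
  move=> /andP[x0 x1]; apply: continuousB.
    apply: continuousM; first exact: cst_continuous.
    by apply: continuousM; [exact: continuous_powR1|exact: continuous_powR1B].
  apply: continuousM; first exact: cst_continuous.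
  by apply: continuousM; [exact: continuous_powR1|exact: continuous_powR1B].
have key i : a * \int[leb]_(x in `[exh i, (1 - exh i)%R]) beta_dens a (b + 1) x -
             b * \int[leb]_(x in `[exh i, (1 - exh i)%R]) beta_dens (a + 1) b x =
             F (1 - exh i) - F (exh i).
  have := FTC_exh i cf dF; move=> /(congr1 fine)/= <-.
  have int c d : 0 < c -> 0 < d -> leb.-integrable `[exh i, (1 - exh i)%R] (EFin \o beta_dens c d).
    move=> c0 d0; apply: (@integrableS _ _ _ _ setT) => //.
    exact: integrable_beta_dens.
  have mi : measurable (`[exh i, 1 - exh i]%classic : set (measurableTypeR R)) by [].
  rewrite -!RintegralZl//; try exact: int.
  rewrite -RintegralB//.
  - apply: eq_Rintegral => x; rewrite inE/= in_itv/= => /andP[e1 e2].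
    have /andP[e3 e4] := @exh_itv R i.
    have x01 : 0 < x < 1 by move: e1 e2 e3 e4; move: (exh i : R) => e; lra.
    by rewrite /f !beta_densE// !addrK.
  - by have := @integrableZl _ _ _ leb _ mi a (EFin \o beta_dens a (b + 1)) (int _ _ a0 b1).
  - by have := @integrableZl _ _ _ leb _ mi b (EFin \o beta_dens (a + 1) b) (int _ _ a1 b0).
have lhs : (fun i => F (1 - exh i) - F (exh i)) @ \oo -->
    a * BI a (b + 1) (fun=> 1) - b * BI (a + 1) b (fun=> 1).
  under eq_fun do rewrite -key.
  by apply: cvgB; apply: cvgMr; exact: beta_dens_exh_cvg.
have F0 : F (exh i) @[i --> \oo] --> (0 : R).
  apply: (squeeze_cvgr _ (cvg_cst _) (exh_powR_cvg0 a0)).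
  apply: nearW => i; have /andP[e3 e4] := @exh_itv R i.
  rewrite /F mulr_ge0 ?powR_ge0//= -[leRHS]mulr1 ler_wpM2l ?powR_ge0//.
  by apply: powR_le1; [move: e3 e4; move: (exh i : R) => e; lra|exact: ltW].
have F1 : F (1 - exh i) @[i --> \oo] --> (0 : R).
  apply: (squeeze_cvgr _ (cvg_cst _) (exh_powR_cvg0 b0)).
  apply: nearW => i; have /andP[e3 e4] := @exh_itv R i.
  rewrite /F mulr_ge0 ?powR_ge0//= -[leRHS]mul1r (_ : 1 - (1 - exh i) = exh i); last by ring.
  rewrite ler_wpM2r ?powR_ge0//.
  by apply: powR_le1; [move: e3 e4; move: (exh i : R) => e; lra|exact: ltW].
have rhs : (fun i => F (1 - exh i) - F (exh i)) @ \oo --> (0 - 0 : R) by exact: cvgB.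
apply/eqP; rewrite -subr_eq0; apply/eqP; rewrite -[RHS]subr0.
exact: (cvg_unique (@Rhausdorff R) lhs rhs).
Qed.

(** Projection onto [0, 1]. It makes integrands bounded on the whole line without changing them
    where the density lives, and later confines the lengths to [0, 1] at every sample point. *)
Definition clip x : R := Num.min (Num.max x 0) 1.

Lemma clip_itv x : 0 <= clip x <= 1.
Proof. by rewrite /clip ge_min lexx orbT andbT le_min le_max lexx orbT ler01. Qed.

Lemma clipE x : 0 <= x <= 1 -> clip x = x.
Proof. by move=> /andP[x0 x1]; rewrite /clip max_l// min_l. Qed.

Lemma measurable_clip : measurable_fun setT clip.
Proof. by apply: measurable_minr => //; apply: measurable_maxr. Qed.

Lemma clip_continuous : continuous clip.
Proof.
move=> x; apply: (@continuous_min _ _ (fun x => Num.max x 0) (fun=> 1)); last exact: cst_continuous.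
by apply: (@continuous_max _ _ id (fun=> 0)) => //; exact: cst_continuous.
Qed.

Lemma clip_norm x : `|clip x| <= 1.
Proof. by have /andP[c0 c1] := clip_itv x; rewrite ger0_norm. Qed.

(** Size-biasing: a factor x raises the first parameter by one, so moments turn into integrals of
    the constant 1. *)
Lemma BI_Sl a b h : 0 < a -> BI (a + 1) b h = BI a b (fun x => clip x * h x).
Proof.
move=> a0; rewrite BI.unlock; apply: eq_Rintegral => x _; rewrite beta_densSl//.
have [x01|x01] := boolP (0 < x < 1); last by rewrite !beta_dens0// !mulr0.
by rewrite clipE; [ring|case/andP: x01 => /ltW-> /ltW].
Qed.

Lemma BI_Sr a b h : 0 < b -> BI a (b + 1) h = BI a b (fun x => (1 - clip x) * h x).
Proof.
move=> a0; rewrite BI.unlock; apply: eq_Rintegral => x _; rewrite beta_densSr//.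
have [x01|x01] := boolP (0 < x < 1); last by rewrite !beta_dens0// !mulr0.
by rewrite clipE; [ring|case/andP: x01 => /ltW-> /ltW].
Qed.

(** Writing 1 = x + (1 - x) gives a second linear relation between the two shifted integrals of
    [beta_by_parts]; the two relations determine the mean a / (a + b). *)
Lemma BI_mean a b : 0 < a -> 0 < b ->
  BI (a + 1) b (fun=> 1) = a / (a + b) * BI a b (fun=> 1).
Proof.
move=> a0 b0; have h := beta_by_parts a0 b0.
have s : BI a b (fun=> 1) = BI (a + 1) b (fun=> 1) + BI a (b + 1) (fun=> 1).
  rewrite BI_Sl// BI_Sr// -(@BID _ _ _ _ _ 1)//.
  - by congr BI; apply/funext => x; move: (clip x) => y; ring.
  - by apply: measurable_funM => //; exact: measurable_clip.
  - by move=> x; rewrite mulr1 clip_norm.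
  - by apply: measurable_funM => //; apply: measurable_funB => //; exact: measurable_clip.
  - by move=> x; rewrite mulr1; have /andP[c0 c1] := clip_itv x; rewrite ger0_norm; move: c0 c1; move: (clip x) => y; lra.
apply: (mulfI (_ : a + b != 0)); first by rewrite gt_eqF// addr_gt0.
rewrite mulrA [_ * (a / _)]mulrCA mulfV ?mulr1; last by rewrite gt_eqF// addr_gt0.
rewrite s; move: h; move: (BI _ _ _) (BI _ _ _) => U V; lra.
Qed.

(** Squared bias plus variance; the second moment comes from applying [BI_mean] twice, with first
    parameters a + 1 and a. *)
Lemma EB_sqdist a b p : 0 < a -> 0 < b ->
  EB a b (fun x => (clip x - p) ^+ 2) =
  (a / (a + b) - p) ^+ 2 + a * b / ((a + b) ^+ 2 * (a + b + 1)).
Proof.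
move=> a0 b0; have s0 : 0 < a + b by exact: addr_gt0.
have mc := measurable_clip.
have e1 : BI a b clip = a / (a + b) * BI a b (fun=> 1).
  by rewrite -BI_mean// BI_Sl//; congr BI; apply/funext => x; rewrite mulr1.
have e2 : BI a b (fun x => clip x * clip x) = (a + 1) / (a + b + 1) * (a / (a + b)) * BI a b (fun=> 1).
  rewrite -mulrA -BI_mean// (_ : a + b + 1 = a + 1 + b); last by ring.
  rewrite -BI_mean ?addr_gt0// BI_Sl ?addr_gt0// BI_Sl//.
  by congr BI; apply/funext => x; rewrite mulr1.
have -> : (fun x => (clip x - p) ^+ 2) =
    (fun x => clip x * clip x + ((- (2 * p)) * clip x + p ^+ 2 * 1)).
  by apply/funext => x; move: (clip x) => y; ring.
pose M : R := 1 + (`|2 * p| + p ^+ 2).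
have p20 : 0 <= p ^+ 2 by exact: sqr_ge0.
have b2 x : `|- (2 * p) * clip x| <= `|2 * p|.
  by rewrite normrM normrN -[leRHS]mulr1 ler_wpM2l// clip_norm.
have b3 x : `|- (2 * p) * clip x + p ^+ 2 * 1| <= `|2 * p| + p ^+ 2.
  by rewrite (le_trans (ler_normD _ _))// mulr1 lerD// ger0_norm.
have m2 : measurable_fun setT (fun x => - (2 * p) * clip x) by exact: measurable_funM.
have m3 : measurable_fun setT (fun x => - (2 * p) * clip x + p ^+ 2 * 1) by exact: measurable_funD.
have pp0 : 0 <= `|2 * p| by [].
rewrite EB.unlock (@BID _ _ _ _ _ M)//; last 3 first.
- exact: measurable_funM.
- move=> x; rewrite normrM (@le_trans _ _ 1)//; last by rewrite /M; lra.
  by rewrite -[leRHS]mulr1 ler_pM// clip_norm.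
- by move=> x; rewrite (le_trans (b3 x))// /M; lra.
rewrite (@BID _ _ _ _ _ (`|2 * p| + p ^+ 2))//; last 2 first.
- by move=> x; rewrite (le_trans (b2 x))//; lra.
- by move=> x; rewrite mulr1 ger0_norm//; lra.
rewrite (@BIZ _ _ _ clip 1)//; last by exact: clip_norm.
rewrite (@BIZ _ _ _ (fun=> 1) 1)//; last by move=> x; rewrite normr1.
rewrite e1 e2 beta_constE; have := beta_const_gt0 a0 b0; rewrite beta_constE.
move: (BI a b _) => C C0; field.
by rewrite !gt_eqF//; lra.
Qed.

(** Chebyshev's inequality, with the variance simplified by [a * b <= (a + b) ^+ 2]. *)
Lemma EB_dist_tail a b p (A : set R) (e : R) : 0 < a -> 0 < b -> 0 < e -> measurable A ->
  (forall x, A x -> 0 < x < 1 -> e <= `|x - p|) -> 0 <= p <= 1 ->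
  EB a b (\1_A) <= e ^- 2 * ((a / (a + b) - p) ^+ 2 + (a + b + 1)^-1).
Proof.
move=> a0 b0 e0 mA HA p01; have s0 : 0 < a + b by exact: addr_gt0.
have mc := measurable_clip.
have mq : measurable_fun setT (fun x => (clip x - p) ^+ 2).
  by apply: measurable_funX; exact: measurable_funB.
have qb x : `|(clip x - p) ^+ 2| <= 1.
  rewrite normrX -[leRHS](expr1n _ 2) lerXn2r ?nnegrE//.
  by have := clip_itv x; rewrite ler_norml; move: (clip x) => y; lra.
have e20 : 0 < e ^- 2 by rewrite invr_gt0 exprn_gt0.
apply: (@le_trans _ _ (EB a b (fun x => e ^- 2 * (clip x - p) ^+ 2))).
  apply: (@le_EB _ _ _ _ _ (1 + e ^- 2)) => //.
  - by move=> x; rewrite (le_trans (indic_norm_le1 _ _))// lerDl ltW.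
  - exact: measurable_funM.
  - move=> x; rewrite normrM (ger0_norm (ltW e20)).
    by rewrite (le_trans (ler_wpM2l (ltW e20) (qb x)))// mulr1 lerDr.
  move=> x x01; rewrite indicE; case: (boolP (x \in A)); rewrite ?inE => xA; last first.
    by rewrite mulr_ge0 ?sqr_ge0// ltW.
  rewrite ler_pdivlMl ?exprn_gt0// mulr1 clipE; last by lra.
  by rewrite -[leRHS](@real_normK R) ?num_real// lerXn2r ?nnegrE ?(ltW e0)//; exact: HA.
rewrite EB.unlock (@BIZ _ _ _ _ 1)// -mulrA ler_wpM2l ?(ltW e20)//.
have := EB_sqdist p a0 b0; rewrite EB.unlock => ->; rewrite lerD2l.
rewrite invfM mulrA -[leRHS]mul1r ler_wpM2r ?invr_ge0//; first by lra.
rewrite ler_pdivrMr ?exprn_gt0// mul1r; nra.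
Qed.

Lemma EB_ge0 a b h : 0 < a -> 0 < b -> (forall x, 0 < x < 1 -> 0 <= h x) -> 0 <= EB a b h.
Proof. by move=> a0 b0 h0; rewrite EB.unlock divr_ge0 ?ge0_BI// ltW// beta_const_gt0. Qed.

End BetaMoments.

(** * Binomial expectations *)

Section Binomial.
Context {R : realType}.
Implicit Types (p : R) (h : nat -> R).

Definition binomE (N : nat) p h : R :=
  \sum_(z < N.+1) 'C(N, z)%:R * p ^+ z * (1 - p) ^+ (N - z) * h z.

(** Pascal's rule, that is, conditioning on one trial: a success shifts the argument of [h]. *)
Lemma binomES N p h :
  binomE N.+1 p h = (1 - p) * binomE N p h + p * binomE N p (h \o S).
Proof.
rewrite /binomE big_ord_recl /= bin0 expr0 subn0 !mulr1 !mul1r.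
under eq_bigr => i _ do rewrite /bump /= add1n binS natrD !mulrDl subSS.
rewrite big_split /= addrA; congr (_ + _); last first.
  by rewrite big_distrr/=; apply: eq_bigr => i _; rewrite exprS; ring.
rewrite [in RHS]big_ord_recl /= bin0 expr0 subn0 !mulr1 !mul1r mulrDr mulrA -exprS; congr (_ + _).
rewrite big_ord_recr /= bin_small// !mul0r addr0 big_distrr/=.
apply: eq_bigr => i _; rewrite /bump/= add1n.
have -> : (N - i = (N - i.+1).+1)%N by rewrite subnSK.
by rewrite [(1 - p) ^+ _.+1]exprS; ring.
Qed.

Lemma binomE1 N p : binomE N p (fun=> 1) = 1.
Proof.
elim: N => [|N IH]; first by rewrite /binomE big_ord1/= bin0 !expr0 !mulr1.
by rewrite binomES (_ : (fun=> 1) \o S = (fun=> 1))// IH; ring.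
Qed.

(** Squared mean plus variance. The free shift [c] lets the induction close, since a success turns c
    into 1 + c. *)
Lemma binomE_sqr N p (c : R) :
  binomE N p (fun z => (z%:R + c) ^+ 2) = (N%:R * p + c) ^+ 2 + N%:R * p * (1 - p).
Proof.
elim: N c => [|N IH] c; first by rewrite /binomE big_ord1/= bin0 !expr0; ring.
rewrite binomES IH; have -> : (fun z : nat => (z%:R + c) ^+ 2) \o S = (fun z => (z%:R + (1 + c)) ^+ 2).
  by apply/funext => z /=; rewrite -natr1; ring.
by rewrite IH -natr1; ring.
Qed.

Lemma le_binomE N p h1 h2 : 0 <= p <= 1 -> (forall z, (z <= N)%N -> h1 z <= h2 z) ->
  binomE N p h1 <= binomE N p h2.
Proof.
move=> p01 h12; apply: ler_sum => z _; rewrite ler_wpM2l//; last by apply: h12; rewrite -ltnS.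
by rewrite !mulr_ge0 ?ler0n// exprn_ge0//; lra.
Qed.

Lemma binomED N p h1 h2 : binomE N p (fun z => h1 z + h2 z) = binomE N p h1 + binomE N p h2.
Proof. by rewrite /binomE -big_split; apply: eq_bigr => i _; rewrite mulrDr. Qed.

Lemma binomEZ N p (k : R) h : binomE N p (fun z => k * h z) = k * binomE N p h.
Proof. by rewrite /binomE big_distrr; apply: eq_bigr => i _ /=; ring. Qed.

End Binomial.

(** * Concentration of one transition *)

Section Kernel.
Context {R : realType}.
Implicit Types (al be : nat -> R).

Lemma Ups_itv al be j (v : R) : (forall j, 0 < al j /\ 0 < be j) -> 0 <= Ups al be j v <= 1.
Proof.
move=> pos; have [a0 b0] := pos j; have [a1 b1] := pos j.+1.
by apply: betaQ_itv => //; exact: betaCDF_le1.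
Qed.

Lemma kerI1E N al be j v (A : set R) : (forall j, 0 < al j /\ 0 < be j) -> measurable A ->
  kerI N al be j v A (fun=> 1%E) =
  (binomE N (Ups al be j v) (fun z => EB (al j.+1 + z%:R) (be j.+1 + (N - z)%:R) (\1_A)))%:E.
Proof.
move=> pos mA; have [a1 b1] := pos j.+1.
rewrite /kerI /binomE -sumEFin; apply: eq_bigr => z _; rewrite [RHS]EFinM; congr (_ * _)%E.
rewrite (@betaI_EB _ _ _ _ (fun=> 1) 1)//; first by congr (EB _ _ _)%:E; apply/funext => x; rewrite mul1r.
- by rewrite ltr_wpDr.
- by rewrite ltr_wpDr.
- by move=> x; rewrite normr1.
Qed.

(** Each Beta component satisfies Chebyshev around [Ups], and the bound is averaged over the
    binomial index. It depends on the state only through the hypothesis on [A], with rate O(1/N). *)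
Lemma kerI_tail N al be j v (A : set R) (e : R) : (forall j, 0 < al j /\ 0 < be j) ->
  measurable A -> 0 < e -> (0 < N)%N ->
  (forall x, A x -> 0 < x < 1 -> e <= `|x - Ups al be j v|) ->
  (kerI N al be j v A (fun=> 1) <= (e ^- 2 * (2 + (al j.+1 + be j.+1) ^+ 2) / N%:R)%:E)%E.
Proof.
move=> pos mA e0 N0 HA; rewrite kerI1E// lee_fin.
have := Ups_itv j v pos; set p := Ups al be j v in HA * => p01.
have [a1 b1] := pos j.+1; move: (al j.+1) (be j.+1) a1 b1 => a b a0 b0.
pose s := a + b + N%:R; have n0 : 1 <= N%:R :> R by rewrite ler1n.
have s0 : 0 < s by rewrite /s; lra.
(* All components share the parameter sum s = a + b + N, so the bias of the component z is (z + c0)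
   / s. Under the binomial law z + c0 has mean a - p (a + b), free of N, and variance at most N;
   division by s^2 leaves O(1/N). *)
pose c0 := a - p * s.
apply: (@le_trans _ _ (binomE N p (fun z => e ^- 2 / s ^+ 2 * (z%:R + c0) ^+ 2 + e ^- 2 / (s + 1) * 1))).
  apply: le_binomE => // z zN.
  have E : a + z%:R + (b + (N - z)%:R) = s by rewrite natrB// /s; ring.
  have az : 0 < a + z%:R by rewrite ltr_wpDr.
  have bz : 0 < b + (N - z)%:R by rewrite ltr_wpDr.
  have := EB_dist_tail az bz e0 mA HA p01; rewrite E.
  have -> : (a + z%:R) / s - p = (z%:R + c0) / s by rewrite /c0; field; rewrite gt_eqF.
  have s1 : 0 < s + 1 by lra.
  move/le_trans; apply; rewrite le_eqVlt; apply/orP; left; apply/eqP.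
  by move: (z%:R : R) => zz; clearbody s c0; field; rewrite !gt_eqF.
rewrite binomED !binomEZ binomE1 binomE_sqr mulr1 /c0.
have -> : N%:R * p + (a - p * s) = a - p * (a + b) by rewrite /s; ring.
have e2 : 0 < e ^- 2 by rewrite invr_gt0 exprn_gt0.
rewrite -!mulrA -mulrDr ler_wpM2l ?(ltW e2)//.
have h1 : (a - p * (a + b)) ^+ 2 <= (a + b) ^+ 2.
  rewrite -[leLHS](@real_normK R) ?num_real// lerXn2r ?nnegrE//; first by lra.
  by rewrite ler_norml; apply/andP; split; nra.
have h2 : N%:R * (p * (1 - p)) <= N%:R :> R.
  by rewrite -[leRHS]mulr1 ler_wpM2l//; nra.
rewrite mulrA.
have h3 : (s ^+ 2)^-1 <= (s * N%:R)^-1.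
  by rewrite lef_pV2 ?posrE ?exprn_gt0 ?mulr_gt0//; [rewrite expr2 ler_wpM2l ?(ltW s0)// /s; lra|lra].
have h5 : (s + 1)^-1 <= N%:R^-1 by rewrite lef_pV2 ?posrE; rewrite /s; lra.
have h4 : (s ^+ 2)^-1 * ((a - p * (a + b)) ^+ 2 + N%:R * (p * (1 - p))) <= (1 + (a + b) ^+ 2) / N%:R.
  apply: (@le_trans _ _ ((s ^+ 2)^-1 * ((a + b) ^+ 2 + N%:R))).
    by rewrite ler_wpM2l ?invr_ge0 ?exprn_ge0 ?(ltW s0)// lerD.
  apply: (@le_trans _ _ ((s * N%:R)^-1 * ((a + b) ^+ 2 + N%:R))).
    by rewrite ler_wpM2r// addr_ge0// sqr_ge0.
  rewrite invfM [X in X * _]mulrC -mulrA mulrC ler_wpM2r ?invr_ge0//.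
  rewrite ler_pdivrMl// /s; have : 0 <= (a + b) ^+ 2 by exact: sqr_ge0.
  move: ((a + b) ^+ 2) => q q0; nra.
have -> : (2 + (a + b) ^+ 2) / N%:R = (1 + (a + b) ^+ 2) / N%:R + N%:R^-1 by field; rewrite gt_eqF//; lra.
by rewrite -[N%:R * p * _]mulrA lerD.
Qed.

End Kernel.

(** * Uniform estimates on [0, 1] by compactness *)

Section Uniformity.
Context {R : realType}.

(** If uniformity failed around some u0, choice would produce indices m k >= k and points u k within
    1/(k+1) of u0 at which [P] fails for every k; the hypothesis forbids this. Near-covering
    compactness then joins the local thresholds into one. *)
Lemma unif01 (P : nat -> R -> Prop) :
  (forall (m : nat -> nat) (u : nat -> R) (u0 : R), (forall k, (k <= m k)%N) ->
     (forall k, 0 <= u k <= 1) -> 0 <= u0 <= 1 -> u @ \oo --> u0 ->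
     exists k, P (m k) (u k)) ->
  exists m0, forall m, (m0 <= m)%N -> forall u, 0 <= u <= 1 -> P m u.
Proof.
move=> HP; have := @segment_compact R 0 1; move/compact_near_coveringP.
move=> /(_ nat \oo (fun m u => 0 <= u <= 1 -> P m u) _) [].
  move=> u0; rewrite /= in_itv/= => u001; apply: contrapT => nP.
  have H k : exists mu : nat * R, [/\ (k <= mu.1)%N, `|u0 - mu.2| < harmonic k,
      0 <= mu.2 <= 1 & ~ P mu.1 mu.2].
    apply: contrapT => nE; apply: nP.
    exists (ball u0 (harmonic k), [set m | (k <= m)%N]); first split => /=.
    - by apply: nbhsx_ballx; exact: harmonic_gt0.
    - by exists k.
    move=> [u m] /= [bu km] u01; apply: contrapT => nPmu; apply: nE.
    by exists (m, u); split.
  have [mu Hmu] := choice H.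
  have [] := HP (fun k => (mu k).1) (fun k => (mu k).2) u0.
  - by move=> k; have [] := Hmu k.
  - by move=> k; have [] := Hmu k.
  - by [].
  - apply/cvgrPdist_lt => e e0.
    have /cvgrPdist_lt /(_ e e0) := @cvg_harmonic R; apply: filterS => k.
    rewrite sub0r normrN ger0_norm ?harmonic_ge0// => hk.
    by have [_ h _ _] := Hmu k; exact: lt_trans hk.
  - by move=> k; have [_ _ _ ] := Hmu k.
move=> m0 _ H; exists m0 => m mm u u01.
by apply: (H m mm u) => //; rewrite /= in_itv.
Qed.

Lemma Ups_cvg (al be : nat -> nat -> R) (alpha beta : nat -> R) j (un : nat -> R) u :
  (forall j, (fun n => al n j) @ \oo --> alpha j) ->
  (forall j, (fun n => be n j) @ \oo --> beta j) ->
  (forall j, 0 < alpha j /\ 0 < beta j) ->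
  (forall n j, 0 < al n j /\ 0 < be n j) ->
  un @ \oo --> u ->
  (fun n => Ups (al n) (be n) j (un n)) @ \oo --> Ups alpha beta j u.
Proof.
move=> ala beb pos posn unu; have [a0 b0] := pos j; have [a1 b1] := pos j.+1.
apply: betaQ_cvg => //.
- by apply: betaCDF_cvg => // n; have [] := posn n j.
- by move=> n; have [] := posn n j.+1.
- by move=> n; have [] := posn n j.+1.
- by move=> n; have [? ?] := posn n j; rewrite betaCDF_ge0 ?betaCDF_le1.
- by rewrite betaCDF_ge0 ?betaCDF_le1.
Qed.

Lemma cvg_comp_ge (T : topologicalType) (f : nat -> T) (l : T) (m : nat -> nat) :
  (forall k, (k <= m k)%N) -> f @ \oo --> l -> (fun k => f (m k)) @ \oo --> l.
Proof.
move=> km fl; apply: cvg_comp fl => A [n _ nA].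
by exists n => // k /= nk; apply: nA => /=; exact: leq_trans (km k).
Qed.

Lemma cvg_same_close (f g : nat -> R) (l e : R) :
  f @ \oo --> l -> g @ \oo --> l -> 0 < e -> exists k, `|f k - g k| < e.
Proof.
move=> fl gl e0; have c3 : (fun k => f k - g k) @ \oo --> (0 : R).
  by rewrite -(subrr l); exact: cvgB.
have /cvgrPdist_lt /(_ e e0) [k _ /(_ k (leqnn k))] := c3.
by rewrite /= sub0r normrN => h; exists k.
Qed.

Lemma Ups_unif (al be : nat -> nat -> R) (alpha beta : nat -> R) j (e : R) :
  (forall j, (fun n => al n j) @ \oo --> alpha j) ->
  (forall j, (fun n => be n j) @ \oo --> beta j) ->
  (forall j, 0 < alpha j /\ 0 < beta j) ->
  (forall n j, 0 < al n j /\ 0 < be n j) -> 0 < e ->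
  exists m0, forall n, (m0 <= n)%N -> forall u u' : R, 0 <= u <= 1 ->
    `|u - u'| <= harmonic m0 -> `|Ups (al n) (be n) j u' - Ups alpha beta j u| < e.
Proof.
move=> ala beb pos posn e0.
(* One index m serves both as threshold for n and, through [harmonic m], as radius around u, so a
   single compactness argument gives both. *)
pose P m u := forall n, (m <= n)%N -> forall u' : R,
    `|u - u'| <= harmonic m -> `|Ups (al n) (be n) j u' - Ups alpha beta j u| < e.
have [m0 Hm0] : exists m0, forall m, (m0 <= m)%N -> forall u, 0 <= u <= 1 -> P m u.
  apply: unif01 => m u u0 km u01 u001 uu0; apply: contrapT => nP.
  have H k : exists nu : nat * R, [/\ (k <= nu.1)%N, `|u k - nu.2| <= harmonic k &
      e <= `|Ups (al nu.1) (be nu.1) j nu.2 - Ups alpha beta j (u k)|].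
    apply: contrapT => nE; apply: nP; exists k => n mn u' uu'.
    rewrite ltNge; apply/negP => eU; apply: nE; exists (n, u'); split => //=.
      exact: leq_trans (km k) mn.
    by rewrite (le_trans uu')// /harmonic/= lef_pV2 ?posrE ?ltr0n// ler_nat ltnS.
  have [nu Hnu] := choice H.
  have c1 : (fun k => Ups alpha beta j (u k)) @ \oo --> Ups alpha beta j u0.
    by apply: (@Ups_cvg (fun=> alpha) (fun=> beta)) => // i; exact: cvg_cst.
  have c2 : (fun k => Ups (al (nu k).1) (be (nu k).1) j (nu k).2) @ \oo --> Ups alpha beta j u0.
    apply: (@Ups_cvg (fun k => al (nu k).1) (fun k => be (nu k).1)) => //.
    - move=> i; apply: (@cvg_comp_ge _ (fun n => al n i) _ (fun k => (nu k).1)) => //.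
      by move=> k; have [] := Hnu k.
    - move=> i; apply: (@cvg_comp_ge _ (fun n => be n i) _ (fun k => (nu k).1)) => //.
      by move=> k; have [] := Hnu k.
    apply/cvgrPdist_lt => d d0.
    have hd : 0 < d / 2 by lra.
    have /cvgrPdist_lt /(_ _ hd) h1 := @cvg_harmonic R.
    have /cvgrPdist_lt /(_ _ hd) h2 := uu0.
    apply: filterS2 h1 h2 => k; rewrite sub0r normrN ger0_norm ?harmonic_ge0// => h1 h2.
    have [_ h3 _] := Hnu k.
    rewrite (_ : u0 - (nu k).2 = (u0 - u k) + (u k - (nu k).2)); last by ring.
    by rewrite (le_lt_trans (ler_normD _ _))//; lra.
  have [k hk] := cvg_same_close c2 c1 e0.
  by have [_ _] := Hnu k; rewrite leNgt hk.
by exists m0 => n mn u u' u01 uu'; exact: (Hm0 m0).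
Qed.

Lemma Ups_continuous (al be : nat -> R) j : (forall j, 0 < al j /\ 0 < be j) ->
  continuous (Ups al be j).
Proof.
move=> pos u; apply/(@cvg_nbhsP _ R^o) => un unu.
by apply: (@Ups_cvg (fun=> al) (fun=> be)) => // i; exact: cvg_cst.
Qed.

Lemma measurable_Ups (al be : nat -> R) j : (forall j, 0 < al j /\ 0 < be j) ->
  measurable_fun setT (Ups al be j).
Proof. by move=> pos; apply: continuous_measurable_fun; exact: Ups_continuous. Qed.

End Uniformity.

(** * Monotonicity of the nested kernel integrals *)

Section Chain.
Context {R : realType}.
Implicit Types (al be : nat -> R) (A : nat -> set R).
Local Open Scope ereal_scope.

Lemma betaI_ge0 (a b : R) (A : set R) (g : R -> \bar R) : (0 < a)%R -> (0 < b)%R ->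
  (forall x, 0 <= g x) -> 0 <= betaI a b A g.
Proof.
move=> a0 b0 g0; apply: integral_ge0 => x _; rewrite mule_ge0// lee_fin.
by rewrite divr_ge0 ?beta_dens_ge0// ltW// beta_const_gt0.
Qed.

Lemma betaI_leZ (a b : R) (A : set R) (f g : R -> \bar R) (c : R) : (0 < a)%R -> (0 < b)%R ->
  (0 <= c)%R -> measurable A -> measurable_fun setT f -> measurable_fun setT g ->
  (forall x, 0 <= f x) -> (forall x, 0 <= g x) ->
  (forall x, A x -> f x <= c%:E * g x) -> betaI a b A f <= c%:E * betaI a b A g.
Proof.
move=> a0 b0 c0 mA mf mg f0 g0 fg.
have d0 x : 0 <= (beta_dens a b x / beta_const a b)%:E.
  by rewrite lee_fin divr_ge0 ?beta_dens_ge0// ltW// beta_const_gt0.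
have md : measurable_fun A (fun x => (beta_dens a b x / beta_const a b)%:E).
  apply/measurable_EFinP; apply: measurable_funTS; apply: measurable_funM => //.
  exact: measurable_beta_dens.
rewrite /betaI -ge0_integralZl_EFin//; last 2 first.
- by move=> x _; exact: mule_ge0.
- by apply: emeasurable_funM => //; exact: measurable_funTS.
apply: ge0_le_integral => //.
- by move=> x _; exact: mule_ge0.
- by apply: emeasurable_funM => //; exact: measurable_funTS.
- by apply: measurable_funeM; apply: emeasurable_funM => //; exact: measurable_funTS.
by move=> x Ax; rewrite muleA lee_wpmul2r// fg.
Qed.

Lemma ker_coef_ge0 N al be j (u : R) z : (forall j, (0 < al j)%R /\ (0 < be j)%R) ->
  0 <= ('C(N, z)%:R * Ups al be j u ^+ z * (1 - Ups al be j u) ^+ (N - z))%:E.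
Proof.
move=> pos; have /andP[u0 u1] := Ups_itv j u pos.
by rewrite lee_fin !mulr_ge0 ?exprn_ge0// subr_ge0.
Qed.

Lemma ker_param_gt0 N al be j z : (forall j, (0 < al j)%R /\ (0 < be j)%R) ->
  (0 < al j + z%:R)%R /\ (0 < be j + (N - z)%:R)%R.
Proof. by move=> pos; have [a0 b0] := pos j; rewrite !ltr_wpDr. Qed.

Lemma kerI_ge0 N al be j u (A : set R) g : (forall j, (0 < al j)%R /\ (0 < be j)%R) ->
  (forall x, 0 <= g x) -> 0 <= kerI N al be j u A g.
Proof.
move=> pos g0; apply: sume_ge0 => z _; rewrite mule_ge0 ?ker_coef_ge0//.
by have [? ?] := ker_param_gt0 N j.+1 z pos; exact: betaI_ge0.
Qed.

Lemma measurable_kerI N al be j (A : set R) g : (forall j, (0 < al j)%R /\ (0 < be j)%R) ->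
  measurable_fun setT (fun u => kerI N al be j u A g).
Proof.
move=> pos; apply: emeasurable_sum => z; under eq_fun do rewrite muleC.
apply: measurable_funeM; apply/measurable_EFinP.
have mU := measurable_Ups j pos.
apply: measurable_funM; last by apply: measurable_funX; exact: measurable_funB.
by apply: measurable_funM => //; exact: measurable_funX.
Qed.

Lemma kerI_leZ N al be j u (A : set R) f g (c : R) : (forall j, (0 < al j)%R /\ (0 < be j)%R) ->
  (0 <= c)%R -> measurable A -> measurable_fun setT f -> measurable_fun setT g ->
  (forall x, 0 <= f x) -> (forall x, 0 <= g x) ->
  (forall x, A x -> f x <= c%:E * g x) -> kerI N al be j u A f <= c%:E * kerI N al be j u A g.
Proof.
move=> pos c0 mA mf mg f0 g0 fg; rewrite /kerI ge0_sume_distrr; last first.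
  move=> z _; rewrite mule_ge0 ?ker_coef_ge0//.
  by have [? ?] := ker_param_gt0 N j.+1 z pos; exact: betaI_ge0.
apply: lee_sum => z _; rewrite muleCA lee_wpmul2l ?ker_coef_ge0//.
by have [? ?] := ker_param_gt0 N j.+1 z pos; exact: betaI_leZ.
Qed.

Lemma chainF_ge0 N al be A k j u : (forall j, (0 < al j)%R /\ (0 < be j)%R) ->
  0 <= chainF N al be A k j u.
Proof. by move=> pos; elim: k j u => [|k IH] j u //=; exact: kerI_ge0. Qed.

Lemma measurable_chainF N al be A k j : (forall j, (0 < al j)%R /\ (0 < be j)%R) ->
  measurable_fun setT (chainF N al be A k j).
Proof. by move=> pos; case: k => [|k] /=; [exact: measurable_cst|exact: measurable_kerI]. Qed.

(** The last transition is the innermost integral. The induction on [k] carries its bound outwards,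
    each outer kernel being monotone and homogeneous. *)
Lemma chainF_step N al be A k j (c : R) : (forall j, (0 < al j)%R /\ (0 < be j)%R) ->
  (0 <= c)%R -> (forall i, measurable (A i)) ->
  (forall u, A (j + k)%N u -> kerI N al be (j + k) u (A (j + k).+1) (fun=> 1) <= c%:E) ->
  forall u, A j u -> chainF N al be A k.+1 j u <= c%:E * chainF N al be A k j u.
Proof.
move=> pos c0 mA; elim: k j => [|k IH] j H u Au; first by rewrite addn0 in H; rewrite mule1; exact: H.
change (kerI N al be j u (A j.+1) (chainF N al be A k.+1 j.+1) <=
  c%:E * kerI N al be j u (A j.+1) (chainF N al be A k j.+1)).
apply: kerI_leZ => //.
- exact: measurable_chainF.
- exact: measurable_chainF.
- by move=> x; exact: chainF_ge0.
- by move=> x; exact: chainF_ge0.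
by move=> x Ax; apply: IH => //; rewrite addSnnS.
Qed.

End Chain.

(** * Probabilities of length events in a Markov stick-breaking process *)

Section BMSB.
Context {R : realType} {X : completePseudoMetricType R}.
Context {d : measure_display} {Omega : measurableType d} (Pr : probability Omega R).
Context (N : nat) (al be : nat -> R) (P0 : probability (Borel X) R).
Context (v : nat -> Omega -> R) (th : nat -> Omega -> Borel X).
Hypothesis H : is_BMSB Pr N al be P0 v th.

Let pos : forall j, 0 < al j /\ 0 < be j. Proof. by case: H. Qed.
Let mv j : measurable_fun setT (v j). Proof. by case: H. Qed.

Lemma BMSB_lengths k (A : nat -> set R) : (forall i, measurable (A i)) ->
  Pr [set w | forall i, (i <= k)%N -> A i (v i w)] =
  betaI (al 0%N) (be 0%N) (A 0%N) (chainF N al be A k 0%N).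
Proof.
move=> mA; case: H => _ _ _ _ /(_ k A (fun=> setT) mA (fun=> measurableT)).
rewrite big1 ?mule1; last by move=> i _; exact: probability_setT.
by move=> <-; congr (Pr _); apply/seteqP; split => w /= h i ik; [split => //; exact: h|case: (h i ik)].
Qed.

Lemma measurable_BMSB_lengths k (A : nat -> set R) : (forall i, measurable (A i)) ->
  measurable [set w | forall i, (i <= k)%N -> A i (v i w)].
Proof.
move=> mA; rewrite (_ : [set w | _] = \bigcap_(i in `I_k.+1) (v i @^-1` A i)).
  by apply: bigcap_measurable => [|i _]; [exists 0%N|rewrite -[X in measurable X]setTI; exact: mv].
by apply/seteqP; split => w /= h i ik; apply: h.
Qed.

Lemma BMSB_step_le j (c : R) (A : nat -> set R) : (forall i, measurable (A i)) -> 0 <= c ->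
  (forall u, A j u -> (kerI N al be j u (A j.+1) (fun=> 1) <= c%:E)%E) ->
  (Pr [set w | forall i, (i <= j.+1)%N -> A i (v i w)] <= c%:E)%E.
Proof.
move=> mA c0 HA; rewrite BMSB_lengths//; have [a0 b0] := pos 0.
apply: (@le_trans _ _ (c%:E * Pr [set w | forall i, (i <= j)%N -> A i (v i w)])%E); last first.
  by rewrite -[leRHS]mule1 lee_wpmul2l ?lee_fin// probability_le1//; exact: measurable_BMSB_lengths.
rewrite BMSB_lengths//; apply: betaI_leZ => //.
- exact: measurable_chainF.
- exact: measurable_chainF.
- by move=> x; exact: chainF_ge0.
- by move=> x; exact: chainF_ge0.
- by move=> u Au; apply: chainF_step.
Qed.

(** The form in which the Markov property is used: a kernel bound valid for all states in [A] bounds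
    the probability of a rectangle of consecutive lengths, the other coordinates being left free. *)
Lemma BMSB_pair_le j (c : R) (A B : set R) : measurable A -> measurable B -> 0 <= c ->
  (forall u, A u -> (kerI N al be j u B (fun=> 1) <= c%:E)%E) ->
  (Pr [set w | A (v j w) /\ B (v j.+1 w)] <= c%:E)%E.
Proof.
move=> mA mB c0 HA.
pose AA i := if i == j then A else if i == j.+1 then B else setT.
have mAA i : measurable (AA i) by rewrite /AA; case: ifP => // _; case: ifP.
have -> : [set w | A (v j w) /\ B (v j.+1 w)] = [set w | forall i, (i <= j.+1)%N -> AA i (v i w)].
  apply/seteqP; split => w /=.
    by move=> [Aw Bw] i _; rewrite /AA; case: eqP => [->//|_]; case: eqP => [->|].
  move=> h; have := h j (leqnSn j); have := h j.+1 (leqnn _).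
  by rewrite /AA !eqxx gtn_eqF.
apply: BMSB_step_le => // u; rewrite /AA !eqxx gtn_eqF//; exact: HA.
Qed.

Lemma BMSB_off01 j : Pr [set w | ~ (0 < v j w < 1)] = 0%E.
Proof.
pose C : set R := ~` `]0, 1[%classic.
have mC : measurable C by apply: measurableC.
have CE w : (~ (0 < v j w < 1)) = C (v j w) by rewrite /C /= in_itv.
have EC (a b : R) : EB a b (\1_C) = 0.
  rewrite (@EB_eq _ _ _ _ (fun=> 0)).
    by rewrite EB.unlock BI.unlock; under eq_Rintegral do rewrite mul0r; rewrite Rintegral_cst// !mul0r.
  by move=> x x01; rewrite indicE memNset// /C /= in_itv/= => /(_ x01).
case: j CE => [|j] CE.
  have := @BMSB_lengths 0 (fun=> C) (fun=> mC).
  rewrite (_ : [set w | forall i, _] = [set w | ~ (0 < v 0 w < 1)]); last first.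
    by apply/seteqP; split => w /=; rewrite CE => h; [exact: h|move=> i; rewrite leqn0 => /eqP ->].
  move=> ->; have [a0 b0] := pos 0; rewrite /= (@betaI_EB _ _ _ _ (fun=> 1) 1)//.
    by rewrite (_ : (fun x => _) = \1_C) ?EC//; apply/funext => x; rewrite mul1r.
  by move=> x; rewrite normr1.
apply/eqP; rewrite eq_le measure_ge0 andbT.
rewrite (_ : [set w | _] = [set w | setT (v j w) /\ C (v j.+1 w)]); last first.
  by apply/seteqP; split => w /=; rewrite CE => // -[].
apply: BMSB_pair_le => // u _; rewrite kerI1E// lee_fin.
by rewrite /binomE big1// => z _; rewrite EC mulr0.
Qed.

End BMSB.

(** * The deterministic maps that drive the limit process *)

Section LimitMaps.
Context {R : realType}.
Variables (alpha beta : nat -> R).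
Hypothesis pos : forall j, 0 < alpha j /\ 0 < beta j.

(** The limit length of index j as a function of the first one, composed step by step to match the
    recursion of the completely dependent process; [tmapE] gives the closed form. *)
Fixpoint tmap (j : nat) (u : R) : R :=
  if j is j'.+1 then Ups alpha beta j' (tmap j' u) else u.

Lemma tmap_continuous j : continuous (tmap j).
Proof.
elim: j => [|j IH] u /=; first exact: cvg_id.
by apply: (@continuous_comp _ _ _ (tmap j)); [exact: IH|exact: Ups_continuous].
Qed.

Lemma tmap_seq_cvg j (u : nat -> R) u0 : u @ \oo --> u0 ->
  (fun k => tmap j (u k)) @ \oo --> tmap j u0.
Proof. by move=> uu0; apply: continuous_cvg => //; exact: tmap_continuous. Qed.

Lemma tmap_itv j u : 0 <= u <= 1 -> 0 <= tmap j u <= 1.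
Proof. by case: j => //= j _; exact: Ups_itv. Qed.

End LimitMaps.

(** Sequential continuity for coordinatewise convergence. All limits below are along sequences, and
    products and stick-breaking weights satisfy it coordinate by coordinate. *)
Definition seqcont {R : realType} (G : (nat -> R) -> R) :=
  forall (y : nat -> nat -> R) (y0 : nat -> R),
    (forall j, (fun k => y k j) @ \oo --> y0 j) -> (fun k => G (y k)) @ \oo --> G y0.

(** * The lengths are close in probability to the image of the first one *)

Section Approximation.
Context {R : realType} {X : completePseudoMetricType R}.
Unset Implicit Arguments.
Variables (dn : nat -> measure_display) (Om : forall n, measurableType (dn n))
  (Pr : forall n, probability (Om n) R)
  (N : nat -> nat) (al be : nat -> nat -> R)
  (P0 : nat -> probability (Borel X) R)
  (v : forall n, nat -> Om n -> R) (th : forall n, nat -> Om n -> Borel X)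
  (alpha beta : nat -> R).
Hypothesis HB : forall n, is_BMSB (Pr n) (N n) (al n) (be n) (P0 n) (v n) (th n).
Hypothesis HN : forall M : nat, \forall n \near \oo, (M <= N n)%N.
Hypothesis ala : forall j, (fun n => al n j) @ \oo --> alpha j.
Hypothesis beb : forall j, (fun n => be n j) @ \oo --> beta j.
Hypothesis pos : forall j, 0 < alpha j /\ 0 < beta j.
Hypothesis v01 : forall n j w, 0 <= v n j w <= 1.

Let posn n j : 0 < al n j /\ 0 < be n j. Proof. by case: (HB n). Qed.
Let mv n j : measurable_fun setT (v n j). Proof. by case: (HB n). Qed.

Set Implicit Arguments.

(** The parameters are eventually below their limits plus 1, so the numerator is bounded while [N n]
    grows. *)
Lemma tail_rate_small j (e dl : R) : 0 < e -> 0 < dl -> \forall n \near \oo, (0 < N n)%N /\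
  e ^- 2 * (2 + (al n j.+1 + be n j.+1) ^+ 2) / (N n)%:R <= dl.
Proof.
move=> e0 dl0; have [a0 b0] := pos j.+1.
pose C := e ^- 2 * (2 + (alpha j.+1 + beta j.+1 + 1) ^+ 2).
have C0 : 0 <= C by rewrite mulr_ge0 ?invr_ge0 ?exprn_ge0 ?(ltW e0)// addr_ge0// sqr_ge0.
have s : (fun n => al n j.+1 + be n j.+1) @ \oo --> alpha j.+1 + beta j.+1 by exact: cvgD.
near=> n; have n1 : ((Num.truncn (C / dl)).+1 <= N n)%N by near: n; exact: HN.
split; first exact: leq_trans n1.
rewrite ler_pdivrMr ?ltr0n; last exact: leq_trans n1.
apply: (@le_trans _ _ C).
  rewrite ler_wpM2l ?invr_ge0 ?exprn_ge0 ?(ltW e0)// lerD2l lerXn2r ?nnegrE//.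
  - by have [? ?] := posn n j.+1; rewrite addr_ge0// ltW.
  - by rewrite !addr_ge0// ltW.
  - near: n; apply: (cvgr_le _ s) => /=; by rewrite ltrDl.
rewrite mulrC -ler_pdivrMr//.
have : C / dl < (Num.truncn (C / dl)).+1%:R by rewrite truncnS_gt// divr_ge0// ltW.
by move/ltW/le_trans; apply; rewrite ler_nat.
Unshelve. all: by end_near. Qed.

Let mU j : measurable_fun setT (Ups alpha beta j). Proof. exact: measurable_Ups. Qed.

Lemma measurable_dist_ge d (T : measurableType d) (f g : T -> R) (e : R) :
  measurable_fun setT f -> measurable_fun setT g ->
  measurable [set w | e <= `|f w - g w|].
Proof.
move=> mf mg; have mh : measurable_fun setT (fun w => `|f w - g w|).
  by apply: (measurableT_comp (@normr_measurable R setT)); exact: measurable_funB.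
rewrite (_ : [set w | _] = (fun w => `|f w - g w|) @^-1` `[e, +oo[%classic).
  by rewrite -[X in measurable X]setTI; apply: mh.
by apply/seteqP; split => w /=; rewrite in_itv/= andbT.
Qed.

(** Both terms of the distance are random. Cutting [0, 1] into cells on which the limit map hardly
    varies replaces [Ups (v_j)] by a constant, and on each cell the event becomes a rectangle to
    which [BMSB_pair_le] applies. *)
Lemma step_small j (e dl : R) : 0 < e -> 0 < dl -> \forall n \near \oo,
  (Pr n [set w | (e <= `|v n j.+1 w - Ups alpha beta j (v n j w)|)%R] <= dl%:E)%E.
Proof.
(* The triangle inequality costs 2 eta when the state is replaced by its grid point and another eta
   when the n-th map is compared with the grid value; the remaining e - 3 eta = eta is the distance
   given to the kernel bound. *)
move=> e0 dl0; pose eta := e / 4; have eta0 : 0 < eta by rewrite /eta; lra.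
have [m0 Hm0] := Ups_unif j ala beb pos posn eta0.
(* The mesh 1/K equals [harmonic m0], the radius delivered by [Ups_unif]. The grid points are i/K
   for i = 0, ..., K, hence K + 1 cells sharing the budget [dl]. *)
pose K := m0.+1; have K0 : 0 < K%:R :> R by rewrite ltr0n.
have dlK : 0 < dl / K.+1%:R by rewrite divr_gt0.
have small := tail_rate_small j eta0 dlK.
near=> n; have mn : (m0 <= n)%N by near: n; exists m0.
have [Nn cn] : (0 < N n)%N /\
  eta ^- 2 * (2 + (al n j.+1 + be n j.+1) ^+ 2) / (N n)%:R <= dl / K.+1%:R by near: n.
pose I i : set R := [set u | 0 <= u <= 1 /\ `|i%:R / K%:R - u| <= harmonic m0].
pose B i : set R := [set x | e - 2 * eta <= `|x - Ups alpha beta j (i%:R / K%:R)|].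
have mI i : measurable (I i).
  rewrite (_ : I i = `[0, 1]%classic `&` `[i%:R / K%:R - harmonic m0, i%:R / K%:R + harmonic m0]%classic).
    exact: measurableI.
  rewrite /I; apply/seteqP; split => u /=; rewrite !in_itv/= ler_distlC => -[? ?]; by split.
have mB i : measurable (B i) by apply: (@measurable_dist_ge _ _ id (fun=> _)) => //; exact: measurable_cst.
have iK i : (i < K.+1)%N -> 0 <= (i%:R / K%:R : R) <= 1.
  move=> ik; rewrite divr_ge0 ?ler0n//= ler_pdivrMr// mul1r ler_nat -ltnS//.
pose E i : set (Om n) := [set w | I i (v n j w) /\ B i (v n j.+1 w)].
have mE i : measurable (E i).
  rewrite (_ : E i = (v n j @^-1` I i) `&` (v n j.+1 @^-1` B i)); last by [].
  by apply: measurableI; rewrite -[X in measurable X]setTI; exact: mv.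
have PE i : (i < K.+1)%N -> (Pr n (E i) <= (dl / K.+1%:R)%:E)%E.
  move=> ik; have := cn; rewrite -lee_fin; apply: le_trans.
  apply: (BMSB_pair_le (HB n)) => //.
    rewrite !mulr_ge0 ?invr_ge0 ?exprn_ge0 ?(ltW eta0) ?ler0n// addr_ge0// sqr_ge0//.
  move=> u [u01 iu]; apply: (kerI_tail (posn n) (mB i) eta0 Nn) => x Bx x01.
  have := Hm0 n mn _ u (iK i ik) iu; move: Bx; rewrite /B /= /eta.
  move: (Ups _ _ _ _) (Ups _ _ _ _) => p q h1 h2.
  have := ler_normD (x - p) (p - q); rewrite subrKA; lra.
have sub : [set w | e <= `|v n j.+1 w - Ups alpha beta j (v n j w)|] `<=` \big[setU/set0]_(i < K.+1) E i.
  move=> w /= ew; have u01 := v01 n j w; set u := v n j w in ew u01 *.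
  pose i := Num.truncn (u * K%:R).
  have /andP[u0 u1] := u01.
  have um0 : 0 <= u * K%:R by rewrite mulr_ge0 ?ler0n.
  have /andP[h1 h2] : i%:R <= u * K%:R < i.+1%:R by exact: truncn_itv.
  have ik : (i < K.+1)%N.
    rewrite ltnS -(ler_nat R) (le_trans h1)// -[leRHS]mul1r ler_wpM2r//.
  have : I i u.
    split => //; rewrite ler_distl /harmonic/= -/K -(ler_pM2r K0) -[X in _ && X](ler_pM2r K0).
    rewrite !mulrDl mulNr mulfVK ?mulVf ?gt_eqF//.
    by move: h1 h2; rewrite -natr1; move: (i%:R : R) (u * _) => a b; lra.
  move=> Iu; rewrite -bigcup_mkord; exists i; [exact: ik|split; first exact: Iu].
  have := Hm0 n mn _ u (iK i ik) Iu.2; have := Hm0 n mn u u u01.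
  rewrite subrr normr0 harmonic_ge0 => /(_ isT); rewrite /B /= /eta; move: ew.
  set p := Ups alpha beta j u; set q := Ups (al n) (be n) j u.
  set r := Ups alpha beta j (i%:R / K%:R); set x := v n j.+1 w.
  move: p q r x => p q r x g1 g2 g3.
  have := ler_normD (x - r) (r - p); have := ler_normD (r - q) (q - p); rewrite !subrKA.
  rewrite [`|r - q|]distrC; lra.
apply: (@le_trans _ _ (Pr n (\big[setU/set0]_(i < K.+1) E i))).
  apply: le_measure => //; rewrite inE.
    by apply: measurable_dist_ge => //; exact: measurableT_comp.
  by apply: bigsetU_measurable.
apply: (le_trans (Boole_inequality _ (fun i _ => mE i))).
apply: (@le_trans _ _ (\sum_(i < K.+1) (dl / K.+1%:R)%:E)%E); first by apply: lee_sum => i _; exact: PE.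
by rewrite sumEFin lee_fin sumr_const card_ord -[leLHS]mulr_natr divfK// gt_eqF.
Unshelve. all: by end_near. Qed.

Lemma Ups_unif_cont j (e : R) : 0 < e -> exists2 eta : R, 0 < eta & forall x y : R,
  0 <= x <= 1 -> `|x - y| < eta -> `|Ups alpha beta j y - Ups alpha beta j x| < e.
Proof.
move=> e0; have [||m0 Hm0] := @Ups_unif _ (fun=> alpha) (fun=> beta) alpha beta j e _ _ pos (fun=> pos) e0.
- by move=> i; exact: cvg_cst.
- by move=> i; exact: cvg_cst.
exists (harmonic m0); first exact: harmonic_gt0.
by move=> x y x01 xy; apply: (Hm0 m0) => //; exact: ltW.
Qed.

Let T := tmap alpha beta.
Let mT j : measurable_fun setT (T j).
Proof. by apply: continuous_measurable_fun; exact: tmap_continuous. Qed.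

(** Induction on j: [step_small] controls the new step, and uniform continuity of the limit map
    carries over the error accumulated before. *)
Lemma tmap_small j (e dl : R) : 0 < e -> 0 < dl -> \forall n \near \oo,
  (Pr n [set w | (e <= `|v n j w - T j (v n 0%N w)|)%R] <= dl%:E)%E.
Proof.
elim: j e dl => [|j IH] e dl e0 dl0.
  apply: nearW => n; rewrite (_ : [set w | _] = set0) ?measure0 ?lee_fin ?(ltW dl0)//.
  by rewrite -subset0 => w /=; rewrite subrr normr0 leNgt e0.
have e2 : 0 < e / 2 by lra. have d2 : 0 < dl / 2 by lra.
have [eta eta0 Heta] := Ups_unif_cont j e2.
near=> n.
have h1 : (Pr n [set w | (e / 2 <= `|v n j.+1 w - Ups alpha beta j (v n j w)|)%R] <= (dl / 2)%:E)%E.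
  by near: n; exact: step_small.
have h2 : (Pr n [set w | (eta <= `|v n j w - T j (v n 0%N w)|)%R] <= (dl / 2)%:E)%E by near: n; exact: IH.
have m1 : measurable [set w | (e / 2 <= `|v n j.+1 w - Ups alpha beta j (v n j w)|)%R].
  by apply: measurable_dist_ge; [exact: mv|exact: (measurableT_comp (mU j) (mv n j))].
have m2 : measurable [set w | (eta <= `|v n j w - T j (v n 0%N w)|)%R].
  by apply: measurable_dist_ge => //; exact: measurableT_comp.
apply: (@le_trans _ _ (Pr n ([set w | (e / 2 <= `|v n j.+1 w - Ups alpha beta j (v n j w)|)%R] `|`
   [set w | (eta <= `|v n j w - T j (v n 0%N w)|)%R]))).
  apply: le_measure; [rewrite inE|rewrite inE; exact: measurableU|].
  - by apply: measurable_dist_ge; [exact: mv|exact: (measurableT_comp (mT j.+1) (mv n 0))].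
  move=> w /= ew; apply: contrapT => /not_orP[/negP n1 /negP n2].
  move: n1 n2; rewrite -!ltNge => n1 n2.
  have := Heta _ _ (v01 n j w) n2; move: ew n1; rewrite /T /=.
  move: (Ups _ _ _ _) (Ups _ _ _ _) (v n j.+1 w) => p q x h3 h4 h5.
  have := ler_normD (x - p) (p - q); rewrite subrKA [`|p - q|]distrC; lra.
by apply: (le_trans (measureU2 _ m1 m2)); rewrite (splitr dl) EFinD; exact: leeD.
Unshelve. all: by end_near. Qed.

(* Off an event of small probability the whole sequence of lengths is, as far
   as G can see, the image of its first term under the limit maps. *)
Lemma seqcont_small (G : (nat -> R) -> R) (e dl : R) : seqcont G -> 0 < e -> 0 < dl ->
  \forall n \near \oo, exists B : set (Om n), [/\ measurable B, (Pr n B <= dl%:E)%E &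
    forall w, ~ B w -> `|G (fun j => v n j w) - G (fun j => T j (v n 0%N w))| <= e].
Proof.
move=> cG e0 dl0.
(* Only the coordinates up to m are constrained: with compactness, sequential continuity of [G]
   becomes a dependence on finitely many coordinates, uniform in the first length. *)
pose P m u := forall y : nat -> R, (forall j, (j <= m)%N -> `|y j - T j u| < harmonic m) ->
  `|G y - G (fun j => T j u)| <= e.
have [m Hm] : exists m0, forall m, (m0 <= m)%N -> forall u, 0 <= u <= 1 -> P m u.
  apply: unif01 => m u u0 km u01 u001 uu0; apply: contrapT => nP.
  have H k : exists y : nat -> R, (forall j, (j <= k)%N -> `|y j - T j (u k)| < harmonic k) /\
      e < `|G y - G (fun j => T j (u k))|.
    apply: contrapT => nE; apply: nP; exists k => y Hy.
    rewrite leNgt; apply/negP => eG; apply: nE; exists y; split => // j jk.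
    apply: lt_le_trans (Hy j (leq_trans jk (km k))) _.
    by rewrite /harmonic/= lef_pV2 ?posrE ?ltr0n// ler_nat ltnS.
  have [y Hy] := choice H.
  have c1 : (fun k => G (fun j => T j (u k))) @ \oo --> G (fun j => T j u0).
    by apply: cG => j; exact: tmap_seq_cvg.
  have c2 : (fun k => G (y k)) @ \oo --> G (fun j => T j u0).
    apply: cG => j; apply/cvgrPdist_lt => d d0.
    have hd : 0 < d / 2 by lra.
    have /cvgrPdist_lt /(_ _ hd) h1 := @cvg_harmonic R.
    have /cvgrPdist_lt /(_ _ hd) h2 := tmap_seq_cvg pos (j := j) uu0.
    near=> k; have [h3 _] := Hy k; have {}h3 := h3 j; rewrite /T in h3 *.
    have g1 : `|0 - harmonic k| < d / 2 by near: k.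
    have g2 : `|tmap alpha beta j u0 - tmap alpha beta j (u k)| < d / 2 by near: k.
    have g3 : `|y k j - tmap alpha beta j (u k)| < harmonic k by apply: h3; near: k; exists j.
    move: g1 g2 g3; rewrite sub0r normrN ger0_norm ?harmonic_ge0//.
    move: (tmap _ _ _ _) (tmap _ _ _ _) (y k j) (harmonic k : R) => p q z r g1 g2 g3.
    have := ler_normD (q - p) (p - z); rewrite subrKA [`|p - z|]distrC; lra.
  have [k hk] := cvg_same_close c2 c1 e0.
  by have [_] := Hy k; rewrite ltNge (ltW hk).
have hm : 0 < harmonic m :> R by exact: harmonic_gt0.
have dm : 0 < dl / m.+1%:R by rewrite divr_gt0.
have near_all : \forall n \near \oo, forall j : 'I_m.+1,
    (Pr n [set w | (harmonic m <= `|v n j w - T j (v n 0%N w)|)%R] <= (dl / m.+1%:R)%:E)%E.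
  by apply: filter_forall => j; exact: tmap_small.
apply: filterS near_all => n Hn.
pose E i : set (Om n) := [set w | (harmonic m <= `|v n i w - T i (v n 0%N w)|)%R].
have mE i : measurable (E i).
  by apply: measurable_dist_ge; [exact: mv|exact: (measurableT_comp (mT i) (mv n 0))].
exists (\big[setU/set0]_(i < m.+1) E i); split.
- by apply: bigsetU_measurable.
- apply: (le_trans (Boole_inequality _ (fun i _ => mE i))).
  apply: (@le_trans _ _ (\sum_(i < m.+1) (dl / m.+1%:R)%:E)%E); first by apply: lee_sum => j _; exact: (Hn j).
  by rewrite sumEFin lee_fin sumr_const card_ord -[leLHS]mulr_natr divfK// gt_eqF.
move=> w; rewrite -bigcup_mkord => nB; apply: (Hm m (leqnn m) _ (v01 n 0%N w)) => j jm.
by rewrite ltNge; apply/negP => h; apply: nB; exists j.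
Unshelve. all: by end_near. Qed.

End Approximation.

(** * Bounded random variables *)

Section ProbabilityTools.
Context {R : realType} {d : measure_display} {T : measurableType d}.
Variable P : probability T R.
Implicit Types (Y : T -> R).

Lemma prob_integrable Y (M : R) : measurable_fun setT Y -> (forall w, `|Y w| <= M) ->
  P.-integrable setT (EFin \o Y).
Proof.
move=> mY YM; apply: measurable_bounded_integrable => //.
  by rewrite (le_lt_trans (probability_le1 _ measurableT))// ltry.
exists M; split; first exact: num_real.
by move=> x Mx w _; exact: le_trans (YM w) (ltW Mx).
Qed.

Lemma prob_EFin Y (M : R) : measurable_fun setT Y -> (forall w, `|Y w| <= M) ->
  (\int[P]_w (Y w)%:E = (\int[P]_w Y w)%:E)%E.
Proof.
move=> mY YM; rewrite /Rintegral fineK//; apply: integrable_fin_num => //.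
exact: prob_integrable mY YM.
Qed.

Lemma prob_Rintegral_cst (r : R) : \int[P]_w r = r.
Proof. apply: etrans; first exact: Rintegral_cst.
by rewrite [X in fine X](_ : _ = 1%E) ?mulr1//; exact: probability_setT. Qed.

(** The difference is at most e off [B] and at most 2 C on [B]. *)
Lemma prob_dist_le Y1 Y2 (C e : R) (B : set T) :
  measurable_fun setT Y1 -> measurable_fun setT Y2 ->
  (forall w, `|Y1 w| <= C) -> (forall w, `|Y2 w| <= C) -> measurable B -> 0 <= e ->
  (forall w, ~ B w -> `|Y1 w - Y2 w| <= e) ->
  `|\int[P]_w Y1 w - \int[P]_w Y2 w| <= e + 2 * C * fine (P B).
Proof.
move=> m1 m2 b1 b2 mB e0 HB.
have i1 := prob_integrable m1 b1; have i2 := prob_integrable m2 b2.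
(* [0 <= C] is read off at a sample point; an empty space carries no probability. *)
have [[w0 _]|T0] := pselect (exists w : T, True); last first.
  have : P setT = 0%E.
    by rewrite (_ : setT = set0) ?measure0//; apply/seteqP; split => // w _; apply: T0; exists w.
  by rewrite probability_setT => /eqP; rewrite onee_eq0.
have C0 : 0 <= C by rewrite (le_trans _ (b1 w0)).
have m12 : measurable_fun setT (fun w => Y1 w - Y2 w) by exact: measurable_funB.
have b12 w : `|Y1 w - Y2 w| <= 2 * C.
  by rewrite (le_trans (ler_normB _ _))// mulr_natl mulr2n lerD.
have mi : measurable_fun setT (\1_B : T -> R) by exact: measurable_indic.
have bi w : `|\1_B w : R| <= 1 by exact: indic_norm_le1.
have ii := prob_integrable mi bi.
rewrite -RintegralB//; apply: le_trans; first apply: le_normr_Rintegral => //.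
  exact: prob_integrable m12 b12.
apply: (@le_trans _ _ (\int[P]_w (e + 2 * C * \1_B w))).
  apply: le_Rintegral => //.
  - apply: (@prob_integrable _ (2 * C)) => [|w]; last by rewrite normr_id.
    exact: (measurableT_comp (@normr_measurable R setT)).
  - apply: (@prob_integrable _ (e + 2 * C)).
      by apply: measurable_funD => //; exact: measurable_funM.
    move=> w; rewrite (le_trans (ler_normD _ _))// ger0_norm// lerD2l normrM.
    by rewrite -[leRHS]mulr1 ler_pM// ger0_norm// mulr_ge0.
  move=> w _; rewrite indicE; case: (boolP (w \in B)) => wB.
    by rewrite mulr1 (le_trans (b12 w))// lerDr.
  by rewrite mulr0 addr0 HB//; move: wB; rewrite notin_setE.
rewrite RintegralD//; last 2 first.
- by apply: (@prob_integrable (fun=> e) e) => [//|w]; rewrite ger0_norm.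
- apply: (@prob_integrable _ (2 * C)); first exact: measurable_funM.
  by move=> w; rewrite normrM -[leRHS]mulr1 ler_pM// ger0_norm// mulr_ge0.
rewrite prob_Rintegral_cst lerD2l RintegralZl// ler_wpM2l ?mulr_ge0//.
by rewrite /Rintegral integral_indic// setIT.
Qed.

End ProbabilityTools.

(** * From equality on sets to equality on nonnegative functions *)

Section Extension.
Local Open Scope ereal_scope.
Context {R : realType} {dT : measure_display} {T : measurableType dT}.

Import HBNNSimple.

Lemma integral_nnsfun_comp d1 (T1 : measurableType d1) (mu : {measure set T1 -> \bar R})
  (U : T1 -> T) (Z : T1 -> \bar R) (g : {nnsfun T >-> R}) :
  measurable_fun setT U -> measurable_fun setT Z -> (forall x, 0 <= Z x) ->
  \int[mu]_x (Z x * (g (U x))%:E) =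
  \sum_(r \in range g) (r%:E * \int[mu]_(x in U @^-1` (g @^-1` [set r])) Z x).
Proof.
move=> mU mZ Z0.
have ind0 (r : R) y : r \in range g -> 0 <= (r * \1_(g @^-1` [set r]) y)%:E.
  by rewrite inE => -[t _ <-]; rewrite lee_fin mulr_ge0// indicE.
have nn (r : R) y : 0 <= (r * \1_(g @^-1` [set r]) y)%:E.
  rewrite lee_fin indicE; case: (boolP (y \in _)); rewrite ?mulr0// inE => /= <-.
  by rewrite mulr1.
have mp r : measurable (U @^-1` (g @^-1` [set r])).
  by rewrite -[X in measurable X]setTI; apply: mU => //; exact: measurable_sfunP.
transitivity (\int[mu]_x (\sum_(r \in range g) (Z x * (r * \1_(g @^-1` [set r]) (U x))%:E))).
  apply: eq_integral => x _; rewrite fimfunE -fsumEFin// ge0_mule_fsumr//.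
have mI r : measurable_fun setT (fun x => (\1_(g @^-1` [set r]) (U x))%:E).
  apply/measurable_EFinP; apply: measurableT_comp mU.
  by apply: measurable_indic; exact: measurable_sfunP.
rewrite ge0_integral_fsum//; last 2 first.
- move=> r; apply: emeasurable_funM => //; under eq_fun do rewrite EFinM.
  exact: measurable_funeM.
- by move=> r x _; rewrite mule_ge0.
apply: eq_fsbigr => r; rewrite inE => -[t _ gt].
rewrite [in RHS]integral_mkcond -ge0_integralZl_EFin//.
- apply: eq_integral => x _; rewrite patchE indicE EFinM muleCA; congr (_ * _).
  rewrite (_ : (x \in U @^-1` _) = (U x \in g @^-1` [set r])).
    by case: (U x \in _); rewrite ?mule1 ?mule0.
  by apply/idP/idP; rewrite !inE.
- by move=> x _; rewrite patchE; case: ifP.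
- by apply/(measurable_restrictT _ _).1 => //; exact: measurable_funTS.
- by rewrite -gt.
Qed.

(** The image under [U1] of the measure with density [Z1] agrees with its counterpart on sets;
    simple functions and monotone convergence do the rest. The weights make it possible to treat one
    coordinate of a product at a time. *)
Lemma integral_ext d1 (T1 : measurableType d1) (mu1 : {measure set T1 -> \bar R})
  d2 (T2 : measurableType d2) (mu2 : {measure set T2 -> \bar R})
  (U1 : T1 -> T) (Z1 : T1 -> R) (U2 : T2 -> T) (Z2 : T2 -> R) (f : T -> R) :
  measurable_fun setT U1 -> measurable_fun setT Z1 -> (forall x, (0 <= Z1 x)%R) ->
  measurable_fun setT U2 -> measurable_fun setT Z2 -> (forall x, (0 <= Z2 x)%R) ->
  (forall B, measurable B ->
     \int[mu1]_(x in U1 @^-1` B) (Z1 x)%:E = \int[mu2]_(x in U2 @^-1` B) (Z2 x)%:E) ->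
  measurable_fun setT f -> (forall y, (0 <= f y)%R) ->
  \int[mu1]_x (Z1 x * f (U1 x))%:E = \int[mu2]_x (Z2 x * f (U2 x))%:E.
Proof.
move=> mU1 mZ1 Z10 mU2 mZ2 Z20 H mf f0.
have mEf : measurable_fun setT (EFin \o f) by exact/measurable_EFinP.
pose g := nnsfun_approx measurableT mEf.
have gf y : (fun n => (g n y)%:E) @ \oo --> (f y)%:E.
  by apply: (@cvg_nnsfun_approx _ _ _ _ measurableT _ mEf) => // t _; rewrite lee_fin.
have ndg y m n : (m <= n)%N -> (g m y <= g n y)%R.
  by move=> mn; exact/lefP/nd_nnsfun_approx.
have key d (T' : measurableType d) (mu : {measure set T' -> \bar R}) (U : T' -> T) (Z : T' -> R) :
    measurable_fun setT U -> measurable_fun setT Z -> (forall x, (0 <= Z x)%R) ->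
    \int[mu]_x (Z x * f (U x))%:E = limn (fun n => \int[mu]_x ((Z x)%:E * (g n (U x))%:E)).
  move=> mU mZ Z0.
  have mgn n : measurable_fun setT (fun x => (Z x)%:E * (g n (U x))%:E).
    by apply: emeasurable_funM; apply/measurable_EFinP => //; exact: measurableT_comp.
  transitivity (\int[mu]_x (limn (fun n => (Z x)%:E * (g n (U x))%:E))).
    apply: eq_integral => x _; apply/esym/cvg_lim => //; rewrite EFinM.
    by apply: cvgeZl => //; exact: gf.
  apply: monotone_convergence => //.
  - by move=> n x _; rewrite mule_ge0// lee_fin.
  - by move=> x _ m n mn; rewrite lee_wpmul2l ?lee_fin// ndg.
have mZE d (T' : measurableType d) (Z : T' -> R) : measurable_fun setT Z ->
  measurable_fun setT (EFin \o Z) by move=> ?; exact/measurable_EFinP.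
rewrite (key _ _ mu1 U1 Z1)// (key _ _ mu2 U2 Z2)//; congr (limn _); apply/funext => n.
rewrite (@integral_nnsfun_comp _ _ mu1 U1 (EFin \o Z1))//; try exact: mZE; try by move=> x; rewrite lee_fin.
rewrite (@integral_nnsfun_comp _ _ mu2 U2 (EFin \o Z2))//; try exact: mZE; try by move=> x; rewrite lee_fin.
apply: eq_fsbigr => r _; congr (_ * _); apply: H; exact: measurable_sfunP.
Qed.

End Extension.

(** * Measurability of sequentially continuous functions of the lengths *)

Section Cylinder.
Context {R : realType} {d : measure_display} {T : measurableType d}.

(* Truncating to the first m coordinates and rounding them down to multiples of
   1/m gives a measurable approximation by functions with finitely many values. *)
Lemma measurable_seqcont (G : (nat -> R) -> R) (v : nat -> T -> R) :
  seqcont G -> (forall j, measurable_fun setT (v j)) -> (forall j w, 0 <= v j w <= 1) ->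
  measurable_fun setT (fun w => G (fun j => v j w)).
Proof.
move=> cG mv v01.
(* Coordinates beyond m get the default 0. The indices run up to m + 1, because a length equal to 1
   rounds to (m + 1)/(m + 1). *)
pose pat m (z : {ffun 'I_m.+1 -> 'I_m.+2}) j : R := if insub j is Some i then (z i)%:R / m.+1%:R else 0.
pose I m (k : nat) : set R := `[(k%:R / m.+1%:R : R), k.+1%:R / m.+1%:R[%classic.
pose Gm m w := \sum_(z : {ffun 'I_m.+1 -> 'I_m.+2}) G (pat m z) * \prod_(i < m.+1) \1_(I m (z i)) (v i w).
have tr m j w : (Num.truncn (v j w * m.+1%:R) < m.+2)%N.
  have /andP[v0 v1] := v01 j w; rewrite ltnS -(ler_nat R).
  apply: (@le_trans _ _ (v j w * m.+1%:R)).
    by have /andP[] : (Num.truncn (v j w * m.+1%:R))%:R <= v j w * m.+1%:R < (Num.truncn (v j w * m.+1%:R)).+1%:R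
      by apply: truncn_itv; rewrite mulr_ge0.
  by rewrite -[leRHS]mul1r ler_wpM2r.
have itr m j w k : (v j w \in I m k) = (k == Num.truncn (v j w * m.+1%:R)).
  have m0 : 0 < m.+1%:R :> R by rewrite ltr0n.
  have /andP[v0 v1] := v01 j w; rewrite mem_setE in_itv/= ler_pdivrMr// ltr_pdivlMr//.
  by rewrite eq_sym truncn_eq// mulr_ge0.
pose rnd m w j : R := if (j < m.+1)%N then (Num.truncn (v j w * m.+1%:R))%:R / m.+1%:R else 0.
have GmE m w : Gm m w = G (rnd m w).
  pose z : {ffun 'I_m.+1 -> 'I_m.+2} := [ffun i : 'I_m.+1 => Ordinal (tr m i w)].
  rewrite /Gm (bigD1 z)//= [X in _ + X]big1 ?addr0.
    rewrite big1 ?mulr1; last by move=> i _; rewrite indicE itr ffunE/= eqxx.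
    congr G; apply/funext => j; rewrite /pat /rnd.
    by case: insubP => [i -> <-|/negbTE ->//]; rewrite ffunE.
  move=> z' zz'; suff [i zi] : exists i, z' i != z i.
    rewrite (bigD1 i)//= indicE itr; move: zi; rewrite ffunE -val_eqE/= => /negbTE ->.
    by rewrite mul0r mulr0.
  apply: contrapT => nE; move/eqP: zz'; apply; apply/ffunP => i; apply/eqP.
  by apply: contrapT => /negP zi; apply: nE; exists i.
apply: (@measurable_fun_cvg _ _ _ setT (fun m => Gm m)).
  move=> m; apply: measurable_sum => z; apply: measurable_funM => //.
  apply: measurable_prod => i _; apply: measurableT_comp => //.
  by apply: measurable_indic; exact: measurable_itv.
move=> w _; under eq_fun do rewrite GmE.
apply: cG => j; have /andP[v0 v1] := v01 j w.
apply/cvgrPdist_lt => e e0; have /cvgrPdist_lt /(_ e e0) h := @cvg_harmonic R.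
near=> m; have jm : (j < m.+1)%N by near: m; exists j.
have : `|0 - harmonic m| < e by near: m.
rewrite sub0r normrN ger0_norm ?harmonic_ge0// => hm.
apply: le_lt_trans hm; rewrite /rnd jm /harmonic/=.
have m0 : 0 < m.+1%:R :> R by rewrite ltr0n.
have /andP[h1 h2] : (Num.truncn (v j w * m.+1%:R))%:R <= v j w * m.+1%:R < (Num.truncn (v j w * m.+1%:R)).+1%:R.
  by apply: truncn_itv; rewrite mulr_ge0.
rewrite ler_distl -(ler_pM2r m0) -[X in _ && X](ler_pM2r m0) mulrBl mulrDl mulfVK ?mulVf ?gt_eqF//.
by move: h1 h2; rewrite -natr1; lra.
Unshelve. all: by end_near. Qed.

End Cylinder.

(** * The extension for bounded functions of arbitrary sign *)

Section BoundedExtension.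
Context {R : realType} {dT : measure_display} {T : measurableType dT}.

Lemma integrable_Mr_bdd d1 (T1 : measurableType d1) (mu : {measure set T1 -> \bar R})
  (Z : T1 -> R) (g : T1 -> R) (M : R) :
  mu.-integrable setT (EFin \o Z) -> (forall x, 0 <= Z x) -> measurable_fun setT g ->
  (forall x, `|g x| <= M) -> mu.-integrable setT (EFin \o (fun x => Z x * g x)).
Proof.
move=> iZ Z0 mg gM.
have mZ : measurable_fun setT Z by exact/measurable_EFinP/(measurable_int mu iZ).
have iM : mu.-integrable setT (fun x => M%:E * (Z x)%:E)%E by exact: integrableZl.
apply: le_integrable iM => //.
  by apply/measurable_EFinP; exact: measurable_funM.
move=> x _; rewrite /= lee_fin !normrM mulrC ler_wpM2r//.
by rewrite (le_trans (gM x))// ler_norm.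
Qed.

(** Adding [M] makes [f] nonnegative; integrability of the weights then allows subtracting the
    contribution of the constant, which is equal on both sides by the case of the whole space. *)
Lemma integral_ext_bdd d1 (T1 : measurableType d1) (mu1 : {measure set T1 -> \bar R})
  d2 (T2 : measurableType d2) (mu2 : {measure set T2 -> \bar R})
  (U1 : T1 -> T) (Z1 : T1 -> R) (U2 : T2 -> T) (Z2 : T2 -> R) (f : T -> R) (M : R) :
  measurable_fun setT U1 -> mu1.-integrable setT (EFin \o Z1) -> (forall x, 0 <= Z1 x) ->
  measurable_fun setT U2 -> mu2.-integrable setT (EFin \o Z2) -> (forall x, 0 <= Z2 x) ->
  (forall B, measurable B ->
     \int[mu1]_(x in U1 @^-1` B) (Z1 x)%:E = \int[mu2]_(x in U2 @^-1` B) (Z2 x)%:E)%E ->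
  measurable_fun setT f -> (forall y, `|f y| <= M) ->
  \int[mu1]_x (Z1 x * f (U1 x)) = \int[mu2]_x (Z2 x * f (U2 x)).
Proof.
move=> mU1 iZ1 Z10 mU2 iZ2 Z20 H mf fM.
have mZ1 : measurable_fun setT Z1 by exact/measurable_EFinP/(measurable_int mu1 iZ1).
have mZ2 : measurable_fun setT Z2 by exact/measurable_EFinP/(measurable_int mu2 iZ2).
have mg : measurable_fun setT (fun y => f y + M) by exact: measurable_funD.
have g0 y : 0 <= f y + M by have := fM y; rewrite ler_norml; lra.
have M0 (y : T) : 0 <= M by exact: le_trans (fM y).
have e1 := integral_ext mU1 mZ1 Z10 mU2 mZ2 Z20 H mg g0.
have dec d (T' : measurableType d) (mu : {measure set T' -> \bar R}) (U : T' -> T) (Z : T' -> R) :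
    measurable_fun setT U -> mu.-integrable setT (EFin \o Z) -> (forall x, 0 <= Z x) ->
    \int[mu]_x (Z x * f (U x)) = \int[mu]_x (Z x * (f (U x) + M)) - \int[mu]_x Z x * M.
  move=> mU iZ Z0; have mfU : measurable_fun setT (fun x => f (U x)) by exact: measurableT_comp.
  rewrite -RintegralZr// -RintegralB//.
  - by apply: eq_Rintegral => x _; rewrite mulrDr addrK.
  - apply: (@integrable_Mr_bdd _ _ _ _ _ (2 * M)) => //; first exact: measurable_funD.
    move=> x; rewrite (le_trans (ler_normD _ _))// mulr_natl mulr2n lerD//.
    by rewrite ger0_norm// (M0 (U x)).
  - by apply: (@integrable_Mr_bdd _ _ _ _ (fun=> M) `|M|).
rewrite (dec _ _ mu1 U1 Z1)// (dec _ _ mu2 U2 Z2)//; congr (_ - _ * _).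
  by rewrite /Rintegral e1.
by have := H setT measurableT; rewrite !preimage_setT /Rintegral => ->.
Qed.

End BoundedExtension.

(** * Factorisation of expectations over the first length and the atoms *)

Section Independence.
Context {R : realType} {X : completePseudoMetricType R}.
Context {d : measure_display} {T : measurableType d} (P : probability T R).
Variables (u : T -> R) (th : nat -> T -> Borel X) (mu : probability (Borel X) R) (a b : R).
Hypothesis a0 : 0 < a.
Hypothesis b0 : 0 < b.
Hypothesis mu_ : measurable_fun setT u.
Hypothesis mth : forall j, measurable_fun setT (th j).
Hypothesis indep : forall (k : nat) (A : set R) (B : nat -> set (Borel X)),
  measurable A -> (forall i, measurable (B i)) ->
  P [set w | A (u w) /\ forall i, (i <= k)%N -> B i (th i w)]
  = (betaM a b A * \prod_(i < k.+1) mu (B i))%E.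

Let ind01 (T' : Type) (A : set T') (x : T') : 0 <= (\1_A x : R) <= 1.
Proof. by rewrite indicE; case: (_ \in _); rewrite ?lexx ?ler01. Qed.

Let prod01 (k : nat) (F : 'I_k -> R) : (forall i, 0 <= F i <= 1) -> 0 <= \prod_i F i <= 1.
Proof.
move=> F01; rewrite prodr_ge0/=; last by move=> i _; case/andP: (F01 i).
by apply: prodr_ile1 => i _; exact: F01.
Qed.

Let norm01 (x : R) : 0 <= x <= 1 -> `|x| <= 1.
Proof. by move=> /andP[x0 x1]; rewrite ger0_norm. Qed.

Let prode_fine k (B : nat -> set (Borel X)) : (forall i, measurable (B i)) ->
  (\prod_(i < k) mu (B i) = (\prod_(i < k) fine (mu (B i)))%:E)%E.
Proof.
move=> mB; rewrite (big_morph EFin EFinM erefl); apply: eq_bigr => i _.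
by rewrite fineK// fin_num_measure.
Qed.

(** With the atom event as weight under [P], and the density multiplied by the product of the atom
    probabilities under Lebesgue measure, the law on rectangles is the set equality that
    [integral_ext_bdd] asks for. *)
Lemma indep_base k (B : nat -> set (Borel X)) (h : R -> R) :
  (forall i, measurable (B i)) -> measurable_fun setT h -> (forall x, 0 <= h x <= 1) ->
  \int[P]_w (h (u w) * \prod_(i < k.+1) \1_(B i) (th i w)) =
  EB a b h * \prod_(i < k.+1) \int[mu]_x \1_(B i) x.
Proof.
move=> mB mh h01.
pose S : set T := [set w | forall i, (i <= k)%N -> B i (th i w)].
have SE w : \prod_(i < k.+1) (\1_(B i) (th i w) : R) = \1_S w.
  rewrite [RHS]indicE; case: (boolP (w \in S)) => [|].
    rewrite inE => Sw; rewrite big1// => i _; rewrite indicE mem_set//.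
    by apply: Sw; rewrite -ltnS.
  rewrite notin_setE /S /= => /existsNP[i /not_implyP[ik nB]].
  by rewrite (bigD1 (Ordinal (ik : (i < k.+1)%N)))//= indicE memNset// mul0r.
have mS : measurable S.
  rewrite (_ : S = \bigcap_(i in `I_k.+1) (th i @^-1` B i)).
    by apply: bigcap_measurable => [|i _]; [exists 0%N|rewrite -[X in measurable X]setTI; exact: mth].
  by apply/seteqP; split => w /= Sw i ik; apply: Sw.
pose c : R := \prod_(i < k.+1) fine (mu (B i)).
have cE : \prod_(i < k.+1) \int[mu]_x (\1_(B i) x : R) = c.
  by apply: eq_bigr => i _; rewrite /Rintegral integral_indic// setIT.
have c0 : 0 <= c by apply: prodr_ge0 => i _; exact: fine_ge0.
have k0 := beta_const_gt0 a0 b0.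
pose Z2 (x : measurableTypeR R) : R := c / beta_const a b * beta_dens a b x.
have iZ2 : lebesgue_measure.-integrable setT (EFin \o Z2).
  have := integrableZl (mu := lebesgue_measure) measurableT (c / beta_const a b) (integrable_beta_dens a0 b0).
  by apply: eq_integrable.
have := @integral_ext_bdd _ _ _ _ _ P _ _ lebesgue_measure u (\1_S) id Z2 h 1 mu_ _ _ _ iZ2.
have iS : P.-integrable setT (EFin \o (\1_S : T -> R)).
  by apply: (@prob_integrable _ _ _ _ _ 1) => [|w]; [exact: measurable_indic|exact: indic_norm_le1].
move=> /(_ iS _ _ _ _ mh); rewrite cE => H.
under eq_Rintegral do rewrite SE mulrC.
rewrite H//.
- rewrite EB.unlock BI.unlock mulrAC -mulrA mulrC -RintegralZl//; last first.
    by apply: (@integrable_M_beta_dens _ _ _ _ 1) => // x; exact: norm01.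
  by apply: eq_Rintegral => x _; rewrite /Z2; ring.
- by move=> x; rewrite /Z2 mulr_ge0 ?divr_ge0 ?beta_dens_ge0// ltW.
- move=> A mA; rewrite integral_indic//; last by rewrite -[X in measurable X]setTI; exact: mu_.
  rewrite (_ : S `&` u @^-1` A = [set w | A (u w) /\ forall i, (i <= k)%N -> B i (th i w)]); last first.
    by apply/seteqP; split => w [].
  apply: etrans; first exact: (indep k mA mB).
  rewrite prode_fine// -/c preimage_id /betaM /betaI muleC.
  have iD : lebesgue_measure.-integrable A (EFin \o beta_dens a b).
    by apply: (@integrableS _ _ _ _ setT) => //; exact: integrable_beta_dens.
  have -> : (\int[lebesgue_measure]_(x in A) (1 * (beta_dens a b x / beta_const a b)%:E) =
    \int[lebesgue_measure]_(x in A) ((beta_const a b)^-1%:E * (beta_dens a b x)%:E))%E.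
    by apply: eq_integral => x _; rewrite mul1e mulrC EFinM.
  have -> : (\int[lebesgue_measure]_(x in A) (Z2 x)%:E =
    \int[lebesgue_measure]_(x in A) ((c / beta_const a b)%:E * (beta_dens a b x)%:E))%E.
    by apply: eq_integral => x _; rewrite -EFinM.
  by rewrite !integralZl// muleA -EFinM.
- by move=> x; apply: norm01.
Qed.

(** Indicators are upgraded to functions one atom at a time: [m] counts the coordinates with
    arbitrary functions, the remaining ones carrying indicators. *)
Lemma indep_factor k (f : nat -> Borel X -> R) (h : R -> R) :
  (forall j, measurable_fun setT (f j)) -> (forall j x, 0 <= f j x <= 1) ->
  measurable_fun setT h -> (forall x, 0 <= h x <= 1) ->
  \int[P]_w (h (u w) * \prod_(i < k.+1) f i (th i w)) =
  EB a b h * \prod_(i < k.+1) \int[mu]_x f i x.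
Proof.
move=> mf f01 mh h01.
suff : forall m (g : nat -> Borel X -> R), (forall j, measurable_fun setT (g j)) ->
    (forall j x, 0 <= g j x <= 1) ->
    (forall j, (m <= j)%N -> exists2 B, measurable B & g j = \1_B) ->
    \int[P]_w (h (u w) * \prod_(i < k.+1) g i (th i w)) =
    EB a b h * \prod_(i < k.+1) \int[mu]_x g i x.
  move=> /(_ k.+1 (fun j => if (j <= k)%N then f j else \1_setT)).
  have E (F : nat -> (Borel X -> R) -> R) :
      \prod_(i < k.+1) F i (if (i <= k)%N then f i else \1_setT) = \prod_(i < k.+1) F i (f i).
    by apply: eq_bigr => i _; rewrite -ltnS ltn_ord.
  rewrite (E (fun i g => \int[mu]_x g x)).
  under eq_Rintegral do rewrite (E (fun i g => g (th i _))).
  apply.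
  - by move=> j; case: ifP => // _; exact: measurable_indic.
  - by move=> j x; case: ifP.
  - by move=> j; rewrite ltnNge => /negbTE ->; exists setT.
elim=> [|m IH] g mg g01 gB.
  have H0 j : exists B : set (Borel X), measurable B /\ g j = \1_B.
    by have [//|B ? ?] := gB j; exists B.
  have [B HB] := choice H0.
  under eq_bigr do rewrite (HB _).2.
  under eq_Rintegral do under eq_bigr do rewrite (HB _).2.
  by apply: indep_base => // i; have [] := HB i.
have upd (B : set (Borel X)) : measurable B ->
    \int[P]_w (h (u w) * \prod_(i < k.+1) (if i == m :> nat then \1_B else g i) (th i w)) =
    EB a b h * \prod_(i < k.+1) \int[mu]_x (if i == m :> nat then \1_B else g i) x.
  move=> mB; apply: (IH (fun i => if i == m then \1_B else g i)).
  - by move=> j; case: ifP => // _; exact: measurable_indic.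
  - by move=> j x; case: ifP.
  - move=> j; rewrite leq_eqVlt eq_sym; case: eqP => [_ _|_ /= mj]; first by exists B.
    exact: gB.
(* Beyond the range of the product, coordinate m does not occur, so any measurable set, here [setT],
   may replace it. *)
have [mk|km] := ltnP m k.+1; last first.
  have E (B : set (Borel X)) (F : nat -> (Borel X -> R) -> R) :
      \prod_(i < k.+1) F i (if i == m :> nat then \1_B else g i) = \prod_(i < k.+1) F i (g i).
    by apply: eq_bigr => i _; rewrite ltn_eqF// (leq_trans (ltn_ord i)).
  have := upd setT measurableT; rewrite (E setT (fun i g => \int[mu]_x g x)).
  by under eq_Rintegral do rewrite (E setT (fun i g => g (th i _))).
pose im : 'I_k.+1 := Ordinal mk.
(* All factors but the one at m form the weight; [upd] says that its integral over an event of atom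
   m is the constant [c] below times the [mu]-probability. *)
pose Z1 w : R := h (u w) * \prod_(i < k.+1 | i != im) g i (th i w).
have gth01 i w : 0 <= g i (th i w) <= 1 by exact: g01.
have Z101 w : 0 <= Z1 w <= 1.
  have /andP[h0 h1] := h01 (u w).
  have p0 : 0 <= \prod_(i < k.+1 | i != im) g i (th i w).
    by apply: prodr_ge0 => i _; have /andP[] := gth01 i w.
  have p1 : \prod_(i < k.+1 | i != im) g i (th i w) <= 1 by apply: prodr_ile1 => i _.
  by rewrite /Z1 mulr_ge0//= mulr_ile1.
have mZ1 : measurable_fun setT Z1.
  apply: measurable_funM; first exact: measurableT_comp.
  rewrite (_ : (fun w => _) = (fun w => \prod_(i < k.+1) (if i != im then g i (th i w) else 1))); last first.
    by apply/funext => w; rewrite big_mkcond.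
  apply: measurable_prod => i _ /=; case: (i != im) => //; exact: (measurableT_comp (mg i) (mth i)).
pose c : R := EB a b h * \prod_(i < k.+1 | i != im) \int[mu]_x g i x.
have c0 : 0 <= c.
  rewrite mulr_ge0//; first by apply: EB_ge0 => // x _; case/andP: (h01 x).
  by apply: prodr_ge0 => i _; apply: Rintegral_ge0 => x _; case/andP: (g01 i x).
have H B : measurable B ->
    (\int[P]_(x in th m @^-1` B) (Z1 x)%:E = \int[mu]_(x in id @^-1` B) (cst c x)%:E)%E.
  move=> mB; rewrite preimage_id.
  apply/esym; apply: etrans; first exact: (integral_cst mu mB c%:E).
  apply/esym.
  have mtB : measurable (th m @^-1` B) by rewrite -[X in measurable X]setTI; exact: mth.
  have := upd B mB; rewrite [X in _ = _ * X](bigD1 im)//= eqxx.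
  rewrite [X in _ * (_ * X)](_ : _ = \prod_(i < k.+1 | i != im) \int[mu]_x g i x); last first.
    by apply: eq_bigr => i; rewrite -val_eqE/= => /negbTE ->.
  rewrite mulrCA -/c (_ : \int[mu]_x \1_B x = fine (mu B)); last first.
    by rewrite /Rintegral integral_indic// setIT.
  move=> E; rewrite [RHS](_ : _ = (fine (mu B) * c)%:E); last first.
    transitivity (c%:E * (fine (mu B))%:E)%E; last by rewrite -EFinM mulrC.
    by congr (_ * _)%E; rewrite fineK// fin_num_measure.
  rewrite -E -(@prob_EFin _ _ _ _ _ 1).
  - rewrite [LHS]integral_mkcond; apply: eq_integral => w _; rewrite patchE (bigD1 im)//= eqxx indicE.
    rewrite (_ : (w \in th m @^-1` B) = (th m w \in B)); last by apply/idP/idP; rewrite !inE.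
    case: (th m w \in B); last by rewrite mul0r mulr0.
    rewrite mul1r /Z1; congr (_ * _)%:E; apply: eq_bigr => i.
    by rewrite -val_eqE/= => /negbTE ->.
  - apply: measurable_funM; first exact: measurableT_comp.
    apply: measurable_prod => i _; apply: measurableT_comp => //.
    by case: ifP => // _; exact: measurable_indic.
  - move=> w; rewrite normrM mulr_ile1 ?normr_ge0 ?norm01//.
    by apply: prod01 => i; case: ifP.
have iZ1 : P.-integrable setT (EFin \o Z1).
  by apply: (@prob_integrable _ _ _ _ _ 1) => // w; exact: norm01.
have ic : mu.-integrable setT (EFin \o cst c).
  by apply: (@prob_integrable _ _ _ _ _ c) => // w; rewrite ger0_norm.
have := @integral_ext_bdd _ _ _ _ _ P _ _ mu (th m) Z1 id (cst c) (g m) 1 (mth m) iZ1 _ _ ic _ H (mg m) _.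
move=> HE; rewrite [in RHS](bigD1 im)//= mulrCA -/c mulrC.
have -> : \int[P]_w (h (u w) * \prod_(i < k.+1) g i (th i w)) = \int[P]_w (Z1 w * g m (th m w)).
  by apply: eq_Rintegral => w _; rewrite (bigD1 im)//= /Z1; ring.
rewrite HE//.
- rewrite RintegralZl//; apply: (@prob_integrable _ _ _ _ _ 1) => // x; exact: norm01.
- by move=> w; case/andP: (Z101 w).
- by move=> x; exact: norm01.
Qed.

End Independence.

Lemma prod_cvg {R : realType} (k : nat) (a : nat -> nat -> R) (l : nat -> R) :
  (forall i, (fun n => a n i) @ \oo --> l i) ->
  (fun n => \prod_(i < k) a n i) @ \oo --> \prod_(i < k) l i.
Proof.
move=> al'; elim: k => [|k IH].
  by rewrite big_ord0; under eq_fun do rewrite big_ord0; exact: cvg_cst.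
rewrite big_ord_recr/=; under eq_fun do rewrite big_ord_recr/=.
exact: cvgM.
Qed.

Lemma measurable_continuous_Borel {R : realType} {X : completePseudoMetricType R} (f : X -> R) : continuous f ->
  measurable_fun (setT : set (Borel X)) (f : Borel X -> R).
Proof.
move=> cf; apply: (measurability _ (RGenOpens.measurableE R)) => _ [_ [a [b ->] <-]].
rewrite setTI; apply: sub_sigma_algebra.
by move/continuousP: cf; apply; exact: interval_open.
Qed.

(** * Polynomial approximation on [0, 1] *)

Section Bernstein.
Context {R : realType}.
Implicit Types (g : R -> R).

Lemma unif_cont01 g (e : R) : continuous g -> 0 < e ->
  exists2 dl : R, 0 < dl & forall x y : R, 0 <= x <= 1 -> `|x - y| <= dl -> `|g y - g x| <= e.
Proof.
move=> cg e0; pose P m x := forall y : R, `|x - y| <= harmonic m -> `|g y - g x| <= e.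
have [m Hm] : exists m0, forall m, (m0 <= m)%N -> forall u, 0 <= u <= 1 -> P m u.
  apply: unif01 => m u u0 km u01 u001 uu0; apply: contrapT => nP.
  have H k : exists y : R, `|u k - y| <= harmonic k /\ e < `|g y - g (u k)|.
    apply: contrapT => nE; apply: nP; exists k => y Hy.
    rewrite leNgt; apply/negP => eG; apply: nE; exists y; split => //.
    by apply: le_trans Hy _; rewrite /harmonic/= lef_pV2 ?posrE ?ltr0n// ler_nat ltnS.
  have [y Hy] := choice H.
  have c1 : (fun k => g (u k)) @ \oo --> g u0 by apply: (@continuous_cvg _ _ _ _ _ _ g) => //; exact: cg.
  have c2 : (fun k => g (y k)) @ \oo --> g u0.
    apply: (@continuous_cvg _ _ _ _ _ _ g); first exact: cg.
    apply/cvgrPdist_lt => dd d0; have hd : 0 < dd / 2 by lra.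
    have /cvgrPdist_lt /(_ _ hd) h1 := @cvg_harmonic R.
    have /cvgrPdist_lt /(_ _ hd) h2 := uu0.
    apply: filterS2 h1 h2 => k; rewrite sub0r normrN ger0_norm ?harmonic_ge0// => h1 h2.
    have [h3 _] := Hy k; have := ler_normD (u0 - u k) (u k - y k); rewrite subrKA; lra.
  have [k hk] := cvg_same_close c2 c1 e0.
  by have [_] := Hy k; rewrite ltNge (ltW hk).
by exists (harmonic m); [exact: harmonic_gt0|move=> x y x01 xy; apply: (Hm m)].
Qed.

(** Uniform continuity handles close points; at distance above dl the quadratic term alone exceeds 2
    M. A quadratic majorant is what a binomial variance can absorb. *)
Lemma quad_modulus01 g (M e : R) : continuous g -> (forall x, `|g x| <= M) -> 0 < e ->
  exists2 C : R, 0 <= C & forall x y : R, 0 <= x <= 1 -> `|g y - g x| <= e + C * (y - x) ^+ 2.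
Proof.
move=> cg gM e0; have [dl dl0 Hdl] := unif_cont01 cg e0.
have M0 : 0 <= M by exact: le_trans (gM 0).
exists (2 * M / dl ^+ 2); first by rewrite divr_ge0 ?mulr_ge0 ?exprn_ge0 ?(ltW dl0).
move=> x y x01; have [xy|xy] := leP `|x - y| dl.
  by rewrite (le_trans (Hdl x y x01 xy))// lerDl mulr_ge0 ?sqr_ge0// divr_ge0 ?mulr_ge0 ?exprn_ge0 ?(ltW dl0).
have : `|g y - g x| <= 2 * M.
  by rewrite (le_trans (ler_normB _ _))// mulr_natl mulr2n lerD.
move/le_trans; apply; apply: (@le_trans _ _ (2 * M / dl ^+ 2 * (y - x) ^+ 2)); last by rewrite lerDr ltW.
rewrite mulrAC ler_pdivlMr ?exprn_gt0// ler_wpM2l ?mulr_ge0//.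
by rewrite -[leRHS](@real_normK R) ?num_real// distrC lerXn2r ?nnegrE ?(ltW dl0)// ltW.
Qed.

(** The Bernstein polynomial at x is the expectation of g(Z/N) with Z binomial of parameters N and
    x; averaging [quad_modulus01] gives the error e/2 + C x (1 - x) / N. *)
Lemma bernstein_approx g (M e : R) : continuous g -> (forall x, `|g x| <= M) -> 0 < e ->
  exists p : {poly R}, forall x, 0 <= x <= 1 -> `|g x - p.[x]| <= e.
Proof.
move=> cg gM e0; have e2 : 0 < e / 2 by lra.
have [C C0 HC] := quad_modulus01 cg gM e2.
(* Large enough for C / N <= e / 2. *)
pose N := (Num.truncn (C / (e / 2))).+1.
have N0 : 0 < N%:R :> R by rewrite ltr0n.
have CN : C / N%:R <= e / 2.
  rewrite ler_pdivrMr// mulrC -ler_pdivrMr//.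
  have : C / (e / 2) < (Num.truncn (C / (e / 2))).+1%:R by rewrite truncnS_gt// divr_ge0// ltW.
  by move/ltW.
pose p : {poly R} := \sum_(z < N.+1) ('C(N, z)%:R * g (z%:R / N%:R)) *: ('X^z * (1 - 'X) ^+ (N - z)).
exists p => x x01.
have -> : p.[x] = binomE N x (fun z => g (z%:R / N%:R)).
  rewrite horner_sum; apply: eq_bigr => z _; rewrite hornerZ hornerM !horner_exp !hornerE /=.
  by move: (g _) => gz; ring.
have -> : g x - binomE N x (fun z => g (z%:R / N%:R)) =
    - binomE N x (fun z => g (z%:R / N%:R) + (- g x) * 1) by rewrite binomED binomEZ binomE1; ring.
rewrite normrN; have -> : e = e / 2 + e / 2 by lra.
have bd : binomE N x (fun z => e / 2 * 1 + C / N%:R ^+ 2 * (z%:R + (- (N%:R * x))) ^+ 2) <= e / 2 + e / 2.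
  rewrite binomED !binomEZ binomE1 binomE_sqr mulr1 lerD2l (le_trans _ CN)//.
  rewrite subrr expr0n/= add0r -!mulrA ler_wpM2l// -[leRHS]mulr1 expr2 invfM -!mulrA ler_wpM2l ?invr_ge0 ?ler0n//.
  by rewrite mulKf ?gt_eqF//; move: x01 => /andP[x0 x1]; nra.
have pw z : `|g (z%:R / N%:R) + (- g x) * 1| <= e / 2 * 1 + C / N%:R ^+ 2 * (z%:R + (- (N%:R * x))) ^+ 2.
  rewrite mulr1 mulr1; apply: le_trans (HC x (z%:R / N%:R) x01) _; rewrite lerD2l.
  by rewrite le_eqVlt; apply/orP; left; apply/eqP; field; rewrite gt_eqF.
rewrite ler_norml; apply/andP; split.
  rewrite lerNl; apply: le_trans bd.
  rewrite -[leLHS]mulN1r -binomEZ; apply: le_binomE => // z _.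
  by rewrite mulN1r (le_trans _ (pw z))// -normrN ler_norm.
apply: le_trans bd; apply: le_binomE => // z _.
by rewrite (le_trans _ (pw z))// ler_norm.
Qed.

End Bernstein.

(** * Convergence in law from convergence of moments *)

Section Moments.
Context {R : realType}.

Lemma norm01_le1 (x : R) : 0 <= x <= 1 -> `|x| <= 1.
Proof. by move=> /andP[x0 x1]; rewrite ger0_norm. Qed.

Lemma expr01 (x : R) i : 0 <= x <= 1 -> 0 <= x ^+ i <= 1.
Proof. by move=> /andP[x0 x1]; rewrite exprn_ge0//= exprn_ile1. Qed.

Lemma prob_Rintegral_sum d (T : measurableType d) (P : probability T R)
  (I : eqType) (r : seq I) (F : I -> T -> R) :
  (forall i, measurable_fun setT (F i)) -> (forall i, exists M : R, forall w, `|F i w| <= M) ->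
  \int[P]_w (\sum_(i <- r) F i w) = \sum_(i <- r) \int[P]_w F i w.
Proof.
move=> mF bF; elim: r => [|i r IH].
  by rewrite big_nil; under eq_Rintegral do rewrite big_nil; exact: prob_Rintegral_cst.
rewrite big_cons -IH -RintegralD//.
- by apply: eq_Rintegral => w _; rewrite big_cons.
- by have [M HM] := bF i; exact: prob_integrable (mF i) HM.
have [M HM] : exists M : R, forall w, `|\sum_(i <- r) F i w| <= M.
  elim: r {IH} => [|i' r [M HM]]; first by exists 0 => w; rewrite big_nil normr0.
  have [M' HM'] := bF i'; exists (M' + M) => w; rewrite big_cons.
  by rewrite (le_trans (ler_normD _ _))// lerD.
by apply: prob_integrable HM; exact: measurable_sum.
Qed.

Unset Implicit Arguments.
Variables (dn : nat -> measure_display) (Om : forall n, measurableType (dn n))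
  (Pr : forall n, probability (Om n) R) (Y : forall n, Om n -> R)
  (d : measure_display) (Omega : measurableType d) (Q : probability Omega R) (Z : Omega -> R).
Hypothesis mY : forall n, measurable_fun setT (Y n).
Hypothesis mZ : measurable_fun setT Z.
Hypothesis Y01 : forall n w, 0 <= Y n w <= 1.
Hypothesis Z01 : forall w, 0 <= Z w <= 1.
Hypothesis mom : forall i, (fun n => \int[Pr n]_w (Y n w) ^+ i) @ \oo --> \int[Q]_w (Z w) ^+ i.
Set Implicit Arguments.

Lemma poly_bounded01 (p : {poly R}) : exists M : R, forall x, 0 <= x <= 1 -> `|p.[x]| <= M.
Proof.
elim/poly_ind: p => [|p c [M HM]]; first by exists 0 => x _; rewrite horner0 normr0.
exists (M + `|c|) => x x01; rewrite !hornerE (le_trans (ler_normD _ _))// lerD2r normrM.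
by rewrite -[leRHS]mulr1 ler_pM// ?HM// norm01_le1.
Qed.

Lemma measurable_poly d' (T' : measurableType d') (U : T' -> R) (p : {poly R}) :
  measurable_fun setT U -> measurable_fun setT (fun w => p.[U w]).
Proof.
move=> mU; elim/poly_ind: p => [|p c IH].
  by under eq_fun do rewrite horner0; exact: measurable_cst.
under eq_fun do rewrite !hornerE.
by apply: measurable_funD => //; exact: measurable_funM.
Qed.

(** The extra power [i] makes the induction on the polynomial work: p X + c trades one factor X for
    i + 1. *)
Lemma poly_moments_cvg (p : {poly R}) i :
  (fun n => \int[Pr n]_w ((Y n w) ^+ i * p.[Y n w])) @ \oo --> \int[Q]_w ((Z w) ^+ i * p.[Z w]).
Proof.
elim/poly_ind: p i => [|p c IH] i.
  have E d' (T' : measurableType d') (P : probability T' R) (U : T' -> R) :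
      \int[P]_w (U w ^+ i * (0 : {poly R}).[U w]) = 0.
    by under eq_Rintegral do rewrite horner0 mulr0; exact: prob_Rintegral_cst.
  by rewrite E; under eq_fun do rewrite E; exact: cvg_cst.
have E d' (T' : measurableType d') (P : probability T' R) (U : T' -> R) :
    measurable_fun setT U -> (forall w, 0 <= U w <= 1) ->
    \int[P]_w (U w ^+ i * (p * 'X + c%:P).[U w]) =
    \int[P]_w (U w ^+ i.+1 * p.[U w]) + c * \int[P]_w (U w ^+ i).
  move=> mU U01; have [M HM] := poly_bounded01 p.
  have mUi j : measurable_fun setT (fun w => U w ^+ j) by exact: measurable_funX.
  have bUi j w : `|U w ^+ j| <= 1 by apply: norm01_le1; exact: expr01.
  rewrite -RintegralZl//; last exact: prob_integrable (mUi i) (bUi i).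
  rewrite -RintegralD//.
  - apply: eq_Rintegral => w _; rewrite !hornerE exprS.
    by move: (p.[U w]) (U w) (U w ^+ i) => x y z; ring.
  - apply: (@prob_integrable _ _ _ _ _ M).
      by apply: measurable_funM => //; exact: measurable_poly.
    by move=> w; rewrite normrM -[leRHS]mul1r ler_pM// HM.
  - apply: (@prob_integrable _ _ _ _ _ `|c|); first exact: measurable_funM.
    by move=> w; rewrite normrM -[leRHS]mulr1 ler_pM.
rewrite E//; under eq_fun do rewrite E//.
by apply: cvgD; [exact: IH|apply: cvgMr; exact: mom].
Qed.

(* Bernstein polynomials reduce convergence in law on [0, 1] to convergence of moments. *)
Lemma moments_cvg (g : R -> R) (M : R) : continuous g -> (forall x, `|g x| <= M) ->
  (fun n => \int[Pr n]_w g (Y n w)) @ \oo --> \int[Q]_w g (Z w).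
Proof.
move=> cg gM; apply/cvgrPdist_lt => e e0; have e4 : 0 < e / 4 by lra.
have [p Hp] := bernstein_approx cg gM e4.
have [Mp HMp] := poly_bounded01 p.
have := @poly_moments_cvg p 0.
under eq_fun do under eq_Rintegral do rewrite expr0 mul1r.
under [X in _ --> X]eq_Rintegral do rewrite expr0 mul1r.
move=> /cvgrPdist_lt /(_ _ e4) hN.
have mg d' (T' : measurableType d') (U : T' -> R) : measurable_fun setT U ->
    measurable_fun setT (fun w => g (U w)).
  by move=> mU; apply: measurableT_comp mU; exact: continuous_measurable_fun.
have M0 : 0 <= M by exact: le_trans (gM 0).
have Mp0 : 0 <= Mp by apply: le_trans (HMp 0 _); rewrite ?lexx ?ler01.
have close d' (T' : measurableType d') (P : probability T' R) (U : T' -> R) :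
    measurable_fun setT U -> (forall w, 0 <= U w <= 1) ->
    `|\int[P]_w g (U w) - \int[P]_w p.[U w]| <= e / 4.
  move=> mU U01.
  have := @prob_dist_le _ _ _ P (fun w => g (U w)) (fun w => p.[U w]) (M + Mp) (e / 4) set0
     (mg _ _ _ mU) (measurable_poly p mU).
  rewrite measure0 mulr0 addr0; apply => //.
  - by move=> w; rewrite (le_trans (gM _))// lerDl.
  - by move=> w; rewrite (le_trans (HMp _ (U01 w)))// lerDr.
  - exact: ltW.
  - by move=> w _; exact: Hp.
apply: filterS hN => n h1.
have h2 := close _ _ (Pr n) (Y n) (mY n) (Y01 n).
have h3 := close _ _ Q Z mZ Z01.
set gZ := \int[Q]_w g (Z w) in h3 *; set gY := \int[Pr n]_w g (Y n w) in h2 *.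
set pZ := \int[Q]_w p.[Z w] in h1 h3; set pY := \int[Pr n]_w p.[Y n w] in h1 h2.
move: gZ gY pZ pY h1 h2 h3 => gZ gY pZ pY h1 h2 h3.
have := ler_normD (gZ - pZ) (pZ - pY); have := ler_normD (gZ - pY) (pY - gY).
rewrite !subrKA [`|pY - gY|]distrC; lra.
Qed.

End Moments.

(** * Deterministic stick-breaking: remaining mass and truncation *)

Section StickBreakingSums.
Context {R : realType}.
Implicit Types (y a : nat -> R).

Definition sbs y j : R := y j * \prod_(i < j) (1 - y i).

Lemma sbs_prod01 y k : (forall j, 0 <= y j <= 1) -> 0 <= \prod_(i < k) (1 - y i) <= 1.
Proof.
move=> y01; have h i : 0 <= 1 - y i <= 1 by have := y01 i; lra.
rewrite prodr_ge0/=; last by move=> i _; case/andP: (h i).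
by apply: prodr_ile1 => i _; exact: h.
Qed.

Lemma sbs01 y j : (forall j, 0 <= y j <= 1) -> 0 <= sbs y j <= 1.
Proof.
move=> y01; have /andP[p0 p1] := sbs_prod01 j y01; have /andP[y0 y1] := y01 j.
by rewrite /sbs mulr_ge0//= mulr_ile1.
Qed.

Lemma sum_sbs y n : \sum_(j < n) sbs y j = 1 - \prod_(i < n) (1 - y i).
Proof.
elim: n => [|n IH]; first by rewrite !big_ord0 subrr.
by rewrite !big_ord_recr/= IH /sbs; ring.
Qed.

Lemma seqcont_sbs j : @seqcont R (fun y => sbs y j).
Proof.
move=> y y0 yy0; apply: cvgM => //.
apply: (@prod_cvg _ _ (fun n i => 1 - y n i) (fun i => 1 - y0 i)) => i.
by apply: cvgB => //; exact: cvg_cst.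
Qed.

Lemma seqcont_prod1B k : @seqcont R (fun y => \prod_(i < k) (1 - y i)).
Proof.
move=> y y0 yy0; apply: (@prod_cvg _ _ (fun n i => 1 - y n i) (fun i => 1 - y0 i)) => i.
by apply: cvgB => //; exact: cvg_cst.
Qed.

Lemma sbs_series_cvg y a : (forall j, 0 <= y j <= 1) -> (forall j, 0 <= a j <= 1) ->
  cvgn (series (fun j => sbs y j * a j)).
Proof.
move=> y01 a01; apply: nondecreasing_is_cvgn.
  apply/nondecreasing_seqP => n; rewrite /series/= big_nat_recr//= lerDl.
  by have /andP[s0 s1] := sbs01 n y01; have /andP[? ?] := a01 n; rewrite mulr_ge0.
exists 1 => _ [n _ <-]; rewrite /series/= big_mkord.
apply: (@le_trans _ _ (\sum_(j < n) sbs y j)).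
  apply: ler_sum => j _; have /andP[s0 s1] := sbs01 j y01; have /andP[? ?] := a01 j.
  by rewrite -[leRHS]mulr1 ler_wpM2l.
by rewrite sum_sbs; have /andP[? ?] := sbs_prod01 n y01; lra.
Qed.

Lemma sbs_series1_cvg y : (forall j, 0 <= y j <= 1) -> cvgn (series (sbs y)).
Proof.
move=> y01; have := @sbs_series_cvg y (fun=> 1) y01.
under eq_fun do rewrite mulr1.
by apply => _; rewrite lexx ler01.
Qed.

(** The value of [sb_integral] at one sample point, with [a] for the values at the atoms and [c] for
    the mean under the base measure. *)
Definition sb_mean y a (c : R) : R :=
  limn (series (fun j => sbs y j * a j)) + (1 - limn (series (sbs y))) * c.

(** The mass left after k breaks is the product on the right; it is shared between the later atoms
    and the base measure, where all values lie in [0, 1]. *)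
Lemma sb_mean_trunc y a c k : (forall j, 0 <= y j <= 1) -> (forall j, 0 <= a j <= 1) ->
  0 <= c <= 1 ->
  0 <= sb_mean y a c - \sum_(j < k) sbs y j * a j <= \prod_(i < k) (1 - y i).
Proof.
move=> y01 a01 /andP[c0 c1].
have cA := sbs_series_cvg y01 a01; have cW := sbs_series1_cvg y01.
rewrite /sb_mean; set A := limn _ in cA *; set W := limn (series (sbs y)) in cW *.
set S := \sum_(j < k) _.
have WE n : series (sbs y) n = 1 - \prod_(i < n) (1 - y i) by rewrite /series/= big_mkord sum_sbs.
have SE : series (fun j => sbs y j * a j) k = S by rewrite /series/= big_mkord.
have term j : 0 <= sbs y j * a j <= sbs y j.
  have /andP[s0 s1] := sbs01 j y01; have /andP[? ?] := a01 j.
  by rewrite mulr_ge0//= -[leRHS]mulr1 ler_wpM2l.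
have nd n : (k <= n)%N -> 0 <= series (fun j => sbs y j * a j) n - S <=
    series (sbs y) n - series (sbs y) k.
  move=> kn; rewrite -SE; elim: n kn => [|n IH].
    by rewrite leqn0 => /eqP ->; rewrite !subrr lexx.
  rewrite leq_eqVlt => /predU1P[->|/IH]; first by rewrite !subrr lexx.
  rewrite /series/= !(big_nat_recr n)//=; have := term n.
  move: (sbs y n * a n) (sbs y n) => p q /andP[p0 pq] /andP[h1 h2].
  by apply/andP; split; lra.
have W1 : W <= 1.
  apply: limr_le => //; apply: nearW => n; rewrite WE.
  by have /andP[? ?] := sbs_prod01 n y01; lra.
have lo : 0 <= A - S.
  rewrite subr_ge0; apply: limr_ge => //; exists k => // n /= kn.
  by have /andP[] := nd n kn; rewrite subr_ge0.
have hi : A - S <= W - series (sbs y) k.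
  have h1 : (fun n => series (fun j => sbs y j * a j) n - S) @ \oo --> A - S.
    by apply: cvgB => //; exact: cvg_cst.
  have h2 : (fun n => series (sbs y) n - series (sbs y) k) @ \oo --> W - series (sbs y) k.
    by apply: cvgB => //; exact: cvg_cst.
  apply: (ler_cvg_to h1 h2); exists k => // n /= kn.
  by have /andP[] := nd n kn.
have : 0 <= (1 - W) * c <= 1 - W by apply/andP; split; nra.
move: hi; rewrite WE; move: ((1 - W) * c) (\prod_(i < k) _) lo => z p; lra.
Qed.

Lemma sb_mean01 y a c : (forall j, 0 <= y j <= 1) -> (forall j, 0 <= a j <= 1) ->
  0 <= c <= 1 -> 0 <= sb_mean y a c <= 1.
Proof. by move=> y01 a01 c01; have := sb_mean_trunc 0 y01 a01 c01; rewrite !big_ord0 subr0. Qed.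

(* Divergence of the lengths forces the sticks to exhaust the unit mass. *)
Lemma prod1B_cvg0 y : (forall j, 0 <= y j <= 1) -> series y @ \oo --> +oo ->
  (fun k => \prod_(i < k) (1 - y i)) @ \oo --> (0 : R).
Proof.
(* An elementary replacement for the bound by exp(- sum y): for s >= 0 one has (1 - y)(1 + s + y) <=
   1 + s, so this quantity never increases. *)
move=> y01 sy; have key k : (\prod_(i < k) (1 - y i)) * (1 + series y k) <= 1.
  elim: k => [|k IH]; first by rewrite big_ord0 /series/= big_nil addr0 mulr1.
  rewrite big_ord_recr/= /series/= big_nat_recr//=; apply: le_trans IH.
  have s0 : 0 <= \sum_(0 <= i < k) y i by apply: sumr_ge0 => i _; case/andP: (y01 i).
  rewrite -mulrA ler_wpM2l//; first by case/andP: (sbs_prod01 k y01).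
  rewrite /series/=; have /andP[? ?] := y01 k; nra.
apply/cvgrPdist_lt => e e0; have near1 : \forall k \near \oo, e^-1 < series y k by move/cvgryPgt : sy; apply.
apply: filterS near1 => k hk; have /andP[p0 p1] := sbs_prod01 k y01.
rewrite sub0r normrN ger0_norm// ltNge; apply/negP => ep.
have s0 : 0 < e^-1 by rewrite invr_gt0.
have := key k; rewrite leNgt => /negP; apply.
apply: (@lt_le_trans _ _ (e * (1 + series y k))).
  by rewrite mulrDr mulr1 -[ltLHS]add0r ltrD// mulrC -ltr_pdivrMr// mul1r.
by rewrite ler_wpM2r//; lra.
Qed.

Lemma sum_cvg (I : eqType) (r : seq I) (a : nat -> I -> R) (l : I -> R) :
  (forall i, (fun n => a n i) @ \oo --> l i) ->
  (fun n => \sum_(i <- r) a n i) @ \oo --> \sum_(i <- r) l i.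
Proof.
move=> al; elim: r => [|i r IH].
  by rewrite big_nil; under eq_fun do rewrite big_nil; exact: cvg_cst.
by rewrite big_cons; under eq_fun do rewrite big_cons; exact: cvgD.
Qed.

Lemma exprn_lip01 (x y : R) p : 0 <= x <= 1 -> 0 <= y <= 1 ->
  `|x ^+ p - y ^+ p| <= p%:R * `|x - y|.
Proof.
move=> x01 y01; elim: p => [|p IH]; first by rewrite !expr0 subrr normr0 mul0r.
rewrite (_ : x ^+ p.+1 - y ^+ p.+1 = x * (x ^+ p - y ^+ p) + (x - y) * y ^+ p); last by rewrite !exprS; ring.
have -> : p.+1%:R * `|x - y| = p%:R * `|x - y| + `|x - y| by rewrite -natr1 mulrDl mul1r.
rewrite (le_trans (ler_normD _ _))// lerD//.
  rewrite normrM (le_trans _ IH)// -[leRHS]mul1r ler_wpM2r// norm01_le1//.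
by rewrite normrM -[leRHS]mulr1 ler_wpM2l// norm01_le1// expr01.
Qed.

(** [phi] picks one summand in each of the p factors. Grouping by chosen atom gives each atom a
    single exponent, the size of its fibre, as independence across atoms requires. *)
Lemma pow_sum_expand (y a : nat -> R) k p :
  (\sum_(j < k) sbs y j * a j) ^+ p =
  \sum_(phi : {ffun 'I_p -> 'I_k}) ((\prod_i sbs y (phi i)) *
     \prod_(j < k) a j ^+ #|[pred i | phi i == j :> nat]|).
Proof.
transitivity (\prod_(i < p) \sum_(j < k) sbs y j * a j); first by rewrite prodr_const card_ord.
rewrite bigA_distr_bigA; apply: eq_bigr => phi _; rewrite big_split/=; congr (_ * _).
rewrite (partition_big (fun i => phi i) xpredT)//=; apply: eq_bigr => j _.
by rewrite -prodr_const; apply: eq_big => [i|i /eqP -> //]; rewrite inE -val_eqE.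
Qed.

End StickBreakingSums.

Lemma quantile_of_cdf {R : realType} (a b u : R) : 0 < a -> 0 < b -> 0 <= u <= 1 ->
  betaQ a b (betaCDF a b u) = u.
Proof.
move=> a0 b0 u01; have F01 : 0 <= betaCDF a b u <= 1 by rewrite betaCDF_ge0 ?betaCDF_le1.
have qu : betaQ a b (betaCDF a b u) <= u by exact: betaQ_le.
have /andP[q0 q1] : 0 <= betaQ a b (betaCDF a b u) <= 1 by apply: betaQ_itv => //; case/andP: F01.
apply/eqP; rewrite eq_le qu/= leNgt; apply/negP => lt.
have /andP[_ u1] := u01; have := betaCDF_lt a0 b0 q0 lt u1.
by rewrite betaQK// ltxx.
Qed.

(** Consecutive quantile and distribution functions cancel, which identifies the step recursion with
    the maps in the divergence hypothesis. *)
Lemma tmapE {R : realType} (alpha beta : nat -> R) j u :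
  (forall j, 0 < alpha j /\ 0 < beta j) -> 0 <= u <= 1 ->
  tmap alpha beta j u = betaQ (alpha j) (beta j) (betaCDF (alpha 0%N) (beta 0%N) u).
Proof.
move=> pos u01; have [a0 b0] := pos 0%N.
elim: j => [|j IH] /=; first by rewrite quantile_of_cdf.
have [aj bj] := pos j; have p01 : 0 <= betaCDF (alpha 0%N) (beta 0%N) u <= 1.
  by rewrite (betaCDF_ge0 u a0 b0) (betaCDF_le1 u a0 b0).
by rewrite IH; exact: (congr1 (betaQ (alpha j.+1) (beta j.+1)) (betaQK aj bj p01)).
Qed.

(** * Expectation bounds and measurability of stick-breaking means *)

Section ProbabilityBounds.
Context {R : realType} {d : measure_display} {T : measurableType d} (P : probability T R).

Lemma prob_dist_le_scaled (Y1 Y2 Z : T -> R) (M C : R) :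
  measurable_fun setT Y1 -> measurable_fun setT Y2 -> measurable_fun setT Z ->
  (forall w, `|Y1 w| <= M) -> (forall w, `|Y2 w| <= M) -> (forall w, `|Z w| <= M) ->
  (forall w, `|Y1 w - Y2 w| <= C * Z w) ->
  `|\int[P]_w Y1 w - \int[P]_w Y2 w| <= C * \int[P]_w Z w.
Proof.
move=> m1 m2 mZ b1 b2 bZ h.
have i1 := prob_integrable P m1 b1; have i2 := prob_integrable P m2 b2.
have iZ := prob_integrable P mZ bZ.
have bD w : `|Y1 w - Y2 w| <= M + M by rewrite (le_trans (ler_normB _ _))// lerD.
have mD : measurable_fun setT (fun w => Y1 w - Y2 w) by exact: measurable_funB.
have bCZ w : `|C * Z w| <= `|C| * M by rewrite normrM ler_wpM2l.
rewrite -RintegralB// -RintegralZl//; apply: (le_trans (le_normr_Rintegral _ (prob_integrable P mD bD))) => //.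
apply: le_Rintegral => //.
- have mN : measurable_fun setT (fun w => `|Y1 w - Y2 w|).
    exact: (measurableT_comp (@normr_measurable R setT) mD).
  by apply: (prob_integrable P mN (M := M + M)) => w; rewrite normr_id.
- have mCZ : measurable_fun setT (fun w => C * Z w) by exact: measurable_funM.
  exact: (prob_integrable P mCZ bCZ).
Qed.

Lemma measurable_sbs (y : nat -> T -> R) j : (forall i, measurable_fun setT (y i)) ->
  measurable_fun setT (fun w => sbs (fun i => y i w) j).
Proof.
move=> my; apply: measurable_funM => //; apply: measurable_prod => i _.
exact: measurable_funB.
Qed.

Lemma measurable_sb_mean (y a : nat -> T -> R) c :
  (forall i, measurable_fun setT (y i)) -> (forall i, measurable_fun setT (a i)) ->
  (forall i w, 0 <= y i w <= 1) -> (forall i w, 0 <= a i w <= 1) ->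
  measurable_fun setT (fun w => sb_mean (fun i => y i w) (fun i => a i w) c).
Proof.
move=> my ma y01 a01; apply: measurable_funD.
  apply: (@measurable_fun_cvg _ _ _ _ (fun n w => series (fun j => sbs (fun i => y i w) j * a j w) n)).
    move=> n; rewrite /series/=; apply: measurable_sum => j.
    by apply: measurable_funM => //; exact: measurable_sbs.
  by move=> w _; exact: (sbs_series_cvg (fun i => y01 i w) (fun i => a01 i w)).
apply: measurable_funM => //; apply: measurable_funB => //.
apply: (@measurable_fun_cvg _ _ _ _ (fun n w => series (sbs (fun i => y i w)) n)).
  by move=> n; rewrite /series/=; apply: measurable_sum => j; exact: measurable_sbs.
by move=> w _; exact: (sbs_series1_cvg (fun i => y01 i w)).
Qed.

End ProbabilityBounds.

(** * Changing an integrand on a null set *)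

Section NullSets.
Import HBNNSimple.

(** The argument acts on the simple functions below the integrand, cutting each to zero on [E]. It
    thus covers functionals of the unclipped lengths, whose measurability is not established. *)
Lemma integral_off_null {R : realType} d (T : measurableType d)
  (mu : {measure set T -> \bar R}) (E : set T) (f g : T -> \bar R) :
  measurable E -> mu E = 0%E -> (forall w, ~ E w -> f w = g w) ->
  (\int[mu]_w f w = \int[mu]_w g w)%E.
Proof.
move=> mE E0.
have le (f' g' : T -> \bar R) : (forall w, ~ E w -> f' w = g' w) ->
    (forall w, 0 <= f' w)%E -> (forall w, 0 <= g' w)%E ->
    (\int[mu]_w f' w <= \int[mu]_w g' w)%E.
  move=> fg f0 g0; rewrite !ge0_integralTE//.
  apply: ub_ereal_sup => _ [h /= hf <-].
  have mEc : measurable (~` E) by exact: measurableC.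
  have := @le_trans _ (\bar R) (sintegral mu (proj_nnsfun h mEc)); apply; last first.
    apply: ereal_sup_ubound; exists (proj_nnsfun h mEc) => //= w.
    rewrite mindicE; have [/set_mem nEw|_] := boolP (w \in ~` E); last by rewrite mulr0.
    by rewrite mulr1 -fg.
  have SE (k : {nnsfun T >-> R}) : (sintegral mu k = \int[mu]_x (k x)%:E)%E.
    by rewrite integral_nnsfun// patch_setT.
  rewrite !SE.
  rewrite (@ge0_ae_eq_integral _ _ _ mu setT (fun x => (h x)%:E) (fun x => (proj_nnsfun h mEc x)%:E))//.
  - by apply/measurable_EFinP; exact: measurable_funP.
  - by apply/measurable_EFinP; exact: measurable_funP.
  - by move=> w _; rewrite lee_fin; exact: fun_ge0.
  - by move=> w _; rewrite lee_fin; exact: fun_ge0.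
  exists E; split => // w /= nh; apply: contrapT => nE; apply: nh => _.
  by rewrite /= mindicE mem_set//= mulr1.
move=> fg; rewrite integralE [RHS]integralE; congr (_ - _)%E; apply/eqP; rewrite eq_le !le//;
  by move=> w nE; rewrite ?funepos.unlock ?funeneg.unlock fg.
Qed.

End NullSets.

Lemma ptws_seq_cvg {R : realType} (y : nat -> {ptws nat -> R}) (y0 : {ptws nat -> R}) :
  (forall j, (fun k => y k j) @ \oo --> y0 j) -> y @ \oo --> y0.
Proof.
move=> h; apply/cvg_sup => j A; rewrite /= (@nbhsE (initial_topology (fun f : {ptws nat -> R} => f j))) => -[B [[C oC <-] By0] BA].
have : \forall k \near \oo, C (y k j) by apply: (h j C); exact: open_nbhs_nbhs.
by apply: filterS => k Ck; apply: BA.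
Qed.

(** The weights and the base mass add up to one, so additive constants pass through. *)
Lemma sb_mean_affine {R : realType} (y a : nat -> R) (c r s : R) :
  (forall j, 0 <= y j <= 1) -> (forall j, 0 <= a j <= 1) ->
  sb_mean y (fun j => r * a j + s) (r * c + s) = r * sb_mean y a c + s.
Proof.
move=> y01 a01; have cA := sbs_series_cvg y01 a01; have cW := sbs_series1_cvg y01.
rewrite /sb_mean.
have -> : limn (series (fun j => sbs y j * (r * a j + s))) =
    r * limn (series (fun j => sbs y j * a j)) + s * limn (series (sbs y)).
  apply/cvg_lim => //.
  have -> : series (fun j => sbs y j * (r * a j + s)) =
      (fun n => r * series (fun j => sbs y j * a j) n + s * series (sbs y) n).
    apply/funext => n; rewrite /series/= !big_distrr/= -big_split/=.
    by apply: eq_bigr => j _; ring.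
  by apply: cvgD; [exact: (cvgM (cvg_cst r) cA)|exact: (cvgM (cvg_cst s) cW)].
by ring.
Qed.

(** [M + 1] rather than [M] keeps the denominator positive when the bound is 0. *)
Lemma affine_to01 {R : realType} (x M : R) : `|x| <= M -> 0 <= (x + (M + 1)) / (2 * (M + 1)) <= 1.
Proof.
move=> xM; have M0 : 0 <= M by exact: le_trans xM.
move: xM; rewrite ler_norml => /andP[x1 x2].
have c0 : 0 < 2 * (M + 1) by lra.
by rewrite divr_ge0 ?(ltW c0)//=; [rewrite ler_pdivrMr// mul1r; lra|lra].
Qed.

Lemma affine_to01K {R : realType} (x M : R) : 0 <= M ->
  2 * (M + 1) * ((x + (M + 1)) / (2 * (M + 1))) + - (M + 1) = x.
Proof. by move=> M0; field; lra. Qed.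

(** * Convergence of weights and processes for lengths in [0, 1] *)

Section ProcessConvergence.
Context {R : realType} {X : completePseudoMetricType R}.
Unset Implicit Arguments.
Variables (dn : nat -> measure_display) (Om : forall n, measurableType (dn n))
  (Pr : forall n, probability (Om n) R)
  (N : nat -> nat) (al be : nat -> nat -> R)
  (P0 : nat -> probability (Borel X) R)
  (v : forall n, nat -> Om n -> R) (th : forall n, nat -> Om n -> Borel X)
  (alpha beta : nat -> R) (P0lim : probability (Borel X) R).
Hypothesis HB : forall n, is_BMSB (Pr n) (N n) (al n) (be n) (P0 n) (v n) (th n).
Hypothesis HN : forall M : nat, \forall n \near \oo, (M <= N n)%N.
Hypothesis ala : forall j, (fun n => al n j) @ \oo --> alpha j.
Hypothesis beb : forall j, (fun n => be n j) @ \oo --> beta j.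
Hypothesis pos : forall j, 0 < alpha j /\ 0 < beta j.
Hypothesis v01 : forall n j w, 0 <= v n j w <= 1.
Hypothesis H2 : exists S : set R, measurable S /\ betaM (alpha 0) (beta 0) S = 0%E /\
     forall u, ~ S u ->
       series (fun j => betaQ (alpha j) (beta j) (betaCDF (alpha 0) (beta 0) u))
         @ \oo --> +oo.
Hypothesis weakP0 : weak_cvg P0 P0lim.
Variables (d : measure_display) (Omega : measurableType d) (Q : probability Omega R)
  (vl : nat -> Omega -> R) (thl : nat -> Omega -> Borel X).
Hypothesis HQ : is_CDSB Q alpha beta P0lim vl thl.
Hypothesis vl01 : forall w, 0 <= vl 0%N w <= 1.

Let posn n j : 0 < al n j /\ 0 < be n j. Proof. by case: (HB n). Qed.
Let mv n j : measurable_fun setT (v n j). Proof. by case: (HB n). Qed.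
Let mth n j : measurable_fun setT (th n j). Proof. by case: (HB n). Qed.
Let mthl j : measurable_fun setT (thl j). Proof. by case: HQ. Qed.
Let T := tmap alpha beta.
Set Implicit Arguments.

(** Brings the law of the first length and the atoms to the form it has in [is_CDSB], so that
    [indep_factor] serves both. *)
Lemma BMSB_indep n (k : nat) (A : set R) (B : nat -> set (Borel X)) :
  measurable A -> (forall i, measurable (B i)) ->
  Pr n [set w | A (v n 0%N w) /\ forall i, (i <= k)%N -> B i (th n i w)]
  = (betaM (al n 0%N) (be n 0%N) A * \prod_(i < k.+1) P0 n (B i))%E.
Proof.
move=> mA mB; pose AA i := if i == 0%N then A else setT.
have mAA i : measurable (AA i) by rewrite /AA; case: ifP.
have [_ _ _ _ H] := HB n.
rewrite (_ : [set w | _] = [set w | forall i, (i <= k)%N -> AA i (v n i w) /\ B i (th n i w)]); last first.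
  apply/seteqP; split => w /=.
    by move=> [Aw Bw] i ik; split; [rewrite /AA; case: eqP => // ->|exact: Bw].
  by move=> h; split; [have [] := h 0%N (leq0n k)|move=> i /h []].
apply: etrans; first exact: H; congr (_ * _)%E.
rewrite -(BMSB_lengths (HB n))//.
have -> : [set w | forall i, (i <= k)%N -> AA i (v n i w)] = [set w | forall i, (i <= 0)%N -> AA i (v n i w)].
  apply/seteqP; split => w /= h i; first by rewrite leqn0 => /eqP ->; exact: h.
  by move=> _; case: i => [|i]; [exact: h|rewrite /AA].
by rewrite (BMSB_lengths (HB n)).
Qed.

Lemma vl_tmap j w : vl j w = T j (vl 0%N w).
Proof. by elim: j => [//|j IH]; case: HQ => _ _ _ /(_ j w) -> _; rewrite IH. Qed.

Lemma weak_cvg_R (f : X -> R) : continuous f -> (forall x, 0 <= f x <= 1) ->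
  (fun n => \int[P0 n]_x f x) @ \oo --> \int[P0lim]_x f x.
Proof.
move=> cf f01; have b x : `|f x| <= 1 by have /andP[f0 f1] := f01 x; rewrite ger0_norm.
have := weakP0 f cf (ex_intro _ 1 b).
rewrite (prob_EFin P0lim (measurable_continuous_Borel cf) b).
by move/fine_cvg.
Qed.

(** By [seqcont_small], G(v) may be replaced by h(v_1) at small cost; the expectation then factors
    exactly and each factor converges, by [EB_cvg] for the length and by weak convergence for the
    atoms. For the limit process the replacement is an identity. *)
Lemma mixed_cvg (G : (nat -> R) -> R) (f : nat -> X -> R) k :
  seqcont G -> (forall y, (forall j, 0 <= y j <= 1) -> 0 <= G y <= 1) ->
  (forall j, continuous (f j)) -> (forall j x, 0 <= f j x <= 1) ->
  (fun n => \int[Pr n]_w (G (fun j => v n j w) * \prod_(i < k.+1) f i (th n i w))) @ \oo -->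
  \int[Q]_w (G (fun j => vl j w) * \prod_(i < k.+1) f i (thl i w)).
Proof.
move=> cG G01 cf f01.
pose h x := G (fun j => T j (clip x)).
have h01 x : 0 <= h x <= 1.
  by apply: G01 => j; apply: tmap_itv => //; exact: clip_itv.
have mh : measurable_fun setT h.
  apply: continuous_measurable_fun => x; apply/(@cvg_nbhsP _ R^o) => un unx.
  apply: cG => j; apply: tmap_seq_cvg => //.
  by apply: (@continuous_cvg _ _ _ _ _ _ clip) => //; exact: clip_continuous.
have mf j : measurable_fun setT (f j : Borel X -> R) by exact: measurable_continuous_Borel.
have [a0 b0] := pos 0%N.
have norm01 (x : R) : 0 <= x <= 1 -> `|x| <= 1 by move=> /andP[x0 x1]; rewrite ger0_norm.
have -> : \int[Q]_w (G (fun j => vl j w) * \prod_(i < k.+1) f i (thl i w)) =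
    EB (alpha 0%N) (beta 0%N) h * \prod_(i < k.+1) \int[P0lim]_x f i x.
  have [_ mvl0 _ _ ind] := HQ.
  rewrite -(indep_factor a0 b0 mvl0 mthl ind k mf f01 mh h01).
  apply: eq_Rintegral => w _; congr (_ * _); rewrite /h clipE//.
  by congr G; apply/funext => j; exact: vl_tmap.
have E n := indep_factor (posn n 0%N).1 (posn n 0%N).2 (mv n 0%N) (mth n) (@BMSB_indep n) k mf f01 mh h01.
have cB : (fun n => EB (al n 0%N) (be n 0%N) h * \prod_(i < k.+1) \int[P0 n]_x f i x) @ \oo -->
    EB (alpha 0%N) (beta 0%N) h * \prod_(i < k.+1) \int[P0lim]_x f i x.
  apply: cvgM.
    apply: (@EB_cvg _ _ _ _ _ (fun=> h) h 1) => //.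
    - by move=> _ x; exact: norm01.
    - by move=> x; exact: norm01.
    - by apply: aeW => x _; exact: cvg_cst.
  apply: (@prod_cvg _ _ (fun n i => \int[P0 n]_x f i x) (fun i => \int[P0lim]_x f i x)) => i.
  exact: weak_cvg_R.
apply/cvgrPdist_lt => e e0.
(* The budget is e/4 for the factored limit, e/4 off the exceptional event and 2 (e/8) on it. *)
have e4 : 0 < e / 4 by lra.
have e8 : 0 < e / 8 by lra.
move/cvgrPdist_lt : cB => /(_ _ e4) near1.
have near2 := seqcont_small HB HN ala beb pos v01 cG e4 e8.
near=> n.
have h1 : `|EB (alpha 0%N) (beta 0%N) h * \prod_(i < k.+1) \int[P0lim]_x f i x -
   EB (al n 0%N) (be n 0%N) h * \prod_(i < k.+1) \int[P0 n]_x f i x| < e / 4 by near: n.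
have [B [mB PB HBn]] : exists B : set (Om n), [/\ measurable B, (Pr n B <= (e / 8)%:E)%E &
    forall w, ~ B w -> `|G (fun j => v n j w) - G (fun j => T j (v n 0%N w))| <= e / 4] by near: n.
have mF : measurable_fun setT (fun w => \prod_(i < k.+1) f i (th n i w)).
  apply: measurable_prod => i _ /=.
  exact: (measurableT_comp (f := f i : Borel X -> R) (mf i) (mth n i)).
have F01 w : 0 <= \prod_(i < k.+1) f i (th n i w) <= 1.
  rewrite prodr_ge0/=; last by move=> i _; case/andP: (f01 i (th n i w)).
  by apply: prodr_ile1 => i _; exact: f01.
have prod1 (x y : R) : 0 <= x <= 1 -> 0 <= y <= 1 -> `|x * y| <= 1.
  by move=> x01 y01; rewrite normrM mulr_ile1 ?normr_ge0 ?norm01.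
have := @prob_dist_le _ _ _ (Pr n) (fun w => G (fun j => v n j w) * \prod_(i < k.+1) f i (th n i w))
  (fun w => h (v n 0%N w) * \prod_(i < k.+1) f i (th n i w)) 1 (e / 4) B.
rewrite E => /(_ _ _ _ _ mB (ltW e4) _) h2.
have {h2} : `|\int[Pr n]_w (G (fun j => v n j w) * \prod_(i < k.+1) f i (th n i w)) -
     EB (al n 0%N) (be n 0%N) h * \prod_(i < k.+1) \int[P0 n]_x f i x| <= e / 4 + 2 * 1 * fine (Pr n B).
  apply: h2.
  - apply: measurable_funM => //; exact: (measurable_seqcont cG (mv n) (v01 n)).
  - apply: measurable_funM => //; exact: (measurableT_comp mh (mv n 0%N)).
  - by move=> w; apply: prod1 => //; apply: G01 => j; exact: v01.
  - by move=> w; exact: prod1.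
  - move=> w nB; rewrite -mulrBl normrM -[leRHS]mulr1; apply: ler_pM => //; last exact: norm01.
    have := HBn w nB; rewrite /h clipE//.
have : fine (Pr n B) <= e / 8 by rewrite -lee_fin fineK// fin_num_measure.
move: h1; move: (fine _) (EB (al n 0%N) _ _ * _) (EB _ _ _ * _) (\int[_]_w _) => p bn l an h1 hp h2.
have := ler_normD (l - bn) (bn - an); rewrite subrKA [`|bn - an|]distrC.
lra.
Unshelve. all: by end_near. Qed.

Let mvl0 : measurable_fun setT (vl 0%N). Proof. by case: HQ. Qed.

Let vl01j j w : 0 <= vl j w <= 1.
Proof. by rewrite vl_tmap; apply: tmap_itv. Qed.

Let mvl j : measurable_fun setT (vl j).
Proof.
have -> : vl j = tmap alpha beta j \o vl 0%N by apply/funext => w; exact: vl_tmap.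
apply: measurableT_comp => //; apply: continuous_measurable_fun; exact: tmap_continuous.
Qed.

Lemma seqcont_BMSB_cvg (G : (nat -> R) -> R) :
  seqcont G -> (forall y, (forall j, 0 <= y j <= 1) -> 0 <= G y <= 1) ->
  (fun n => \int[Pr n]_w G (fun j => v n j w)) @ \oo --> \int[Q]_w G (fun j => vl j w).
Proof.
move=> cG G01; have := @mixed_cvg G (fun _ _ => 1) 0 cG G01.
have E d' (T' : measurableType d') (P : probability T' R) (F : T' -> R) :
    \int[P]_w (F w * \prod_(i < 1) 1) = \int[P]_w F w.
  by apply: eq_Rintegral => w _; rewrite big1 ?mulr1.
have -> : (fun n => \int[Pr n]_w G (fun j => v n j w)) =
    (fun n => \int[Pr n]_w (G (fun j => v n j w) * \prod_(i < 1) 1)) by apply/funext => n; rewrite E.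
rewrite -(E _ _ Q (fun w => G (fun j => vl j w))); apply => [j x|j x]; [exact: cvg_cst|by rewrite ler01 lexx].
Qed.

Lemma rest_cvg k : (fun n => \int[Pr n]_w \prod_(i < k) (1 - v n i w)) @ \oo -->
  \int[Q]_w \prod_(i < k) (1 - vl i w).
Proof.
apply: (seqcont_BMSB_cvg (@seqcont_prod1B R k)) => y y01; exact: sbs_prod01.
Qed.

(** The divergence hypothesis [H2] enters here: off the preimage of its null set the remaining mass
    tends to 0 pointwise, and dominated convergence by 1 concludes. *)
Lemma limit_rest_cvg0 : (fun k => \int[Q]_w \prod_(i < k) (1 - vl i w)) @ \oo --> (0 : R).
Proof.
pose F k w := \prod_(i < k) (1 - vl i w).
have F01 k w : 0 <= F k w <= 1 by exact: (sbs_prod01 k (fun j => vl01j j w)).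
have FM k w : `|F k w| <= 1 by exact: norm01_le1.
have mF k : measurable_fun setT (F k).
  by apply: measurable_prod => i _; exact: measurable_funB.
have [S [mS [S0 HS]]] := H2.
have ae0 : {ae Q, forall w, setT w -> (fun k => (F k w)%:E) @ \oo --> (0 : \bar R)%E}.
  exists (vl 0%N @^-1` S); split.
  - by rewrite -[_ @^-1` _]setTI; exact: mvl0.
  - have [_ _ _ _ /(_ 0%N S (fun=> setT) mS (fun=> measurableT))] := HQ.
    rewrite S0 mul0e => <-; congr (Q _); apply/seteqP; split => w //=; by case.
  - move=> w /= nc; apply: contrapT => nS; apply: nc => _; apply: cvg_EFin; first exact: nearW.
    apply: (prod1B_cvg0 (fun j => vl01j j w)).
    rewrite (_ : (fun j => vl j w) = fun j => betaQ (alpha j) (beta j) (betaCDF (alpha 0%N) (beta 0%N) (vl 0%N w))).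
      exact: HS.
    by apply/funext => j; rewrite vl_tmap; apply: tmapE.
have i1 : Q.-integrable setT (EFin \o (fun=> 1)) by apply: (prob_integrable Q (M := 1)) => // w; rewrite normr1.
have [|||_ _] := @dominated_convergence _ _ _ Q setT measurableT (fun k w => (F k w)%:E) (fun=> 0%E) _ _ _ ae0 i1.
- by move=> k; apply/measurable_EFinP.
- exact: measurable_cst.
- by apply: aeW => w k _; rewrite lee_fin.
rewrite integral0 => /fine_cvg; exact.
Qed.

Section UnitRange.
Variable f : X -> R.
Hypothesis cf : continuous f.
Hypothesis f01 : forall x, 0 <= f x <= 1.

(** Every term of [pow_sum_expand] is a function of the lengths times a product of powers of [f]
    over distinct atoms, the shape treated by [mixed_cvg]. *)
Lemma truncated_moment_cvg k p :
  (fun n => \int[Pr n]_w (\sum_(j < k.+1) sbs (fun i => v n i w) j * f (th n j w)) ^+ p) @ \oo -->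
  \int[Q]_w (\sum_(j < k.+1) sbs (fun i => vl i w) j * f (thl j w)) ^+ p.
Proof.
pose m (phi : {ffun 'I_p -> 'I_k.+1}) (j : nat) := #|[pred i | phi i == j :> nat]|.
pose G (phi : {ffun 'I_p -> 'I_k.+1}) (y : nat -> R) := \prod_i sbs y (phi i).
have cG phi : seqcont (G phi).
  move=> y y0 yy0; rewrite /G; elim: (index_enum _) => [|i r IH].
    by rewrite big_nil; under eq_fun do rewrite big_nil; exact: cvg_cst.
  rewrite big_cons; under eq_fun do rewrite big_cons.
  by apply: cvgM => //; exact: seqcont_sbs.
have G01 phi y : (forall j, 0 <= y j <= 1) -> 0 <= G phi y <= 1.
  move=> y01; rewrite prodr_ge0/=; last by move=> i _; case/andP: (sbs01 (phi i) y01).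
  by apply: prodr_ile1 => i _; exact: sbs01.
have mf : measurable_fun setT (f : Borel X -> R) by exact: measurable_continuous_Borel.
have E d' (T' : measurableType d') (P : probability T' R) (y : nat -> T' -> R) (t : nat -> T' -> Borel X) :
    (forall j, measurable_fun setT (y j)) -> (forall j, measurable_fun setT (t j)) ->
    (forall j w, 0 <= y j w <= 1) ->
    \int[P]_w (\sum_(j < k.+1) sbs (fun i => y i w) j * f (t j w)) ^+ p =
    \sum_(phi : {ffun 'I_p -> 'I_k.+1}) \int[P]_w (G phi (fun i => y i w) *
      \prod_(j < k.+1) f (t j w) ^+ m phi j).
  move=> my mt y01; rewrite -prob_Rintegral_sum.
  - by apply: eq_Rintegral => w _; exact: (pow_sum_expand (fun i => y i w) (fun j => f (t j w))).
  - move=> phi; apply: measurable_funM.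
      by apply: measurable_prod => i _; exact: measurable_sbs.
    apply: measurable_prod => i _; apply: measurable_funX.
    exact: (measurableT_comp mf (mt i)).
  - move=> phi; exists 1 => w; rewrite normrM mulr_ile1 ?normr_ge0 ?norm01_le1//; first exact: G01.
    rewrite prodr_ge0/=; last by move=> i _; case/andP: (expr01 (m phi i) (f01 (t i w))).
    by apply: prodr_ile1 => i _; exact: expr01.
rewrite E//; under eq_fun do rewrite E//.
apply: sum_cvg => phi.
apply: (@mixed_cvg (G phi) (fun j x => f x ^+ m phi j) k (cG phi) (G01 phi)).
  move=> j x; apply: (@continuous_comp _ _ _ f (fun z : R => z ^+ m phi j)); [exact: cf|exact: exprn_continuous].
by move=> j x; exact: expr01.
Qed.

Lemma fine_integral01 (P : probability (Borel X) R) : 0 <= fine (\int[P]_x (f x)%:E)%E <= 1.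
Proof.
have mf : measurable_fun setT (f : Borel X -> R) by exact: measurable_continuous_Borel.
have fM x : `|f x| <= 1 by exact: norm01_le1.
rewrite -/(Rintegral _ _ _); apply/andP; split.
  by apply: Rintegral_ge0 => x _; case/andP: (f01 x).
rewrite -[leRHS](prob_Rintegral_cst P); apply: le_Rintegral => //.
- exact: (prob_integrable P mf fM).
- by apply: (prob_integrable P (M := 1)) => // x; rewrite normr1.
- by move=> x _; case/andP: (f01 x).
Qed.

(** On [0, 1] the p-th power is p-Lipschitz, so the pointwise bound [sb_mean_trunc] passes to
    moments. The probability space is arbitrary, to serve the approximating processes and the limit
    alike. *)
Lemma sb_integral_trunc_moment d' (T' : measurableType d') (P : probability T' R)
  (P1 : probability (Borel X) R) (y : nat -> T' -> R) (t : nat -> T' -> Borel X) k p :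
  (forall j, measurable_fun setT (y j)) -> (forall j, measurable_fun setT (t j)) ->
  (forall j w, 0 <= y j w <= 1) ->
  [/\ measurable_fun setT (sb_integral P1 y t f),
      forall w, 0 <= sb_integral P1 y t f w <= 1 &
  `|\int[P]_w (sb_integral P1 y t f w) ^+ p -
    \int[P]_w (\sum_(j < k) sbs (fun i => y i w) j * f (t j w)) ^+ p| <=
  p%:R * \int[P]_w \prod_(i < k) (1 - y i w)].
Proof.
move=> my mt y01; have c01 := fine_integral01 P1; set c := fine _ in c01.
have mf : measurable_fun setT (f : Borel X -> R) by exact: measurable_continuous_Borel.
have mft j : measurable_fun setT (fun w => f (t j w)) by exact: (measurableT_comp mf (mt j)).
have mI : measurable_fun setT (sb_integral P1 y t f).
  exact: (measurable_sb_mean c my mft y01 (fun j w => f01 (t j w))).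
have tr w := sb_mean_trunc k (fun j => y01 j w) (fun j => f01 (t j w)) c01.
have I01 w : 0 <= sb_integral P1 y t f w <= 1.
  exact: (sb_mean01 (fun j => y01 j w) (fun j => f01 (t j w)) c01).
have S01 w : 0 <= \sum_(j < k) sbs (fun i => y i w) j * f (t j w) <= 1.
  apply/andP; split.
    apply: sumr_ge0 => j _; apply: mulr_ge0; first by case/andP: (sbs01 j (fun j => y01 j w)).
    by case/andP: (f01 (t j w)).
  have /andP[h _] := tr w; rewrite subr_ge0 in h; apply: (le_trans h).
  by case/andP: (I01 w).
split => //; apply: (@prob_dist_le_scaled _ _ _ P _ _ _ 1).
- exact: measurable_funX.
- apply: measurable_funX; apply: measurable_sum => j; apply: measurable_funM => //; exact: measurable_sbs.
- by apply: measurable_prod => i _; exact: measurable_funB.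
- by move=> w; apply/norm01_le1/expr01.
- by move=> w; apply/norm01_le1/expr01.
- by move=> w; apply/norm01_le1/(sbs_prod01 k (fun j => y01 j w)).
move=> w; apply: (le_trans (exprn_lip01 p (I01 w) (S01 w))).
apply: ler_wpM2l => //; have /andP[h1 h2] := tr w; rewrite ger0_norm; [exact: h2|exact: h1].
Qed.

Lemma sb_integral_moment_cvg p :
  (fun n => \int[Pr n]_w (sb_integral (P0 n) (v n) (th n) f w) ^+ p) @ \oo --> \int[Q]_w (sb_integral P0lim vl thl f w) ^+ p.
Proof.
(* The denominator p + 1 admits p = 0 and gives p e' <= e / 4. The level k makes the remaining mass
   of the limit less than e', hence less than 2 e' for large n; the total is e/4 for the truncated
   moments plus 3 p e'. *)
apply/cvgrPdist_lt => e e0; pose e' := e / 4 / p.+1%:R.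
have e'0 : 0 < e' by rewrite !divr_gt0.
have pe' : p%:R * e' <= e / 4.
  by rewrite /e' mulrA ler_pdivrMr// mulrC ler_wpM2l ?ler_nat// divr_ge0// ltW.
have := limit_rest_cvg0; move/cvgrPdist_lt/(_ _ e'0) => [k _ /(_ k.+1 (leqnSn k))/=].
rewrite sub0r normrN => hk.
have WQ0 : 0 <= \int[Q]_w \prod_(i < k.+1) (1 - vl i w).
  by apply: Rintegral_ge0 => w _; case/andP: (sbs_prod01 k.+1 (fun j => vl01j j w)).
rewrite ger0_norm// in hk.
have /cvgrPdist_lt/(_ _ e'0) near1 := @rest_cvg k.+1.
have e4 : 0 < e / 4 by lra.
have /cvgrPdist_lt/(_ _ e4) near2 := @truncated_moment_cvg k p.
have [_ _ hQ] := sb_integral_trunc_moment Q P0lim k.+1 p mvl mthl vl01j.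
near=> n.
have [_ _ hn] := sb_integral_trunc_moment (Pr n) (P0 n) k.+1 p (mv n) (mth n) (v01 n).
have h1 : `|\int[Q]_w \prod_(i < k.+1) (1 - vl i w) - \int[Pr n]_w \prod_(i < k.+1) (1 - v n i w)| < e' by near: n.
have h2 : `|\int[Q]_w (\sum_(j < k.+1) sbs (fun i => vl i w) j * f (thl j w)) ^+ p -
  \int[Pr n]_w (\sum_(j < k.+1) sbs (fun i => v n i w) j * f (th n j w)) ^+ p| < e / 4 by near: n.
move: hn hQ h1 h2 hk WQ0.
set a1 := \int[_]_w _; set a2 := \int[_]_w _; set a3 := \int[_]_w _.
set b1 := \int[_]_w _; set b2 := \int[_]_w _; set b3 := \int[_]_w _.
move: a1 a2 a3 b1 b2 b3 => a1 a2 a3 b1 b2 b3 hn hQ h1 h2 hk WQ0.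
have p0 : 0 <= p%:R :> R by [].
move: (p%:R : R) p0 pe' hn hQ => q q0 pe' hn hQ.
have : q * a3 <= 2 * (q * e').
  by rewrite mulrCA; apply: ler_wpM2l => //; move: h1; rewrite ltr_norml; lra.
have : q * b3 <= q * e' by apply: ler_wpM2l => //; exact: ltW.
move: (q * a3) (q * b3) (q * e') hn hQ pe' => x y z.
move: h2; rewrite !ltr_norml !ler_norml => /andP[? ?] /andP[? ?] /andP[? ?] ? ? ?.
by apply/andP; split; lra.
Unshelve. all: by end_near. Qed.

Lemma sb_integral_cvg01 (g : R -> R) (M : R) : continuous g -> (forall x, `|g x| <= M) ->
  (fun n => \int[Pr n]_w g (sb_integral (P0 n) (v n) (th n) f w)) @ \oo --> \int[Q]_w g (sb_integral P0lim vl thl f w).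
Proof.
have hY n := sb_integral_trunc_moment (Pr n) (P0 n) 0 0 (mv n) (mth n) (v01 n).
have [mZ Z01 _] := sb_integral_trunc_moment Q P0lim 0 0 mvl mthl vl01j.
apply: moments_cvg => //.
- by move=> n; case: (hY n).
- by move=> n; case: (hY n).
- exact: sb_integral_moment_cvg.
Qed.

End UnitRange.

Lemma sb_integral_affine d' (T' : measurableType d') (P1 : probability (Borel X) R)
  (y : nat -> T' -> R) (t : nat -> T' -> Borel X) (f : X -> R) (r s : R) w :
  continuous f -> (forall x, 0 <= f x <= 1) -> (forall j w, 0 <= y j w <= 1) ->
  sb_integral P1 y t (fun x => r * f x + s) w = r * sb_integral P1 y t f w + s.
Proof.
move=> cf f01 y01.
have mf : measurable_fun setT (f : Borel X -> R) by exact: measurable_continuous_Borel.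
have fM x : `|f x| <= 1 by exact: norm01_le1.
have iF := prob_integrable P1 mf fM.
have mrf : measurable_fun setT (fun x : Borel X => r * f x) by exact: measurable_funM.
have rfM x : `|r * f x| <= `|r| by rewrite normrM -[leRHS]mulr1 ler_wpM2l.
rewrite -(sb_mean_affine _ _ _ (fun j => y01 j w) (fun j => f01 (t j w))).
rewrite /sb_integral /sb_mean; congr (_ + _ * _).
rewrite -[LHS]/(\int[P1]_x (r * f x + s)) RintegralD//.
- by rewrite RintegralZl// prob_Rintegral_cst.
- exact: (prob_integrable P1 mrf rfM).
- exact: (prob_integrable P1 (M := `|s|)).
Qed.

(** An affine change brings [f] into [0, 1], where the moment argument applies; the test function
    absorbs the inverse change. *)
Lemma sb_cvg_dist (f : X -> R) : continuous f -> bdd_fun f ->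
  cvg_dist Pr (fun n => sb_integral (P0 n) (v n) (th n) f) Q (sb_integral P0lim vl thl f).
Proof.
move=> cf [M fM]; have M0 : 0 <= M by exact: le_trans (fM point).
pose r := 2 * (M + 1); pose s := - (M + 1).
pose f' x := (f x + (M + 1)) / r.
have f'01 x : 0 <= f' x <= 1 by exact: affine_to01.
have cf' : continuous f'.
  by move=> x; apply: cvgM; [apply: cvgD; [exact: cf|exact: cvg_cst]|exact: cvg_cst].
have fE : f = fun x => r * f' x + s by apply/funext => x; rewrite affine_to01K.
move=> g cg [C gC].
pose g' x := g (r * x + s).
have cg' : continuous g'.
  move=> x; apply: (@continuous_comp _ _ _ (fun x : R => r * x + s) g); last exact: cg.
  by apply: cvgD; [apply: cvgM; [exact: cvg_cst|exact: cvg_id]|exact: cvg_cst].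
have g'C x : `|g' x| <= C by exact: gC.
have mg' : measurable_fun setT g' by exact: continuous_measurable_fun.
have [mZ _ _] := sb_integral_trunc_moment cf' f'01 Q P0lim 0 0 mvl mthl vl01j.
have EZ : (\int[Q]_w (g (sb_integral P0lim vl thl f w))%:E =
   (\int[Q]_w g' (sb_integral P0lim vl thl f' w))%:E)%E.
  rewrite -(prob_EFin Q (measurableT_comp mg' mZ) (fun w => g'C _)).
  by apply: eq_integral => w _; rewrite fE (sb_integral_affine _ _ _ _ _ cf' f'01 vl01j).
have EY n : (\int[Pr n]_w (g (sb_integral (P0 n) (v n) (th n) f w))%:E =
   (\int[Pr n]_w g' (sb_integral (P0 n) (v n) (th n) f' w))%:E)%E.
  have [mY _ _] := sb_integral_trunc_moment cf' f'01 (Pr n) (P0 n) 0 0 (mv n) (mth n) (v01 n).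
  rewrite -(prob_EFin (Pr n) (measurableT_comp mg' mY) (fun w => g'C _)).
  by apply: eq_integral => w _; rewrite fE (sb_integral_affine _ _ _ _ _ cf' f'01 (v01 n)).
rewrite EZ; under eq_fun do rewrite EY.
apply: cvg_EFin; first exact: nearW.
exact: (sb_integral_cvg01 cf' f'01 cg' g'C).
Qed.

(** A continuous function of the weights, rescaled to [0, 1], is a sequentially continuous function
    of the lengths. *)
Lemma sbw_cvg_dist :
  cvg_dist_seq Pr (fun n w => (fun j => sbw (v n) j w) : {ptws nat -> R})
    Q (fun w => (fun j => sbw vl j w) : {ptws nat -> R}).
Proof.
move=> g cg [M gM]; have M0 : 0 <= M by exact: le_trans (gM point).
pose r := 2 * (M + 1); pose s := - (M + 1).
pose G (y : nat -> R) := (g (sbs y : {ptws nat -> R}) + (M + 1)) / r.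
have cG : seqcont G.
  move=> y y0 yy0; apply: cvgM; last exact: cvg_cst.
  apply: cvgD; last exact: cvg_cst.
  apply: (@continuous_cvg _ _ _ _ _ _ g); first exact: cg.
  apply: (@ptws_seq_cvg R (fun k => sbs (y k)) (sbs y0)) => j.
  exact: seqcont_sbs.
have G01 y : 0 <= G y <= 1 by exact: affine_to01.
have E d' (T' : measurableType d') (P : probability T' R) (y : nat -> T' -> R) :
    (forall j, measurable_fun setT (y j)) -> (forall j w, 0 <= y j w <= 1) ->
    (\int[P]_w (g ((fun j => sbw y j w) : {ptws nat -> R}))%:E =
     (r * \int[P]_w G (fun j => y j w) + s)%:E)%E.
  move=> my y01; have mG := measurable_seqcont cG my y01.
  have bG w : `|G (fun j => y j w)| <= 1 by apply: norm01_le1; exact: G01.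
  have iG := prob_integrable P mG bG.
  have mrG : measurable_fun setT (fun w => r * G (fun j => y j w)) by exact: measurable_funM.
  have brG w : `|r * G (fun j => y j w)| <= `|r| by rewrite normrM -[leRHS]mulr1 ler_wpM2l.
  transitivity (\int[P]_w (r * G (fun j => y j w) + s))%:E%E; last first.
    rewrite RintegralD//; first by rewrite RintegralZl// prob_Rintegral_cst.
    - exact: (prob_integrable P mrG brG).
    - exact: (prob_integrable P (M := `|s|)).
  rewrite -(@prob_EFin _ _ _ P _ (`|r| + `|s|)).
  - by apply: eq_integral => w _; rewrite affine_to01K.
  - exact: measurable_funD.
  - by move=> w; rewrite (le_trans (ler_normD _ _))// lerD2r.
rewrite (E _ _ Q vl mvl vl01j); under eq_fun do rewrite (E _ _ _ _ (mv _) (v01 _)).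
apply: cvg_EFin; first exact: nearW.
apply: cvgD; last exact: cvg_cst.
apply: cvgM; first exact: cvg_cst.
exact: (seqcont_BMSB_cvg cG (fun y _ => G01 y)).
Qed.

End ProcessConvergence.

Lemma measure_eq_off_null {R : realType} d (T : measurableType d)
  (mu : {measure set T -> \bar R}) (E A B : set T) :
  measurable E -> mu E = 0%E -> measurable A -> measurable B ->
  (forall w, ~ E w -> A w <-> B w) -> mu A = mu B.
Proof.
move=> mE E0 mA mB AB; rewrite -(setIT A) -(setIT B) -!integral_indic//.
apply: (integral_off_null mE E0) => w nE; rewrite !indicE; suff -> : (w \in A) = (w \in B) by [].
by apply/idP/idP => /set_mem /(AB w nE) /mem_set.
Qed.

(** * Stochastic monotonicity of Beta laws in the second parameter *)

Section BetaFacts.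
Context {R : realType}.
Implicit Types a b s x : R.

Lemma betaM_off01 a b : 0 < a -> 0 < b -> betaM a b (~` `]0, 1[%classic) = 0%E.
Proof.
move=> a0 b0; rewrite /betaM (@betaI_EB _ _ _ _ (fun=> 1) 1)//; last 2 first.
- exact: measurableC.
- by move=> x; rewrite normr1.
rewrite (@EB_eq _ _ _ _ (fun=> 0)).
  by rewrite EB.unlock BI.unlock; under eq_Rintegral do rewrite mul0r; rewrite Rintegral_cst// !mul0r.
by move=> x x01; rewrite indicE memNset ?mulr0//= in_itv/= => /(_ x01).
Qed.

Lemma betaI_cst a b (A : set R) (c : R) : 0 < a -> 0 < b -> measurable A ->
  betaI a b A (fun=> c%:E) = (c%:E * betaM a b A)%E.
Proof.
move=> a0 b0 mA; rewrite /betaM (@betaI_EB _ _ _ _ (fun=> 1) 1)//; last by move=> x; rewrite normr1.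
rewrite (@betaI_EB _ _ _ _ (fun=> c) `|c|)// -EFinM EB.unlock mulrA.
have mI : measurable_fun setT (\1_A : R -> R) by exact: measurable_indic.
have mI1 : measurable_fun setT (fun x => 1 * \1_A x : R) by exact: measurable_funM.
have bI (x : R) : `|1 * \1_A x : R| <= 1 by rewrite mul1r indic_norm_le1.
rewrite -(BIZ c a0 b0 mI1 bI); congr (_ / _)%:E.
by congr BI; apply/funext => x; rewrite mul1r.
Qed.

Lemma betaM_fin a b (A : set R) : 0 < a -> 0 < b -> measurable A ->
  exists r : R, betaM a b A = r%:E.
Proof.
move=> a0 b0 mA; rewrite /betaM (@betaI_EB _ _ _ _ (fun=> 1) 1)//; first by eexists.
by move=> x; rewrite normr1.
Qed.

Lemma betaCDF_clip a b x : 0 < a -> 0 < b -> betaCDF a b (clip x) = betaCDF a b x.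
Proof.
move=> a0 b0; have [x0|x0] := leP x 0.
  by rewrite /clip max_r// min_l// !betaCDF_le0.
have [x1|x1] := leP 1 x; last by rewrite clipE// (ltW x0) (ltW x1).
by rewrite /clip max_l ?(ltW x0)// min_r// !betaCDF_ge1.
Qed.

Let tilt s x := (1 - clip x) `^ s.

Lemma BI_tilt a b s h : BI a (b + s) h = BI a b (fun x => tilt s x * h x).
Proof.
rewrite BI.unlock; apply: eq_Rintegral => x _.
have [x01|x01] := boolP (0 < x < 1); last by rewrite !beta_dens0// !mulr0.
have /andP[x0 x1] := x01.
rewrite !beta_densE// /tilt clipE ?(ltW x0) ?(ltW x1)//.
rewrite (_ : b + s - 1 = (b - 1) + s); last by ring.
rewrite [(1 - x) `^ (b - 1 + s)]powRD; first by ring.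
by apply/implyP => _; rewrite gt_eqF// subr_gt0.
Qed.

(* The two laws have likelihood ratio (1 - x)^s, which is decreasing. *)
Lemma betaCDF_shift_le a b s x : 0 < a -> 0 < b -> 0 <= s -> 0 <= x <= 1 ->
  betaCDF a b x <= betaCDF a (b + s) x.
Proof.
move=> a0 b0 s0 x01; have bs0 : 0 < b + s by exact: ltr_wpDr.
have t01 y : 0 <= tilt s y <= 1.
  have /andP[c0 c1] := clip_itv y.
  rewrite powR_ge0/=; have := @ge0_ler_powR R s s0 (1 - clip y) 1.
  rewrite !nnegrE subr_ge0 c1 ler01 powR1; apply => //; lra.
have mt : measurable_fun setT (tilt s).
  apply: (measurableT_comp (@measurable_powR R s)).
  by apply: measurable_funB => //; exact: measurable_clip.
have tanti y z : y <= z -> tilt s z <= tilt s y.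
  move=> yz; have /andP[? ?] := clip_itv y; have /andP[? ?] := clip_itv z.
  apply: ge0_ler_powR => //; rewrite ?nnegrE ?subr_ge0//.
  have : clip y <= clip z by rewrite /clip le_min2// le_max2.
  lra.
rewrite !betaCDFE//; set I : R -> R := \1__.
have I01 y : I y = if y <= x then 1 else 0.
  rewrite /I indicE; suff -> : (y \in `]-oo, x]%classic) = (y <= x) by case: (_ <= _).
  by apply/idP/idP => [/set_mem|h]; [rewrite /= in_itv|rewrite mem_set//= in_itv].
have mI : measurable_fun setT I by exact: measurable_indic_ray.
have mJ : measurable_fun setT (fun y => 1 - I y) by exact: measurable_funB.
have mtI : measurable_fun setT (fun y => tilt s y * I y) by exact: measurable_funM.
have mtJ : measurable_fun setT (fun y => tilt s y * (1 - I y)) by exact: measurable_funM.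
have mxI : measurable_fun setT (fun y => tilt s x * I y) by exact: measurable_funM.
have mxJ : measurable_fun setT (fun y => tilt s x * (1 - I y)) by exact: measurable_funM.
have i01 y : 0 <= I y <= 1 by rewrite I01; case: (y <= x); rewrite ?lexx ?ler01.
have j01 y : 0 <= 1 - I y <= 1 by have := i01 y; lra.
have prod_le1 (u w : R) : 0 <= u <= 1 -> 0 <= w <= 1 -> `|u * w| <= 1.
  by move=> u01 w01; rewrite normrM mulr_ile1 ?normr_ge0 ?norm01_le1.
have iM y : `|I y| <= 1 by exact: norm01_le1.
have jM y : `|1 - I y| <= 1 by exact: norm01_le1.
have C0 := beta_const_gt0 a0 b0; have K0 := beta_const_gt0 a0 bs0.
have CE : beta_const a b = BI a b I + BI a b (fun y => 1 - I y).
  rewrite beta_constE -(BID a0 b0 mI iM mJ jM); congr BI; apply/funext => y; ring.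
have KE : beta_const a (b + s) =
    BI a b (fun y => tilt s y * I y) + BI a b (fun y => tilt s y * (1 - I y)).
  rewrite beta_constE BI_tilt -(@BID _ _ _ _ _ 1 a0 b0 mtI _ mtJ).
  - by congr BI; apply/funext => y; ring.
  - by move=> y; exact: prod_le1.
  - by move=> y; exact: prod_le1.
have h1 : tilt s x * BI a b I <= BI a b (fun y => tilt s y * I y).
  rewrite -(BIZ _ a0 b0 mI iM); apply: (@le_BI _ _ _ _ _ 1 a0 b0 mxI _ mtI).
  - by move=> y; exact: prod_le1.
  - by move=> y; exact: prod_le1.
  move=> y _; rewrite I01; case: (leP y x) => [yx|_] /=; last by rewrite !mulr0.
  by rewrite !mulr1; exact: tanti.
have h2 : BI a b (fun y => tilt s y * (1 - I y)) <= tilt s x * BI a b (fun y => 1 - I y).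
  rewrite -(BIZ _ a0 b0 mJ jM); apply: (@le_BI _ _ _ _ _ 1 a0 b0 mtJ _ mxJ).
  - by move=> y; exact: prod_le1.
  - by move=> y; exact: prod_le1.
  move=> y _; rewrite I01; case: (leP y x) => [_|xy] /=; first by rewrite subrr !mulr0.
  by rewrite subr0 !mulr1; exact/tanti/ltW.
have q0 : 0 <= BI a b I by apply: ge0_BI => y _; case/andP: (i01 y).
have r0 : 0 <= BI a b (fun y => 1 - I y) by apply: ge0_BI => y _; case/andP: (j01 y).
(* Split at x, with t = [tilt s x]: the tilted mass below x is at least t times the original one,
   above x at most t times. After clearing denominators the comparison of the two distribution
   functions is this inequality. *)
have cheb (q r p p' t : R) : t * q <= p -> p' <= t * r -> 0 <= q -> 0 <= r ->
    q * (p + p') <= p * (q + r).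
  move=> h3 h4 q1 r1; rewrite !mulrDr (mulrC q p) lerD2l (le_trans (ler_wpM2l q1 h4))//.
  by rewrite mulrA (mulrC q t) ler_wpM2r.
rewrite EB.unlock BI_tilt (ler_pdivrMr _ _ C0) mulrAC (ler_pdivlMr _ _ K0) CE KE.
exact: (cheb _ _ _ _ _ h1 h2 q0 r0).
Qed.

End BetaFacts.

(** * Exceptional sets, clipping, monotone weights and the case N = 0 *)

Section LengthProcesses.
Context {R : realType} {X : completePseudoMetricType R}.
Context {d : measure_display} {Omega : measurableType d} (Pr : probability Omega R).
Implicit Types (al be : nat -> R) (v : nat -> Omega -> R) (th : nat -> Omega -> Borel X).

Lemma BMSB_exceptional N al be (P0 : probability (Borel X) R) v th : is_BMSB Pr N al be P0 v th ->
  exists E, [/\ measurable E, Pr E = 0%E & forall w, ~ E w -> forall j, 0 <= v j w <= 1].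
Proof.
move=> H; have [pos _ mv _ _] := H.
pose F j := [set w | ~ (0 < v j w < 1)].
have mF j : measurable (F j).
  rewrite (_ : F j = v j @^-1` (~` `]0, 1[%classic)).
    by rewrite -[X in measurable X]setTI; apply: mv => //; exact: measurableC.
  by apply/seteqP; split => w; rewrite /F /= in_itv.
exists (\bigcup_j F j); split.
- exact: bigcup_measurable.
- apply/(negligibleP _ (bigcup_measurable _)) => //; apply: negligible_bigcup => j.
  by apply/negligibleP => //; exact: BMSB_off01 H j.
- move=> w nE j; have : 0 < v j w < 1 by apply: contrapT => h; apply: nE; exists j.
  by move=> /andP[/ltW-> /ltW].
Qed.

Lemma BMSB_clip N al be (P0 : probability (Borel X) R) v th : is_BMSB Pr N al be P0 v th ->
  is_BMSB Pr N al be P0 (fun j w => clip (v j w)) th.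
Proof.
move=> H; have [E [mE E0 HE]] := BMSB_exceptional H; have [pos dP0 mv mth law] := H.
have mcv j : measurable_fun setT (fun w => clip (v j w)).
  exact: (measurableT_comp (@measurable_clip R) (mv j)).
split=> // k A B mA mB; rewrite -(law k A B mA mB).
have mS (y : nat -> Omega -> R) : (forall j, measurable_fun setT (y j)) ->
    measurable [set w | forall i, (i <= k)%N -> A i (y i w) /\ B i (th i w)].
  move=> my; rewrite (_ : [set w | _] = \bigcap_(i in `I_k.+1) (y i @^-1` A i `&` th i @^-1` B i)).
    apply: bigcap_measurable => [|i _]; first by exists 0%N.
    apply: measurableI; rewrite -[X in measurable X]setTI; first exact: my.
    exact: mth.
  by apply/seteqP; split => w /= h i ik; apply: h.
apply: (measure_eq_off_null mE E0 (mS _ mcv) (mS _ mv)) => w nE.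
by split => h i ik; have := h i ik; rewrite clipE//; exact: HE.
Qed.

(** Only the first length needs an exceptional set: all later ones are quantiles, which lie in
    [0, 1] at every sample point. *)
Lemma CDSB_exceptional al be (P0 : probability (Borel X) R) v th : (forall j, 0 < al j /\ 0 < be j) ->
  is_CDSB Pr al be P0 v th ->
  exists E, [/\ measurable E, Pr E = 0%E & forall w, ~ E w -> forall j, 0 <= v j w <= 1].
Proof.
move=> pos H; have [_ mv0 _ step law] := H; have [a0 b0] := pos 0%N.
have mC : measurable (~` `]0%R, 1%R[%classic : set R) by exact: measurableC.
exists (v 0%N @^-1` (~` `]0, 1[%classic)); split.
- by rewrite -[X in measurable X]setTI; exact: mv0.
- have := law 0%N _ (fun=> setT) mC (fun=> measurableT).
  rewrite betaM_off01// mul0e => <-; congr (Pr _).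
  by apply/seteqP; split => w //=; case.
- move=> w nE [|j].
    have : 0 < v 0%N w < 1 by apply: contrapT => h; apply: nE; rewrite /= in_itv.
    by move=> /andP[/ltW-> /ltW].
  rewrite step; have [aj bj] := pos j; have [aj' bj'] := pos j.+1.
  exact: (betaQ_itv aj' bj' (betaCDF_le1 _ aj bj)).
Qed.

(** The recursion holds everywhere by definition and must survive clipping: the distribution
    function ignores [clip], and quantiles are fixed by it. *)
Lemma CDSB_clip al be (P0 : probability (Borel X) R) v th : (forall j, 0 < al j /\ 0 < be j) ->
  is_CDSB Pr al be P0 v th -> is_CDSB Pr al be P0 (fun j w => clip (v j w)) th.
Proof.
move=> pos H; have [E [mE E0 HE]] := CDSB_exceptional pos H.
have [dP0 mv0 mth step law] := H.
have mcv0 : measurable_fun setT (fun w => clip (v 0%N w)).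
  exact: (measurableT_comp (@measurable_clip R) mv0).
split=> // [j w|k A B mA mB].
  have [aj bj] := pos j; have [aj' bj'] := pos j.+1.
  rewrite (betaCDF_clip _ aj bj) step; apply: clipE.
  exact: (betaQ_itv aj' bj' (betaCDF_le1 _ aj bj)).
rewrite -(law k A B mA mB).
have mS (y : Omega -> R) : measurable_fun setT y ->
    measurable [set w | A (y w) /\ forall i, (i <= k)%N -> B i (th i w)].
  move=> my; rewrite (_ : [set w | _] = y @^-1` A `&` \bigcap_(i in `I_k.+1) (th i @^-1` B i)).
    apply: measurableI; first by rewrite -[X in measurable X]setTI; exact: my.
    apply: bigcap_measurable => [|i _]; first by exists 0%N.
    by rewrite -[X in measurable X]setTI; exact: mth.
  by apply/seteqP; split => w /= [h1 h2]; split => // i ik; apply: h2.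
apply: (measure_eq_off_null mE E0 (mS _ mcv0) (mS _ mv0)) => w nE.
by rewrite /= clipE//; exact: HE.
Qed.

(** Raising the second parameter raises the distribution function, hence lowers the quantile:
    v_(j+1) <= v_j. The extra factor 1 - v_j then only helps. *)
Lemma CDSB_weights_decreasing al be (P0 : probability (Borel X) R) v th (a s : R) : (forall j, 0 < al j /\ 0 < be j) ->
  0 <= s -> (forall j, al j = a /\ be j.+1 = be j + s) -> is_CDSB Pr al be P0 v th ->
  {ae Pr, forall w, forall j, sbw v j.+1 w <= sbw v j w}.
Proof.
move=> pos s0 abE H; have [E [mE E0 HE]] := CDSB_exceptional pos H; have [_ _ _ step _] := H.
exists E; split => // w /= nh; apply: contrapT => nE; apply: nh => j.
have v01 := HE w nE; have [aj bj] := pos j.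
have vle : v j.+1 w <= v j w.
  rewrite step; have [-> ->] : al j.+1 = al j /\ be j.+1 = be j + s.
    by have [-> ->] := abE j; have [-> _] := abE j.+1.
  exact: (betaQ_le (v01 j) (betaCDF_shift_le aj bj s0 (v01 j))).
rewrite /sbw big_ord_recr/=; have /andP[p0 p1] := @sbs_prod01 R (fun i => v i w) j v01.
have /andP[y0 y1] := v01 j; have /andP[z0 z1] := v01 j.+1.
apply: ler_pM => //; first by rewrite mulr_ge0// subr_ge0.
by rewrite -[leRHS]mulr1 ler_wpM2l//; lra.
Qed.

(** For N = 0 the mixture has the single term z = 0 with coefficient 1, so the kernel forgets the
    state and the nested integrals become a product. *)
Lemma chainF_N0 al be (A : nat -> set R) (p : nat -> R) k j u : (forall j, 0 < al j /\ 0 < be j) ->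
  (forall i, measurable (A i)) -> (forall i, betaM (al i) (be i) (A i) = (p i)%:E) ->
  chainF 0 al be A k j u = (\prod_(i < k) p (j + i).+1)%:E.
Proof.
move=> pos mA pE; elim: k j u => [|k IH] j u; first by rewrite big_ord0.
have [a0 b0] := pos j.+1.
rewrite [LHS]/= /kerI big_ord1 bin0 !expr0 !mul1r mul1e !addr0.
rewrite (_ : chainF 0 al be A k j.+1 = fun=> (\prod_(i < k) p (j.+1 + i).+1)%:E); last first.
  by apply/funext => x; exact: IH.
rewrite (betaI_cst _ a0 b0 (mA j.+1)) pE -EFinM mulrC big_ord_recl addn0.
by congr (_ * _)%:E; apply: eq_bigr => i _; rewrite lift0 addnS addSn.
Qed.

Lemma BMSB0_law al be (P0 : probability (Borel X) R) v th k (A : nat -> set R) (B : nat -> set (Borel X)) :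
  is_BMSB Pr 0 al be P0 v th ->
  (forall i, measurable (A i)) -> (forall i, measurable (B i)) ->
  Pr [set w | forall i, (i <= k)%N -> A i (v i w) /\ B i (th i w)] =
  (\prod_(i < k.+1) betaM (al i) (be i) (A i) * \prod_(i < k.+1) P0 (B i))%E.
Proof.
move=> [pos _ _ _ law] mA mB; rewrite (law k A B mA mB); congr (_ * _)%E.
have [p pE] : exists p : nat -> R, forall i, betaM (al i) (be i) (A i) = (p i)%:E.
  exists (fun i => fine (betaM (al i) (be i) (A i))) => i; have [a0 b0] := pos i.
  by have [r ->] := betaM_fin a0 b0 (mA i).
have [a0 b0] := pos 0%N.
under [RHS]eq_bigr do rewrite pE.
rewrite (_ : chainF 0 al be A k 0 = fun=> (\prod_(i < k) p (0 + i).+1)%:E); last first.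
  by apply/funext => x; exact: (chainF_N0 k 0 x pos mA pE).
rewrite (betaI_cst _ a0 b0 (mA 0%N)) pE -EFinM mulrC.
rewrite big_ord_recl EFinM; congr (_ * _)%E; rewrite -prodEFin.
by apply: eq_bigr => i _; rewrite lift0 add0n.
Qed.

Lemma BMSB0_PY al be (P0 : probability (Borel X) R) v th (sig tht : R) :
  (forall j, al j = 1 - sig /\ be j = tht + j.+1%:R * sig) ->
  is_BMSB Pr 0 al be P0 v th -> is_PY Pr sig tht P0 v th.
Proof.
move=> abE H; have alE : al = fun=> 1 - sig by apply/funext => j; case: (abE j).
have beE : be = fun j => tht + j.+1%:R * sig by apply/funext => j; case: (abE j).
rewrite alE beE in H; have [_ d0 mv mth _] := H.
split; [exact: d0|exact: mv|exact: mth|move=> k A B mA mB].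
have E := BMSB0_law k H mA mB; cbv beta in E; exact E.
Qed.

End LengthProcesses.

(** * Return from clipped to original lengths, and the theorem *)

Section Transfer.
Context {R : realType} {X : completePseudoMetricType R}.
Context {d : measure_display} {T : measurableType d} (P : probability T R).

Lemma sb_integral_clip (P0 : probability (Borel X) R) (v : nat -> T -> R) (th : nat -> T -> Borel X)
  (f : X -> R) w : (forall j, 0 <= v j w <= 1) ->
  sb_integral P0 (fun j w => clip (v j w)) th f w = sb_integral P0 v th f w.
Proof.
move=> v01; rewrite -[LHS]/(sb_mean (fun j => clip (v j w)) (fun j => f (th j w)) _).
rewrite -[RHS]/(sb_mean (fun j => v j w) (fun j => f (th j w)) _).
by rewrite (_ : (fun j => clip (v j w)) = fun j => v j w)//; apply/funext => j; rewrite clipE.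
Qed.

Lemma sbw_clip (v : nat -> T -> R) w : (forall j, 0 <= v j w <= 1) ->
  (fun j => sbw (fun j w => clip (v j w)) j w) = (fun j => sbw v j w).
Proof.
move=> v01; rewrite -[LHS]/(sbs (fun j => clip (v j w))) -[RHS]/(sbs (fun j => v j w)).
by congr sbs; apply/funext => j; rewrite clipE.
Qed.

End Transfer.

Theorem mainTheorem12
  (R : realType) (X : completePseudoMetricType R)
  (hX : hausdorff_space X) (sepX : separable X)
  (dn : nat -> measure_display) (Om : forall n, measurableType (dn n))
  (Pr : forall n, probability (Om n) R)
  (N : nat -> nat) (al be : nat -> nat -> R)
  (P0 : nat -> probability (Borel X) R)
  (v : forall n, nat -> Om n -> R) (th : forall n, nat -> Om n -> Borel X)
  (alpha beta : nat -> R) (P0lim : probability (Borel X) R) :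
  (forall n, is_BMSB (Pr n) (N n) (al n) (be n) (P0 n) (v n) (th n)) ->
  (forall n, proper_sb (Pr n) (v n)) ->
  (* (H0) *)
  N 0%N = 0%N ->
  (forall M : nat, \forall n \near \oo, (M <= N n)%N) ->
  (* (H1) *)
  (forall j, (fun n => al n j) @ \oo --> alpha j) ->
  (forall j, (fun n => be n j) @ \oo --> beta j) ->
  (forall j, 0 < alpha j /\ 0 < beta j) ->
  (* (H2) *)
  (exists S : set R, measurable S /\ betaM (alpha 0) (beta 0) S = 0%E /\
     forall u, ~ S u ->
       series (fun j => betaQ (alpha j) (beta j) (betaCDF (alpha 0) (beta 0) u))
         @ \oo --> +oo) ->
  (* (H3) *)
  diffuse P0lim -> weak_cvg P0 P0lim ->
  (* (i) *)
  ((forall (k : nat) (A : nat -> set R), (forall i, measurable (A i)) ->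
      Pr 0 [set w | forall i, (i <= k)%N -> A i (v 0 i w)]
      = (\prod_(i < k.+1) betaM (al 0%N i) (be 0%N i) (A i))%E) /\
   (forall sig tht : R, 0 <= sig < 1 -> - sig < tht ->
      (forall j, al 0 j = 1 - sig /\ be 0 j = tht + j.+1%:R * sig) ->
      is_PY (Pr 0) sig tht (P0 0) (v 0) (th 0))) /\
  (* (ii) *)
  (forall (d : measure_display) (Omega : measurableType d)
      (Q : probability Omega R) (vl : nat -> Omega -> R)
      (thl : nat -> Omega -> Borel X),
    is_CDSB Q alpha beta P0lim vl thl ->
    [/\ (forall f : X -> R, continuous f -> bdd_fun f ->
           cvg_dist Pr (fun n => sb_integral (P0 n) (v n) (th n) f)
                    Q (sb_integral P0lim vl thl f)),
        cvg_dist_seq Pr (fun n w => (fun j => sbw (v n) j w) : {ptws nat -> R})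
                     Q (fun w => (fun j => sbw vl j w) : {ptws nat -> R}) &
        (forall sig tht : R, 0 <= sig < 1 -> - sig < tht ->
           (forall j, alpha j = 1 - sig /\ beta j = tht + j.+1%:R * sig) ->
           {ae Q, forall w, forall j, sbw vl j.+1 w <= sbw vl j w})]).
Proof.
move=> HB _ N0 HN ala beb pos H2 dP0 wP0; split.
  split.
    move=> k A mA; have H := HB 0%N; rewrite N0 in H.
    have := BMSB0_law k H mA (fun=> measurableT).
    rewrite [X in (_ * X)%E]big1 ?mule1; last by move=> i _; exact: probability_setT.
    move=> <-; congr (Pr 0%N _); apply/seteqP; split => w /= h i ik; first by split => //; exact: h.
    by case: (h i ik).
  move=> sig tht _ _ abE; have H := HB (0 : nat); have N0' : N (0 : nat) = 0%N := N0.
  by rewrite N0' in H; exact: (BMSB0_PY abE H).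
move=> d Omega Q vl thl HQ.
pose v' n j w := clip (v n j w); pose vl' j w := clip (vl j w).
have HB' n : is_BMSB (Pr n) (N n) (al n) (be n) (P0 n) (v' n) (th n) by exact: BMSB_clip.
have v01 n j w : 0 <= v' n j w <= 1 by exact: clip_itv.
have HQ' : is_CDSB Q alpha beta P0lim vl' thl by exact: CDSB_clip.
have vl01 w : 0 <= vl' 0%N w <= 1 by exact: clip_itv.
have [E [mE E0 HE]] := CDSB_exceptional pos HQ.
split.
- move=> f cf bf g cg bg.
  have := sb_cvg_dist HB' HN ala beb pos v01 H2 wP0 HQ' vl01 cf bf cg bg.
  rewrite (@integral_off_null _ _ _ Q E _ (fun w => (g (sb_integral P0lim vl thl f w))%:E) mE E0); last first.
    by move=> w nE; rewrite (sb_integral_clip _ _ _ (HE w nE)).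
  rewrite (_ : (fun n => _) = fun n => (\int[Pr n]_w (g (sb_integral (P0 n) (v n) (th n) f w))%:E)%E)//.
  (* The exceptional set may depend on n, since each expectation is altered separately. *)
  apply/funext => n; have [En [mEn En0 HEn]] := BMSB_exceptional (HB n).
  apply: (integral_off_null mEn En0) => w nE.
  by rewrite (sb_integral_clip _ _ _ (HEn w nE)).
- move=> g cg bg.
  have := sbw_cvg_dist HB' HN ala beb pos v01 wP0 HQ' vl01 cg bg.
  rewrite (@integral_off_null _ _ _ Q E _ (fun w => (g (fun j => sbw vl j w))%:E) mE E0); last first.
    by move=> w nE; rewrite (sbw_clip (HE w nE)).
  rewrite (_ : (fun n => _) = fun n => (\int[Pr n]_w (g (fun j => sbw (v n) j w))%:E)%E)//.
  apply/funext => n; have [En [mEn En0 HEn]] := BMSB_exceptional (HB n).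
  apply: (integral_off_null mEn En0) => w nE.
  by rewrite (sbw_clip (HEn w nE)).
- move=> sig tht /andP[sig0 _] _ abE.
  apply: (CDSB_weights_decreasing (a := 1 - sig) pos sig0 _ HQ) => j.
  have [-> ->] := abE j; have [_ ->] := abE j.+1; split; first by [].
  by rewrite -(@natr1 R j.+1) mulrDl mul1r addrA.
Qed.
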